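(* Let $p=p(n)\in(0,1)$ and $q=1/(1-p)$. For every fixed $\varepsilon>0$ there exists a sufficiently large constant $C_{\varepsilon}>0$ such that if $C_{\varepsilon}/n<p<1-\varepsilon$, then asymptotically almost surely (i.e. with probability tending to $1$ as $n\to\infty$) $$\left\lfloor 2\log_q\bigl(enp(1-\varepsilon)\bigr)+3\right\rfloor\le F(G(n,p))\le \left\lceil 2\log_q\bigl(enp(1+\varepsilon)\bigr)+3\right\rceil .$$
   Context: $G(n,p)$ is the binomial (Erdős–Rényi) random graph on vertex set $\{1,\dots,n\}$ in which each pair is an edge independently with probability $p$. For a graph $G$, $F(G)$ denotes the maximum number of vertices of an induced subgraph of $G$ that is a forest. *)

(* Defs.v *)
From HB Require Import structures.
From mathcomp Require Import all_boot all_order all_algebra.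
From mathcomp Require Import all_classical all_reals all_analysis.
Set Implicit Arguments.
Unset Strict Implicit.
Unset Printing Implicit Defensive.
Import Order.TTheory GRing.Theory Num.Theory.
Import numFieldNormedType.Exports.
Local Open Scope classical_set_scope.
Local Open Scope ring_scope.

(* A simple graph on the vertex set 'I_n is given by its edge set, a subset of
   [vpairs n]. *)
Definition vpairs (n : nat) : {set {set 'I_n}} :=
  [set e : {set 'I_n} | #|e| == 2%N]%SET.

Definition adj (n : nat) (E : {set {set 'I_n}}) : rel 'I_n :=
  fun x y => [set x; y]%SET \in E.

(* The induced subgraph on S is kept on the vertex set 'I_n: vertices outside S
   become isolated, which does not affect the existence of cycles. *)
Definition induced (n : nat) (E : {set {set 'I_n}}) (S : {set 'I_n}) :
    {set {set 'I_n}} :=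
  [set e in E | e \subset S]%SET.

Definition is_forest (n : nat) (E : {set {set 'I_n}}) : Prop :=
  forall c : seq 'I_n, (2 < size c)%N -> ~ ucycle (adj E) c.

Definition max_induced_forest (n : nat) (E : {set {set 'I_n}}) : nat :=
  \max_(S : {set 'I_n} | `[< is_forest (induced E S) >]) #|S|.

(* The probability that G(n,p) satisfies A. *)
Definition gnp_prob (R : realType) (n : nat) (p : R)
    (A : pred {set {set 'I_n}}) : R :=
  \sum_(E : {set {set 'I_n}} | (E \subset vpairs n) && A E)
    \prod_(e in vpairs n) (if e \in E then p else 1 - p).

Definition logb (R : realType) (b x : R) : R := ln x / ln b.

(* Main.v *)
(* Write q = 1/(1-p), D = np.

   Upper bound: a forest on a k-set S is the edge set of a parent function
   S -> S with one edge per non-fixed point, so the expected number of induced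
   forests of size k is at most C(n,k) q^(-C(k,2)) (1 + kp/(1-p))^k, which is
   exponentially small in k once k > 2 log_q(enp(1+eps)) + 3.

   Lower bound: apply the second moment method to pairs (S, f), with f a rooted
   tree on S.  Exactly |S|^(j-1) rooted trees contain a given rooted forest with
   j trees (Pitman's double counting).  If two trees f, f' induce the same graph
   on a set L of size l, then f' is determined on L by f and by the set of those
   vertices of L whose parent is not in L; this leaves at most C(l,j) choices,
   and C(l,j) <= t^j (1+1/t)^l with t a large constant, so it costs only a
   factor e^(O(l/t)).  If D >= n^(3/5) the ratio E[X^2]/(E X)^2 tends to 1.  If
   D <= n^(3/5) it is only exp(O(n log^2(D)/D^2)) times a polynomial in n; then
   we restrict S to transversals of blocks of about sqrt(D) vertices, so that
   re-sampling the edges of one block changes the size of the largest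
   transversal forest by at most 1 and a bounded difference inequality (with the
   slack between eps and eps/2) upgrades the small positive probability to
   probability tending to 1. *)

Require Import Defs.
From HB Require Import structures.
From mathcomp Require Import all_classical all_reals all_analysis.
From mathcomp Require Import all_boot all_order all_algebra.
From mathcomp Require Import zify ring lra.
Set Implicit Arguments.
Unset Strict Implicit.
Unset Printing Implicit Defensive.
Import Order.TTheory GRing.Theory Num.Theory.
Import numFieldNormedType.Exports.
Local Open Scope ring_scope.

(** * Random subsets of a finite set *)

Section RandomSubset.
Variables (R : realFieldType) (T : finType) (p : R).
Implicit Types (A B D E : {set T}) (u v : {set T} -> R).

(** Two random k-sets share about k^2/n vertices, where k is of order n log(D)/D, so about n
    log^2(D)/D^2 of them. This tends to 0 only when D is well above sqrt(n); 3/5 is a convenient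
    exponent above 1/2. For smaller D the second moment yields only a probability exp(-O(n
    log^2(D)/D^2)), which a concentration bound has to beat. The slack between eps and eps/2 is a
    number t of vertices of order n/D. With blocks of m vertices there are n/m independent colours,
    and the bounded difference exponent t^2/(n/m) is of order nm/D^2. For m = 1 this loses against
    log^2(D). For m near sqrt(D) it is n D^(-3/2), which wins once D exceeds a large constant and is
    at least n^(1/10) for D <= n^(3/5), so that it also beats powers of n. Blocks cannot be much
    larger: a transversal k-set needs room among n/m blocks, so km must be small compared to n, that
    is, m small compared to D/log(D). The concentration bound controls the product of an upper and a
    lower tail, so that a lower bound on the first gives an upper bound on the second without any
    estimate of the mean. *)

Definition weight D E : R := \prod_(e in D) (if e \in E then p else 1 - p).

Definition expect D u : R := \sum_(E : {set T} | E \subset D) weight D E * u E.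

(** Independence of the elements in [A] and outside [A]: Fubini, after reindexing [E] by its two
    traces. *)
Lemma expect_split D A u : A \subset D ->
  expect D u = expect A (fun B => expect (D :\: A) (fun B' => u (B :|: B'))).
Proof.
move=> sAD; rewrite /expect.
under [RHS]eq_bigr => B _ do rewrite mulr_sumr.
rewrite pair_big_dep /=.
rewrite (reindex_onto (fun x : {set T} * {set T} => x.1 :|: x.2)
           (fun E => (E :&: A, E :\: A))) /=; last first.
  by move=> E _; rewrite setID.
apply: eq_big => [[B B'] | [B B']] /=.
  apply/idP/idP.
    case/andP; rewrite subUset => /andP[_ sB'D] /eqP[<- <-].
    by rewrite subsetIr setSD // subUset (subset_trans (subsetIr _ _)).
  rewrite subsetD => /andP[sBA /andP[sB'D dis]].
  rewrite subUset (subset_trans sBA) //= sB'D /=.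
  have inB x : x \in B -> x \in A by apply: (subsetP sBA).
  have inB' x : x \in B' -> x \notin A by move: dis; rewrite disjoint_subset => /subsetP/(_ x).
  apply/eqP; congr (_, _); apply/setP => x; rewrite !inE; move: (inB x) (inB' x);
    case: (x \in B); case: (x \in B'); case: (x \in A) => //= H1 H2;
    by [have := H1 isT | have := H2 isT].
case/andP; rewrite subUset => /andP[_ sB'D] /eqP[eB eB'].
rewrite mulrA; congr (_ * _).
rewrite /weight (big_setID A) /= (setIidPr sAD); congr (_ * _).
  apply: eq_bigr => e eA; rewrite -{2}eB !inE.
  by rewrite eA andbT.
by apply: eq_bigr => e; rewrite !inE => /andP[eA _]; rewrite -{2}eB' !inE eA.
Qed.

Lemma expect_set1 e u : expect [set e] u = p * u [set e] + (1 - p) * u set0.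
Proof.
rewrite /expect (bigD1 [set e]) ?subxx //= (bigD1 set0) /=; last first.
  by rewrite sub0set eq_sym -card_gt0 cards1.
rewrite big1 ?addr0 => [|E]; last first.
  by rewrite subset1 => /andP[/andP[/orP[]/eqP->]]; rewrite eqxx.
by rewrite /weight !big_set1 !inE eqxx.
Qed.

Lemma expect_set0 u : expect set0 u = u set0.
Proof.
rewrite /expect (bigD1 set0) ?sub0set //= big1 ?addr0 => [|E].
  by rewrite /weight big_set0 mul1r.
by rewrite subset0 => /andP[/eqP->]; rewrite eqxx.
Qed.

Lemma expectC D c : expect D (fun=> c) = c.
Proof.
elim: {D}_.+1 {-2}D (ltnSn #|D|) => // N IH D; rewrite ltnS => leDN.
have [->|[e eD]] := set_0Vmem D; first by rewrite expect_set0.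
rewrite (@expect_split _ [set e]) ?sub1set // expect_set1 IH.
  by rewrite -mulrDl addrC subrK mul1r.
by rewrite (cardsD1 e) eD in leDN.
Qed.

Lemma eq_expect D u v : (forall E, E \subset D -> u E = v E) -> expect D u = expect D v.
Proof. by move=> uv; apply: eq_bigr => E /uv->. Qed.

Lemma expectD D u v : expect D (fun E => u E + v E) = expect D u + expect D v.
Proof. by rewrite -big_split; apply: eq_bigr => E _; rewrite mulrDr. Qed.

Lemma expectZ D c u : expect D (fun E => c * u E) = c * expect D u.
Proof. by rewrite mulr_sumr; apply: eq_bigr => E _; rewrite mulrCA. Qed.

Lemma expect_sum (I : finType) (P : pred I) D (u : I -> {set T} -> R) :
  expect D (fun E => \sum_(i | P i) u i E) = \sum_(i | P i) expect D (u i).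
Proof. by rewrite /expect exchange_big; apply: eq_bigr => E _; rewrite mulr_sumr. Qed.

Lemma weightE A B : B \subset A -> weight A B = p ^+ #|B| * (1 - p) ^+ (#|A| - #|B|).
Proof.
move=> sBA; rewrite /weight (big_setID B) /= (setIidPr sBA); congr (_ * _).
  by rewrite (eq_bigr (fun=> p)) ?prodr_const // => e ->.
have -> : (#|A| - #|B| = #|A :\: B|)%N by rewrite cardsD (setIidPr sBA).
rewrite -prodr_const.
by apply: eq_bigr => e; rewrite inE => /andP[/negPf->].
Qed.

Lemma expect_trace D A B : A \subset D -> B \subset A ->
  expect D (fun E => (E :&: A == B)%:R) = weight A B.
Proof.
move=> sAD sBA; rewrite (expect_split _ sAD).
rewrite (@eq_expect _ _ (fun B0 => (B0 == B)%:R)) => [|B0 sB0A].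
  rewrite /expect (bigD1 B) //= eqxx mulr1 big1 ?addr0 // => E /andP[_ /negPf->].
  by rewrite mulr0.
rewrite -[RHS](expectC (D :\: A)); apply: eq_expect => B' sB'.
rewrite setIUl (setIidPl sB0A) (_ : B' :&: A = set0) ?setU0 //.
by move: sB'; rewrite subsetD => /andP[_]; rewrite -setI_eq0 => /eqP.
Qed.

Hypothesis p01 : 0 <= p <= 1.

Lemma weight_ge0 D E : 0 <= weight D E.
Proof. by apply: prodr_ge0 => e _; case: ifP => _; case/andP: p01; lra. Qed.

Lemma ler_expect D u v : (forall E, E \subset D -> u E <= v E) -> expect D u <= expect D v.
Proof. by move=> uv; apply: ler_sum => E /uv; apply: ler_wpM2l; apply: weight_ge0. Qed.

Lemma expect_ge0 D u : (forall E, E \subset D -> 0 <= u E) -> 0 <= expect D u.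
Proof. by move=> u0; apply: sumr_ge0 => E /u0; apply: mulr_ge0; apply: weight_ge0. Qed.

(** The engine of the second moment method. The expectation of (c 1_{u != 0} - u)^2 is a nonnegative
    quadratic in c, evaluated at its minimiser m / P. *)
Lemma expect_CS D u : expect D u ^+ 2 <= expect D (fun E => (u E != 0)%:R) * expect D (fun E => u E ^+ 2).
Proof.
set P := expect D (fun E => (u E != 0)%:R); set m := expect D u.
have P0 : 0 <= P by apply: expect_ge0 => E _; apply: ler0n.
have Q0 : 0 <= expect D (fun E => u E ^+ 2) by apply: expect_ge0 => E _; apply: sqr_ge0.
have H c : 0 <= c ^+ 2 * P - 2 * c * m + expect D (fun E => u E ^+ 2).
  rewrite -mulNr -2!expectZ -!expectD; apply: expect_ge0 => E _.
  case: eqP => [->|_] /=; first by rewrite !mulr0 expr2 mul0r !addr0.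
  by rewrite mulr1 (_ : _ + _ = (c - u E) ^+ 2) ?sqr_ge0 //; ring.
have [P00|Pn0] := eqVneq P 0.
  rewrite P00 mul0r.
  have [->|mn0] := eqVneq m 0; first by rewrite expr2 mul0r.
  (* With [P = 0] the quadratic is affine in c, and this c gives it the value -1. *)
  have := H ((expect D (fun E => u E ^+ 2) + 1) / (2 * m)).
  rewrite P00 mulr0 add0r (_ : 2 * _ * m = expect D (fun E => u E ^+ 2) + 1); first lra.
  by field.
have := H (m / P); have Pgt0 : 0 < P by rewrite lt_def Pn0.
rewrite (_ : _ - _ = - (m ^+ 2 / P)); last by field.
by rewrite addrC subr_ge0 ler_pdivrMr // mulrC.
Qed.

End RandomSubset.

(** * Rooted trees as parent functions *)

Section RootedTrees.
Variable T : finType.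
Implicit Types (S V : {set T}) (f g : {ffun T -> T}) (v w r : T).

Definition acyclic f := [forall v, exists w, fconnect f v w && (f w == w)].

(** Fixing the vertices outside [S] makes [f] determined by its restriction to [S], so that counting
    these [ffun]s counts maps from [S] to [S]; it also reduces [acyclic] to a condition on [S]. *)
Definition endo S f := [forall v, if v \in S then f v \in S else f v == v].

Definition roots S f : {set T} := [set v in S | f v == v].

Definition rtree S f := [&& endo S f, acyclic f & #|roots S f| == 1%N].

Definition extends g f := [forall v, (g v == v) || (f v == g v)].

Lemma fconnectP (f : T -> T) v w : reflect (exists i, iter i f v = w) (fconnect f v w).
Proof.
apply: (iffP idP) => [/iter_findex|[i <-]]; first by exists (findex f v w).
exact: fconnect_iter.
Qed.

Lemma acyclicP f : reflect (forall v, exists i, f (iter i f v) = iter i f v) (acyclic f).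
Proof.
apply: (iffP forallP) => H v; have := H v.
  by case/existsP=> w /andP[/fconnectP[i <-] /eqP]; exists i.
by case=> i fi; apply/existsP; exists (iter i f v); rewrite fi eqxx fconnect_iter.
Qed.

Lemma iter_fixed (f : T -> T) v i : f v = v -> iter i f v = v.
Proof. by move=> fv; elim: i => //= i ->. Qed.

(** A periodic point returns at arbitrarily late times, when its orbit already sits at a fixed
    point. *)
Lemma acyclic_cycle f v i : acyclic f -> iter i.+1 f v = v -> f v = v.
Proof.
move/acyclicP/(_ v) => [j fj] fi.
have fm m : iter (m * i.+1) f v = v by elim: m => // m IH; rewrite mulSn iterD IH.
have := fm j.+1; rewrite (_ : (j.+1 * i.+1)%N = (j.+1 * i.+1 - j + j)%N); last nia.
by rewrite iterD iter_fixed // => jv; rewrite -jv fj.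
Qed.

Lemma endo_in S f v : endo S f -> v \in S -> f v \in S.
Proof. by move/forallP/(_ v) => + vS; rewrite vS. Qed.

Lemma endo_out S f v : endo S f -> v \notin S -> f v = v.
Proof. by move/forallP/(_ v) => + /negPf vS; rewrite vS => /eqP. Qed.

Lemma endo_iter S f v i : endo S f -> v \in S -> iter i f v \in S.
Proof. by move=> ef vS; elim: i => //= i; apply: endo_in. Qed.

Lemma extendsP g f v : extends g f -> g v != v -> f v = g v.
Proof. by move/forallP/(_ v) => + /negPf gv; rewrite gv => /eqP. Qed.

Lemma extends_fconnect g f v w : extends g f -> fconnect g v w -> fconnect f v w.
Proof.
move=> gf /fconnectP[i]; elim: i v => [|i IH] v; first by move=> /= ->.
rewrite iterSr; have [->|gv] := eqVneq (g v) v; first exact: IH.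
move/IH; apply: connect_trans; rewrite -(extendsP gf gv); exact: fconnect1.
Qed.

Lemma fixed_unique (f : T -> T) v w w' :
  fconnect f v w -> fconnect f v w' -> f w = w -> f w' = w' -> w = w'.
Proof.
move=> /fconnectP[i iw] /fconnectP[j jw'] fw fw'.
have [ij|/ltnW ji] := leqP i j.
  by rewrite -jw' -(subnK ij) iterD iw iter_fixed.
by rewrite -iw -(subnK ji) iterD jw' iter_fixed.
Qed.

Lemma unique_root S g w : endo S g -> acyclic g -> w \in S ->
  #|[set r in roots S g | fconnect g w r]| = 1%N.
Proof.
move=> eg /acyclicP/(_ w)[i gi] wS; apply/eqP/cards1P; exists (iter i g w).
apply/setP => r; rewrite !inE -andbA; apply/idP/eqP => [/and3P[rS /eqP gr wr]|->].
  exact: (fixed_unique wr (fconnect_iter _ _ _)).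
by rewrite endo_iter // gi eqxx fconnect_iter.
Qed.

Definition graft g r w : {ffun T -> T} := [ffun v => if v == r then w else g v].

Lemma acyclic_graft g r w : acyclic g -> g r = r -> ~~ fconnect g w r ->
  acyclic (graft g r w).
Proof.
set g' := graft g r w => /acyclicP ag gr nwr.
have step v : v != r -> g' v = g v by rewrite ffunE => /negPf->.
have to_r i v : iter i g v = r -> fconnect g' v r.
  elim: i v => [v /= ->|i IH v]; first exact: connect0.
  have [-> _|vr] := eqVneq v r; first exact: connect0.
  by rewrite iterSr => /IH; apply: connect_trans; rewrite -step //; apply: fconnect1.
have to_other i v z : iter i g v = z -> z != r -> fconnect g' v z.
  elim: i v => [v /= -> _|i IH v]; first exact: connect0.
  have [->|vr] := eqVneq v r; first by rewrite iter_fixed // => ->; rewrite eqxx.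
  by rewrite iterSr => /IH /[apply]; apply: connect_trans; rewrite -step //; apply: fconnect1.
apply/forallP => v; apply/existsP; case: (ag v) => i gi.
have [ir|ir] := eqVneq (iter i g v) r; last first.
  exists (iter i g v); rewrite (to_other i) //= step // gi eqxx //.
case: (ag w) => j gj; have jr : iter j g w != r.
  by apply: contra nwr => /eqP <-; apply: fconnect_iter.
exists (iter j g w); rewrite step // gj eqxx andbT.
apply: connect_trans (to_r _ _ ir) _.
apply: connect_trans (fconnect1 _ _) _; rewrite {2}/g' ffunE eqxx.
exact: (to_other j).
Qed.

(** Double counting of the pairs of an extension [f] and a root [r] of [g] that is not the root of
    [f]. Such an [r] is attached by [f] to a vertex [w = f r] outside the tree of [r], so [f]
    extends [graft g r w], a forest with one root fewer, to which the induction applies. Conversely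
    each [w] in [S] admits all roots except that of its own tree; the number of these cancels
    against the number of non-roots of [f]. *)
Lemma card_extensions S j g : endo S g -> acyclic g -> #|roots S g| = j.+1 ->
  #|[set f | rtree S f & extends g f]| = (#|S| ^ j)%N.
Proof.
elim: j g => [|j IH] g eg ag rg.
  apply/eqP/cards1P; exists g; apply/setP => f; rewrite !inE.
  apply/andP/eqP => [[/and3P[ef af /eqP rf] gf]|->]; last first.
    by rewrite /rtree eg ag rg; split=> //; apply/forallP => v; rewrite eqxx orbT.
  have /eqP rfg : roots S f == roots S g.
    rewrite eqEcard rf rg leqnn andbT; apply/subsetP => v; rewrite !inE => /andP[-> /eqP fv].
    by apply/eqP; apply: contra_eq (fv) => gv; rewrite (extendsP gf gv).
  apply/ffunP => v; have [gv|/(extendsP gf)//] := eqVneq (g v) v.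
  have [vS|vS] := boolP (v \in S); last by rewrite (endo_out ef) // (endo_out eg).
  have : v \in roots S g by rewrite inE vS gv eqxx.
  by rewrite -rfg inE gv => /andP[_ /eqP].
set A := [set f | rtree S f & extends g f].
have rootP r : r \in roots S g -> (r \in S) * (g r = r).
  by rewrite inE => /andP[-> /eqP].
have graftE r w f : r \in roots S g -> ~~ fconnect g w r ->
    (rtree S f && extends (graft g r w) f) = (f \in A) && (f r == w).
  move=> rr nwr; rewrite inE -andbA; congr (_ && _); have [rS gr] := rootP r rr.
  have wr : w != r by apply: contra nwr => /eqP->; apply: connect0.
  apply/forallP/andP => [H|[/forallP H /eqP fr] v].
    have := H r; rewrite ffunE eqxx (negPf wr) => fr; split=> //; apply/forallP => v.
    have [->|vr] := eqVneq v r; first by rewrite gr eqxx.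
    by have := H v; rewrite ffunE (negPf vr).
  rewrite ffunE; have [->|vr] := eqVneq v r; first by rewrite fr eqxx orbT.
  exact: H.
have : (\sum_(w in S) \sum_(r in roots S g | ~~ fconnect g w r)
         #|[set f | rtree S f & extends (graft g r w) f]|)%N =
       (\sum_(f in A) \sum_(r in roots S g) (f r != r))%N.
  transitivity (\sum_(w in S) \sum_(r in roots S g | ~~ fconnect g w r)
                  \sum_(f in A) (f r == w))%N.
    apply: eq_bigr => w wS; apply: eq_bigr => r /andP[rr nwr].
    rewrite -sum1_card big_mkcond [RHS]big_mkcond; apply: eq_bigr => f _.
    by rewrite inE graftE //; case: (f \in A); case: eqP.
  rewrite (eq_bigr (fun w => \sum_(f in A) \sum_(r in roots S g | ~~ fconnect g w r) (f r == w))%N);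
    last by move=> w _; rewrite exchange_big.
  rewrite exchange_big; apply: eq_bigr => f; rewrite inE => /andP[/and3P[ef af _] gf].
  under eq_bigr => w _ do rewrite big_mkcondr.
  rewrite exchange_big; apply: eq_bigr => r rr; have [rS gr] := rootP r rr.
  rewrite (bigD1 (f r)) ?(endo_in ef) //= eqxx big1 ?addn0 => [|w /andP[_ /negPf]]; last first.
    by rewrite eq_sym => ->; case: ifP.
  have [->|fr] /= := eqVneq (f r) r; first by rewrite connect0.
  (* If [f r] were in the tree of [r], then [f] would have a cycle through [r]. *)
  case: ifP => // /negbFE /(extends_fconnect gf) /fconnectP[i]; rewrite -iterSr.
  by move/(acyclic_cycle af) => fr'; rewrite fr' eqxx in fr.
have -> : (\sum_(f in A) \sum_(r in roots S g) (f r != r) = #|A| * j.+1)%N.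
  rewrite -sum_nat_const; apply: eq_bigr => f; rewrite inE => /andP[/and3P[ef af /eqP rf] gf].
  have rf1 : (\sum_(r in roots S g) (f r == r) = 1)%N.
    rewrite -rf -sum1_card big_mkcond [RHS]big_mkcond; apply: eq_bigr => r _; rewrite !inE.
    have [rS|//] := boolP (r \in S); have [fr|] /= := eqVneq (f r) r; last by rewrite if_same.
    have [//|gr] := eqVneq (g r) r.
    by move: fr; rewrite (extendsP gf gr) => /eqP; rewrite (negPf gr).
  apply/eqP; rewrite -(eqn_add2r (\sum_(r in roots S g) (f r == r))%N) -big_split /= rf1 addn1 -rg.
  by rewrite (eq_bigr (fun=> 1%N)) ?sum1_card // => r _; case: eqP.
have -> : (\sum_(w in S) \sum_(r in roots S g | ~~ fconnect g w r)
   #|[set f | rtree S f & extends (graft g r w) f]| = #|S| * (j.+1 * #|S| ^ j))%N.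
  rewrite -sum_nat_const; apply: eq_bigr => w wS.
  rewrite (eq_bigr (fun=> (#|S| ^ j)%N)) => [|r /andP[rr nwr]].
    rewrite sum_nat_const; congr (_ * _)%N.
    have := cardsID [set r | fconnect g w r] (roots S g).
    rewrite rg -(_ : [set r in roots S g | fconnect g w r] = roots S g :&: _).
      rewrite unique_root // add1n => -[<-]; apply: eq_card => r.
      by rewrite !inE andbC unfold_in inE.
    by apply/setP => r; rewrite !inE.
  have [rS gr] := rootP r rr; have wr : w != r by apply: contra nwr => /eqP->; apply: connect0.
  apply: IH.
  - apply/forallP => v; rewrite ffunE; case: eqP => [->|_]; first by rewrite rS.
    exact: (forallP eg).
  - exact: acyclic_graft.
  apply/eqP; rewrite -eqSS -rg (cardsD1 r (roots S g)) rr add1n eqSS; apply/eqP.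
  apply: eq_card => v; rewrite !inE ffunE; have [->|//] := eqVneq v r.
  by rewrite (negPf wr) andbF.
by move/eqP; rewrite mulnCA mulnC eqn_pmul2r // => /eqP<-; rewrite expnS.
Qed.

(** Cayley's formula: every rooted tree extends the edgeless forest, which has [#|S|] roots. *)
Lemma card_rtree S : (0 < #|S|)%N -> #|[set f | rtree S f]| = (#|S| ^ #|S|.-1)%N.
Proof.
move=> S0; pose g : {ffun T -> T} := [ffun v => v].
have gE v : g v = v by rewrite ffunE.
rewrite -(@card_extensions S #|S|.-1 g).
- apply: eq_card => f; rewrite !inE (_ : extends g f) ?andbT //.
  by apply/forallP => v; rewrite gE eqxx.
- by apply/forallP => v; rewrite gE eqxx; case: ifP.
- by apply/forallP => v; apply/existsP; exists v; rewrite gE eqxx connect0.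
rewrite prednK //; apply: eq_card => v; rewrite inE gE eqxx andbT //.
Qed.

(** Keeping only the parents of the vertices of [V] leaves a rooted forest with [#|S| - #|V|] trees;
    this number is positive because the root of [f0] lies outside [V]. *)
Lemma card_rtree_prescribed S V f0 : rtree S f0 -> V \subset S ->
  (forall v, v \in V -> f0 v != v) ->
  #|[set f | rtree S f & [forall v in V, f v == f0 v]]| = (#|S| ^ (#|S| - #|V|).-1)%N.
Proof.
case/and3P=> ef af /eqP rf sVS nV; pose g : {ffun T -> T} := [ffun v => if v \in V then f0 v else v].
rewrite -(@card_extensions S (#|S| - #|V|).-1 g).
- apply: eq_card => f; rewrite !inE; congr (_ && _); apply: eq_forallb => v.
  rewrite ffunE; case: ifP => [/nV/negPf->//|_]; by rewrite eqxx.
- apply/forallP => v; rewrite ffunE; have [vV|_] := boolP (v \in V).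
    by rewrite (subsetP sVS) // (endo_in ef) // (subsetP sVS).
  by rewrite eqxx; case: ifP.
- apply/acyclicP => v; case/acyclicP/(_ v): af => i.
  elim: i v => [|i IH] v.
    move=> fv; exists 0%N; rewrite /= ffunE; case: ifP => // /nV /eqP; by rewrite fv.
  rewrite iterSr; case: (boolP (v \in V)) => vV; last first.
    by exists 0%N; rewrite /= ffunE (negPf vV).
  by case/IH => j; exists j.+1; rewrite iterSr [g v]ffunE vV.
have <- : (#|S| - #|V|)%N = #|roots S g|.
  rewrite -{1}(setIidPr sVS) -cardsD; apply: eq_card => v; rewrite !inE ffunE.
  rewrite andbC; apply: andb_id2l => _; case: ifP => [/nV/negPf->//|_]; by rewrite eqxx.
rewrite prednK // subn_gt0; apply: proper_card; rewrite properEneq sVS andbT.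
apply/eqP => VS; have : (0 < #|roots S f0|)%N by rewrite rf.
by case/card_gt0P => v; rewrite inE -VS => /andP[/nV/negP].
Qed.

End RootedTrees.

(** * Edge sets of parent functions *)

Section TreeEdges.
Variable T : finType.
Implicit Types (S L : {set T}) (f g : {ffun T -> T}) (v w : T).

Definition pairs S : {set {set T}} := [set e : {set T} | (#|e| == 2%N) && (e \subset S)].

Definition inner L f : {set T} := [set v in L | (f v \in L) && (f v != v)].

Definition edges L f : {set {set T}} := [set [set v; f v] | v in inner L f].

Lemma card_pairs S : #|pairs S| = 'C(#|S|, 2).
Proof. by rewrite -cards_draws; apply: eq_card => e; rewrite !inE andbC. Qed.

Lemma pairsI S L : pairs S :&: pairs L = pairs (S :&: L).
Proof. by apply/setP => e; rewrite !inE subsetI; case: (_ == _) => //=; rewrite !andbT. Qed.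

Lemma pairsS S L : S \subset L -> pairs S \subset pairs L.
Proof. by move=> SL; apply/subsetP => e; rewrite !inE => /andP[-> /subset_trans->]. Qed.

Lemma edges_sub_pairs L f : edges L f \subset pairs L.
Proof.
apply/subsetP => e /imsetP[v]; rewrite inE => /and3P[vL fvL fv] ->.
by rewrite inE cards2 (eq_sym v) fv subUset !sub1set vL fvL.
Qed.

Lemma edges_trace S L f : endo S f -> L \subset S -> edges S f :&: pairs L = edges L f.
Proof.
move=> ef LS; apply/setP => e; rewrite inE; apply/andP/idP => [[/imsetP[v vi ->]]|/imsetP[v]].
  rewrite inE subUset !sub1set => /and3P[_ vL fvL]; apply/imsetP; exists v => //.
  by move: vi; rewrite !inE vL fvL => /and3P[_ _ ->].
rewrite inE => /and3P[vL fvL fv] ->; split; last first.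
  by rewrite inE cards2 (eq_sym v) fv subUset !sub1set vL fvL.
by apply/imsetP; exists v => //; rewrite inE fv (subsetP LS) // (subsetP LS).
Qed.

Lemma no_2cycle f v : acyclic f -> f (f v) = v -> f v = v.
Proof. by move=> af ffv; apply: (@acyclic_cycle _ f v 1). Qed.

Lemma set2_eq v w v' w' : [set v; w] = [set v'; w'] -> (v = v' /\ w = w') \/ (v = w' /\ w = v').
Proof.
move=> E; have: v \in [set v'; w'] by rewrite -E set21.
have: w \in [set v'; w'] by rewrite -E set22.
have: v' \in [set v; w] by rewrite E set21.
have: w' \in [set v; w] by rewrite E set22.
by rewrite !inE => /orP[]/eqP + /orP[]/eqP + /orP[]/eqP + /orP[]/eqP => *; subst; auto.
Qed.

Lemma card_edges L f : acyclic f -> #|edges L f| = #|inner L f|.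
Proof.
move=> af; apply: card_in_imset => v w; rewrite inE => /and3P[_ _ fv] _.
by case/set2_eq => [[]//|[vw fvw]]; move: fv; rewrite (no_2cycle af) ?eqxx // fvw.
Qed.

(** If [f] and [g] differ at an inner [v], the edge from [v] to [f v] must be traversed by [g] in
    the other direction, so [g (f v) = v]. As [f] has no 2-cycle, [f] and [g] then differ at [f v]
    too, which is again inner. Climbing along [f] reaches a root, which is not inner. *)
Lemma edges_determine L f g : acyclic f -> acyclic g ->
  edges L f = edges L g -> inner L f = inner L g -> {in inner L f, f =1 g}.
Proof.
move=> af ag E I v vi; apply/eqP/negPn/negP => fgv.
have step w : w \in inner L f -> f w != g w -> (f w \in inner L f) && (f (f w) != g (f w)).
  move=> wi fgw; have : [set w; f w] \in edges L g by rewrite -E; apply: imset_f.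
  case/imsetP => u ui; case/set2_eq => -[wu fwu].
    by move: fgw; rewrite fwu wu eqxx.
  rewrite -fwu in ui wu; rewrite I ui /= -wu; apply/eqP => ffw.
  by move: wi; rewrite inE (no_2cycle af ffw) eqxx !andbF.
have all_steps i : (iter i f v \in inner L f) && (f (iter i f v) != g (iter i f v)).
  by elim: i => [|i /andP[ii fgi]] /=; [rewrite vi | apply: step].
case/acyclicP/(_ v): af => i fi; have /andP[] := all_steps i.
by rewrite inE fi eqxx !andbF.
Qed.

Lemma inner_rtree S f : rtree S f -> #|inner S f| = #|S|.-1.
Proof.
case/and3P=> ef _ /eqP rf; have := cardsID (roots S f) S.
rewrite (setIidPr _) ?rf; last by apply/subsetP => v; rewrite inE => /andP[].
move=> <-; rewrite add1n /=; apply: eq_card => v; rewrite !inE.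
by have [vS|] := boolP (v \in S); rewrite ?andbF // (endo_in ef) //= andbT.
Qed.

End TreeEdges.

(** * Forests and parent functions *)

Section ForestsAndParentFunctions.
Variable n : nat.
Implicit Types (S : {set 'I_n}) (E F : {set {set 'I_n}}) (f : {ffun 'I_n -> 'I_n}) (v w : 'I_n).

Lemma adj_sym E : symmetric (adj E).
Proof. by move=> v w; rewrite /adj setUC. Qed.

Lemma fconnect_sub_proper f v : acyclic f -> f v != v ->
  (#|[set w | fconnect f (f v) w]| < #|[set w | fconnect f v w]|)%N.
Proof.
move=> af fv; apply: proper_card; apply/properP; split.
  by apply/subsetP => w; rewrite !inE; apply: connect_trans; apply: fconnect1.
exists v; rewrite inE ?connect0 //; apply/negP => /fconnectP[i]; rewrite -iterSr.
by move/(acyclic_cycle af) => fv'; rewrite fv' eqxx in fv.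
Qed.

(** On a cycle, take a vertex with the most ancestors ([h]). No neighbour on the cycle can be its
    child, so both neighbours are its parent, which is impossible on at least three vertices. *)
Lemma forest_edges S f : acyclic f -> is_forest (edges S f).
Proof.
move=> af c c2 /andP[cyc uc]; pose h v := #|[set w | fconnect f v w]|.
have [x xc] : exists x, x \in c by case: c c2 {cyc uc} => // x c; exists x; rewrite mem_head.
case: (@arg_maxnP _ x (mem c) h xc) => v vc hv.
have nbr u : u \in c -> [set v; u] \in edges S f -> u = f v.
  move=> /hv hu /imsetP[w]; rewrite inE => /and3P[_ _ fw] /set2_eq[[-> ->]//|[vw uw]].
  by move: hu; rewrite /h vw uw /= leqNgt fconnect_sub_proper.
have nv : next c v = f v by apply: nbr; rewrite ?mem_next //; have := next_cycle cyc vc.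
have pv : prev c v = f v.
  by apply: nbr; rewrite ?mem_prev // setUC; have := prev_cycle cyc vc.
have npv : next c v = prev c v by rewrite nv pv.
case: (rot_to vc) => i s cs; move: npv; rewrite -(next_rot i) // -(prev_rot i) // cs.
have := c2; rewrite -(size_rot i) cs; have := uc; rewrite -(rot_uniq i) cs.
case: s {cs} => [|a [|b s]] // uvab _.
have -> : next [:: v, a, b & s] v = a by rewrite /= eqxx.
have -> : prev [:: v, a, b & s] v = last b s.
  case/andP: uvab; rewrite !inE !negb_or => /and3P[va vb vs] _.
  rewrite /= (negPf va) (negPf vb).
  elim: s b vb vs => [|y s IH] b vb /=; first by rewrite eqxx.
  by rewrite inE negb_or => /andP[vy vs]; rewrite (negPf vy) IH.
by case/and3P: uvab => _ ai _ al; rewrite {1}al mem_last in ai.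
Qed.

(** With all degrees at least 2, a path could be prolonged at its end [x] for ever: if all
    neighbours of [x] were on the path, one of them would close a cycle. *)
Lemma forest_leaf S E : is_forest E -> E \subset pairs S -> S != set0 ->
  exists2 v, v \in S & (#|[set w | adj E v w]| <= 1)%N.
Proof.
move=> fE EP S0.
have [/exists_inP[v vS v1]|/exists_inPn H] := boolP [exists v in S, #|[set w | adj E v w]| <= 1]%N.
  by exists v.
have adjS v w : adj E v w -> (w \in S) * (v != w).
  move=> /(subsetP EP); rewrite inE cards2 subUset !sub1set => /and3P[+ vS wS].
  by case: (v != w).
have big m : exists x p, [/\ x \in S, size p = m, path (adj E) x p & uniq (x :: p)].
  elim: m => [|m [x [p [xS sp pp up]]]]; first by case/set0Pn: S0 => x xS; exists x, [::].
  have [/exists_inP[u xu un]|/exists_inPn Hu] := boolP [exists u in [set w | adj E x w], u \notin x :: p].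
    rewrite inE in xu; exists u, (x :: p); split; rewrite /= ?sp ?(adjS _ _ xu) //.
      by rewrite adj_sym xu.
    by rewrite un.
  have inp u : adj E x u -> u \in p.
    move=> xu; have := Hu u; rewrite inE => /(_ xu); rewrite negbK inE.
    by case/orP => // /eqP ux; have [_] := adjS _ _ xu; rewrite ux eqxx.
  have /card_gt1P[u1 [u2 [+ + u12]]] : (1 < #|[set w | adj E x w]|)%N by rewrite ltnNge H.
  rewrite !inE => xu1 xu2.
  (* [head x p] is the vertex next to [x] on the path; any other neighbour closes a cycle of length
     at least 3. *)
  have [u [xu uh]] : exists u, adj E x u /\ u != head x p.
    have [e1|] := eqVneq u1 (head x p); last by exists u1.
    by exists u2; rewrite -e1 eq_sym.
  case/splitPr: (inp u xu) pp up uh => p1 p2 {inp Hu sp}; rewrite cat_path /= => /and3P[pp1 eu _].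
  rewrite mem_cat inE !negb_or cat_uniq /= => /andP[/and3P[xp1 xu' _] /and3P[up1 + _]].
  rewrite negb_or => /andP[up1' _] uh; exfalso.
  apply: (fE (x :: rcons p1 u)); first by case: p1 uh {pp1 eu xp1 up1 up1'} => [|y p1] /=; rewrite ?eqxx // size_rcons.
  rewrite /ucycle /= !rcons_path pp1 eu last_rcons adj_sym xu /=.
  by rewrite mem_rcons inE negb_or xu' xp1 rcons_uniq up1' up1.
have [x [p [_ sp _ up]]] := big n; have := max_card (mem (x :: p)).
by rewrite (card_uniqP up) /= sp card_ord ltnn.
Qed.

Lemma forest_sub E F : E \subset F -> is_forest F -> is_forest E.
Proof.
move=> EF fF c c2 /andP[cyc uc]; apply: (fF c c2); rewrite /ucycle uc andbT.
by apply: sub_cycle cyc => v w; apply: (subsetP EF).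
Qed.

(** Leaves are removed one at a time, and each takes its neighbour as parent. The equality of
    cardinalities says that distinct inner vertices give distinct edges; the union bound needs just
    this. *)
Lemma forest_parent S E : is_forest E -> E \subset pairs S ->
  exists f, [/\ endo S f, edges S f = E & #|inner S f| = #|E| ].
Proof.
elim: {S}_.+1 {-2}S E (ltnSn #|S|) => // N IH S E; rewrite ltnS => leSN fE EP.
have [S0|S0] := eqVneq S set0.
  exists [ffun v => v]; have E0 : E = set0.
    apply/eqP; rewrite -subset0; apply: subset_trans EP _; apply/subsetP => e.
    by rewrite !inE S0 subset0 => /andP[/eqP + /eqP e0]; rewrite e0 cards0.
  have I0 : inner S [ffun v => v] = set0 by rewrite S0; apply/setP => v; rewrite !inE.
  rewrite /edges I0 imset0 E0 !cards0; split=> //.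
  by apply/forallP => v; rewrite ffunE S0 inE.
have [v vS v1] := forest_leaf fE EP S0.
pose S' := S :\ v; pose E' := E :&: pairs S'.
have sE'E : E' \subset E by apply: subsetIl.
have szS' : (#|S'| < N)%N by rewrite /S'; rewrite (cardsD1 v S) vS in leSN.
have [f' [ef' edf' inf']] := IH S' E' szS' (forest_sub sE'E fE) (subsetIr _ _).
have inE2 e : e \in E -> v \in e -> exists2 w, e = [set v; w] & (w \in S) && (w != v).
  move=> /(subsetP EP); rewrite inE => /andP[/cards2P[a [b [ab ->]]]].
  rewrite subUset !sub1set => /andP[aS bS]; rewrite !inE => /orP[]/eqP->.
    by exists b => //; rewrite bS eq_sym.
  by exists a; rewrite ?aS // setUC.
have E'E e : e \in E -> v \notin e -> e \in E'.
  move=> eE ve; rewrite inE eE inE; have := subsetP EP _ eE; rewrite inE => /andP[-> eS] /=.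
  by apply/subsetP => x xe; rewrite !inE (subsetP eS) // andbT; apply: contraNneq ve => <-.
have vE' e : e \in E' -> v \notin e.
  by rewrite !inE => /and3P[_ _ /subsetP eS']; apply/negP => /eS'; rewrite !inE eqxx.
have f'v w : w \in S' -> (f' w \in S') /\ w != v.
  by move=> wS'; split; [apply: endo_in ef' wS' | move: wS'; rewrite !inE => /andP[]].
have S'S w : w \in S' -> w \in S by rewrite !inE => /andP[].
(* [u] is the parent given to [v]: its only neighbour, or [v] itself when [v] is isolated. *)
have build u : u \in S -> (u == v) || adj E v u -> (forall w, adj E v w -> w = u /\ u != v) ->
    exists f, [/\ endo S f, edges S f = E & #|inner S f| = #|E| ].
  move=> uS uv only; exists [ffun w => if w == v then u else f' w].
  set f := finfun _; have fE' w : f w = if w == v then u else f' w by rewrite ffunE.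
  have ef : endo S f.
    apply/forallP => w; rewrite fE'; have [->|wv] := eqVneq w v; first by rewrite vS.
    have [wS|wS] := boolP (w \in S); last by rewrite (endo_out ef') // !inE negb_and wS orbT.
    by apply: S'S; apply: endo_in ef' _; rewrite !inE wv.
  have inn : inner S f = if u == v then inner S' f' else v |: inner S' f'.
    apply/setP => w; transitivity (if w == v then u != v else w \in inner S' f').
      rewrite inE fE'; have [->|wv] := eqVneq w v; first by rewrite vS uS.
      rewrite !inE wv /=; apply: andb_id2l => wS; have [] := f'v w; rewrite ?inE ?wv //.
      by case/andP=> -> ->.
    have vn : v \notin inner S' f' by rewrite !inE eqxx.
    case: ifP => [/eqP->|wv].
      by case: ifP => [_|_]; rewrite ?(negPf vn) // !inE eqxx.
    by case: ifP => // _; rewrite [RHS]inE inE wv.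
  have edE : edges S f = if u == v then E' else [set v; u] |: E'.
    rewrite /edges inn -edf' /edges.
    have im : [set [set w; f w] | w in inner S' f'] = [set [set w; f' w] | w in inner S' f'].
      apply: eq_in_imset => w; rewrite inE => /andP[/f'v[_ /negPf wv] _]; by rewrite fE' wv.
    by case: ifP => // _; rewrite imsetU1 im fE' eqxx.
  have EE : E = if u == v then E' else [set v; u] |: E'.
    apply/setP => e; have [ve|ve] := boolP (v \in e); last first.
      have -> : (e \in E) = (e \in E') by apply/idP/idP => [/E'E/(_ ve)//|/(subsetP sE'E)].
      case: ifP => // _; rewrite in_setU1; have [ee|//] := eqVneq e [set v; u].
      by rewrite ee set21 in ve.
    have -> : (e \in (if u == v then E' else [set v; u] |: E')) = (u != v) && (e == [set v; u]).
      have ne : e \notin E' by apply: contraL ve => /vE'.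
      by case: ifP => _ /=; rewrite ?in_setU1 (negPf ne) // orbF.
    apply/idP/andP => [eE|[uv' /eqP->]].
      have [w ew _] := inE2 e eE ve; rewrite ew in eE *.
      by have [-> ->] := only w eE.
    by move: uv; rewrite (negPf uv').
  split=> //; first by rewrite edE -EE.
  rewrite inn EE; case: ifP => // _; rewrite !cardsU1 inf'.
  have -> : v \notin inner S' f' by rewrite !inE eqxx.
  by have /contraL/(_ (set21 v u))-> := @vE' [set v; u].
have [A0|/set0Pn[u]] := eqVneq [set w | adj E v w] set0.
  apply: (build v) => //; first by rewrite eqxx.
  move=> w vw; have : w \in [set w | adj E v w] by rewrite inE.
  by rewrite A0 inE.
rewrite inE => vu; have : [set v; u] \in pairs S by apply: (subsetP EP).
rewrite inE cards2 subUset !sub1set => /and3P[uv _ uS].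
apply: (build u) => // [|w vw]; first by rewrite vu orbT.
split; last by rewrite eq_sym; move: uv; case: (v != u).
by apply/eqP; apply: contraTT v1 => wu; rewrite -ltnNge; apply/card_gt1P; exists w, u; rewrite !inE.
Qed.

End ForestsAndParentFunctions.

(** * Weighted counts of parent functions *)

Section CountingParentFunctions.
Variable T : finType.
Implicit Types (S L : {set T}) (f g : {ffun T -> T}) (v w : T).

Lemma sum_family (R : comPzSemiRingType) (Q : T -> pred T) (G : T -> T -> R) :
  \sum_(f : {ffun T -> T} | [forall v, Q v (f v)]) \prod_v G v (f v) =
  \prod_v \sum_(w | Q v w) G v w.
Proof. by rewrite bigA_distr_big_dep; apply: eq_bigl => f; apply/forallP/familyP. Qed.

(** Without acyclicity the parents are chosen independently and the sum factorises. A vertex of [L]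
    has [#|L|.-1] choices that make it inner and [(#|S| - #|L|).+1] that do not: itself or a vertex
    outside [L]. *)
Lemma sum_endo_inner (R : comPzSemiRingType) S L (a b : R) : L \subset S ->
  \sum_(f | endo S f) b ^+ #|inner L f| * a ^+ (#|L| - #|inner L f|) =
  (#|S| ^ (#|S| - #|L|))%:R * (#|L|.-1%:R * b + (#|S| - #|L|).+1%:R * a) ^+ #|L|.
Proof.
move=> LS; pose Q v w := if v \in S then w \in S else w == v.
pose G v w : R := if v \in L then (if (w \in L) && (w != v) then b else a) else 1.
have -> : \sum_(f | endo S f) b ^+ #|inner L f| * a ^+ (#|L| - #|inner L f|) =
    \sum_(f : {ffun T -> T} | [forall v, Q v (f v)]) \prod_v G v (f v).
  apply: eq_bigr => f _; rewrite -big_mkcond (big_setID (inner L f)) /=.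
  have sIL : inner L f \subset L by apply/subsetP => v; rewrite inE => /andP[].
  rewrite (setIidPr sIL); congr (_ * _).
    by rewrite -prodr_const; apply: eq_bigr => v; rewrite inE => /andP[_ ->].
  have -> : (#|L| - #|inner L f| = #|L :\: inner L f|)%N by rewrite cardsD (setIidPr sIL).
  rewrite -prodr_const; apply: eq_bigr => v; rewrite !inE => /andP[+ vL].
  by rewrite vL /= => /negPf->.
rewrite sum_family (bigID (mem L)) /= mulrC; congr (_ * _).
  rewrite (bigID (mem S)) /= [X in _ * X]big1 ?mulr1 => [|v /andP[/negPf vL /negPf vS]].
    rewrite (eq_bigr (fun=> #|S|%:R)) => [|v /andP[/negPf vL vS]]; last first.
      by rewrite /G /Q vL vS sumr_const.
    rewrite prodr_const natrX; congr (_ ^+ _); rewrite -[in RHS](setIidPr LS) -cardsD.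
    by apply: eq_card => v; rewrite !inE.
  by rewrite /G /Q vL vS big_pred1_eq.
rewrite -prodr_const; apply: eq_bigr => v vL; have vS := subsetP LS v vL.
rewrite (eq_bigr (fun w => if (w \in L) && (w != v) then b else a)); last by move=> w; rewrite /G vL.
rewrite /Q vS (bigID (fun w => (w \in L) && (w != v))) /=; congr (_ + _).
  rewrite (eq_bigr (fun=> b)) => [|w /andP[_ ->]//]; rewrite sumr_const mulr_natl.
  congr (_ *+ _); rewrite (cardsD1 v L) vL add1n /=; apply: eq_card => w; rewrite unfold_in !inE.
  by have [->|] := eqVneq w v; rewrite ?andbF //= andbT; case: (boolP (w \in L)) => [/(subsetP LS)->|]; rewrite ?andbF.
rewrite (eq_bigr (fun=> a)) => [|w /andP[_ /negPf->]//]; rewrite sumr_const mulr_natl.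
congr (_ *+ _); have := cardsD1 v (S :\: (L :\ v)); rewrite !inE eqxx vS /= add1n => E.
transitivity #|S :\: (L :\ v)|; first by apply: eq_card => w; rewrite unfold_in !inE andbC [_ && (_ \in L)]andbC.
rewrite E; congr _.+1; rewrite -[in RHS](setIidPr LS) -cardsD; apply: eq_card => w.
by rewrite !inE; have [->|] //= := eqVneq w v; rewrite vL.
Qed.

End CountingParentFunctions.

(** * Trees that induce the same graph on a common vertex set *)

Section AgreeingTrees.
Variable T : finType.
Implicit Types (S L I : {set T}) (f g : {ffun T -> T}).

Definition agreeing S L f : {set {ffun T -> T}} :=
  [set g | rtree S g & edges L g == edges L f].

Lemma inner_sub L f : inner L f \subset L.
Proof. by apply/subsetP => v; rewrite inE => /andP[]. Qed.

(* The binomial coefficient counts the sets [inner L g]: by [edges_determine],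
   agreeing trees with the same inner set share their parents on it. *)
Lemma card_agreeing S L f (m : nat) : acyclic f -> L \subset S ->
  (forall g, rtree S g -> #|inner L g| = #|inner L f| ->
    #|[set h | [&& rtree S h, inner L h == inner L g & [forall v in inner L g, h v == g v]]]| <= m)%N ->
  (#|agreeing S L f| <= 'C(#|L|, #|inner L f|) * m)%N.
Proof.
move=> af LS Hm; pose A I := [set g in agreeing S L f | inner L g == I].
have cI g : g \in agreeing S L f -> #|inner L g| = #|inner L f|.
  by rewrite inE => /andP[/and3P[_ ag _] /eqP E]; rewrite -!card_edges // E.
rewrite -cards_draws -sum_nat_const -sum1_card.
rewrite (partition_big (fun g : {ffun T -> T} => inner L g)
   (fun I => I \in [set B : {set T} | B \subset L & #|B| == #|inner L f|])) /=; last first.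
  by move=> g gA; rewrite inE inner_sub cI //=.
apply: leq_sum => I _; rewrite sum1dep_card.
have [->|/set0Pn[g]] := eqVneq [set x | (x \in agreeing S L f) && (inner L x == I)] set0.
  by rewrite cards0.
rewrite inE => /andP[gA /eqP gI]; move: (gA); rewrite inE => /andP[tg /eqP Eg].
apply: leq_trans (Hm g tg (cI g gA)); apply: subset_leq_card; apply/subsetP => h.
rewrite !inE => /andP[/andP[th /eqP Eh] /eqP hI]; rewrite th hI gI eqxx /=.
apply/forall_inP => v vI; apply/eqP.
case/and3P: th => _ ah _; case/and3P: tg => _ ag _.
apply: (edges_determine ah ag (L := L)); [by rewrite Eh Eg | by rewrite hI gI | by rewrite hI].

Qed.

Lemma card_agreeing_trees S L f : acyclic f -> L \subset S ->
  (#|agreeing S L f| <= 'C(#|L|, #|inner L f|) * #|S| ^ (#|S| - #|inner L f|).-1)%N.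
Proof.
move=> af LS; apply: card_agreeing => // g tg <-.
rewrite -(card_rtree_prescribed tg (V := inner L g)).
- by apply: subset_leq_card; apply/subsetP => h; rewrite !inE => /and3P[-> _ ->].
- exact: subset_trans (inner_sub _ _) LS.
by move=> v; rewrite inE => /and3P[].
Qed.

(** Here acyclicity is dropped, but each vertex of [L] that is not inner has only [(#|S| - #|L|).+1]
    possible parents. This is what makes the bound strong when [L] is almost all of [S]. *)
Lemma card_agreeing_functions S L f : acyclic f -> L \subset S ->
  (#|agreeing S L f| <= 'C(#|L|, #|inner L f|) *
     (#|S| ^ (#|S| - #|L|) * (#|S| - #|L|).+1 ^ (#|L| - #|inner L f|)))%N.
Proof.
move=> af LS; apply: card_agreeing => // g tg <-.
pose Q v : pred T := if v \in inner L g then pred1 (g v)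
  else if v \in L then [pred w in S :\: (L :\ v)] else if v \in S then [pred w in S] else pred1 v.
have -> : (#|S| ^ (#|S| - #|L|) * (#|S| - #|L|).+1 ^ (#|L| - #|inner L g|))%N =
    (\sum_(f : {ffun T -> T} | [forall v, Q v (f v)]) \prod_(v : T) 1)%N.
  rewrite (sum_family Q (fun _ _ => 1%N)).
  have -> : (#|L| - #|inner L g| = #|L :\: inner L g|)%N by rewrite cardsD (setIidPr (inner_sub _ _)).
  have -> : (#|S| - #|L| = #|S :\: L|)%N by rewrite cardsD (setIidPr LS).
  rewrite -!prod_nat_const big_mkcond [X in (_ * X)%N]big_mkcond -big_split /=.
  apply: eq_bigr => v _; rewrite sum1_card /Q !in_setD.
  have [vi|vi] := boolP (v \in inner L g).
    by rewrite (subsetP (inner_sub _ _) _ vi) card1.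
  have [vL|vL] := boolP (v \in L); rewrite /=; last first.
    by case: ifP => vS; rewrite ?card1 ?muln1.
  have vS := subsetP LS v vL; rewrite mul1n.
  have := cardsD1 v (S :\: (L :\ v)); rewrite !inE eqxx vS /= add1n => E.
  transitivity #|S :\: (L :\ v)|; last by apply: eq_card => w; rewrite !inE.
  rewrite E; congr _.+1; apply: eq_card => w.
  by rewrite !inE; have [->|] //= := eqVneq w v; rewrite vL.
under [leqRHS]eq_bigr => h _ do rewrite prod_nat_const exp1n.
rewrite sum1dep_card; apply: subset_leq_card; apply/subsetP => h.
rewrite !inE => /and3P[/and3P[eh _ _] /eqP hI /forall_inP hg]; apply/forallP => v; rewrite /Q.
case: ifP => [vi|vi]; first exact: hg.
case: ifP => vL /=.
  rewrite !inE (endo_in eh) ?(subsetP LS) // andbT.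
  by move: vi; rewrite -hI inE vL /= => /negbT; rewrite negb_and negbK => /orP[/negPf->|->]; rewrite ?andbF.
by case: ifP => vS; [rewrite inE (endo_in eh) | rewrite /= (endo_out eh) // vS].
Qed.

End AgreeingTrees.

(** * The second moment *)

Section TwoTraces.
Variables (R : realFieldType) (T : finType) (p : R).
Hypothesis p01 : 0 < p < 1.
Implicit Types A B D E : {set T}.

Lemma weight_gt0 A B : 0 < weight p A B.
Proof. by apply: prodr_gt0 => e _; case: ifP => _; case/andP: p01; lra. Qed.

(** Two traces are compatible exactly when they agree on [A :&: A']; together they then prescribe
    one trace on [A :|: A'], where the common part is weighted only once. *)
Lemma expect_two_traces D A A' B B' : A \subset D -> A' \subset D -> B \subset A -> B' \subset A' ->
  expect p D (fun E => (E :&: A == B)%:R * (E :&: A' == B')%:R) =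
  (B :&: A' == B' :&: A)%:R * (weight p A B * weight p A' B' / weight p (A :&: A') (B :&: A')).
Proof.
move=> sA sA' sB sB'; have [BB|BB] := eqVneq (B :&: A') (B' :&: A); last first.
  rewrite mul0r -(expectC p D 0); apply: eq_expect => E _.
  have [EA|_] := eqVneq (E :&: A) B; last by rewrite mul0r.
  have [EA'|_] := eqVneq (E :&: A') B'; last by rewrite mulr0.
  by case/eqP: BB; rewrite -EA -EA' -!setIA [A :&: A']setIC.
have inB e : (e \in A') && (e \in B) = (e \in A) && (e \in B').
  by move/setP/(_ e): BB; rewrite !inE andbC => ->; rewrite andbC.
have AB e : e \in B -> e \in A by apply: (subsetP sB).
have AB' e : e \in B' -> e \in A' by apply: (subsetP sB').
have -> : expect p D (fun E => (E :&: A == B)%:R * (E :&: A' == B')%:R) =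
    expect p D (fun E => (E :&: (A :|: A') == B :|: B')%:R).
  apply: eq_expect => E _; rewrite -natrM mulnb; congr (nat_of_bool _)%:R.
  apply/andP/eqP => [[/eqP<- /eqP<-]|/setP EE]; first by rewrite setIUr.
  split; apply/eqP/setP => e; have := EE e; have := inB e; have := AB e; have := AB' e; rewrite !inE.
    by case: (e \in A); case: (e \in A'); case: (e \in B); case: (e \in B'); rewrite ?andbT ?andbF ?orbT ?orbF //= => a b c d; have := a isT; have := b isT.
  by case: (e \in A); case: (e \in A'); case: (e \in B); case: (e \in B'); rewrite ?andbT ?andbF ?orbT ?orbF //= => a b c d; have := a isT; have := b isT.
rewrite expect_trace ?subUset ?sA ?sA' ?(subset_trans sB) ?(subset_trans sB') ?subsetUl ?subsetUr //= mul1r.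
apply: (@mulIf _ (weight p (A :&: A') (B :&: A'))); first by rewrite gt_eqF ?weight_gt0.
rewrite divfK; last by rewrite gt_eqF ?weight_gt0.
rewrite /weight.
have -> : \prod_(e in A :|: A') (if e \in B :|: B' then p else 1 - p) =
   \prod_(e in A) (if e \in B then p else 1 - p) * \prod_(e in A' :\: A) (if e \in B' then p else 1 - p).
  rewrite (big_setID A) /= setIUl setIid setDUl setDv set0U (setUidPl (subsetIr _ _)); congr (_ * _).
    apply: eq_bigr => e eA; rewrite inE; have := inB e; have := AB' e; rewrite eA /=.
    by case: (e \in A'); case: (e \in B); case: (e \in B') => //= a; have := a isT.
  apply: eq_bigr => e; rewrite !inE => /andP[eA _]; have := AB e; rewrite (negPf eA).
  by case: (e \in B) => // a; have := a isT.
rewrite -mulrA; congr (_ * _); rewrite [RHS](big_setID A) /= mulrC setIC; congr (_ * _).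
apply: eq_bigr => e; rewrite !inE => /andP[eA' eA].
by have := inB e; rewrite eA eA' /= => ->; rewrite andbT.
Qed.

End TwoTraces.

(** * The second moment inequality for rooted trees on a family of k-sets *)

Section SecondMoment.
Variables (R : realFieldType) (T : finType) (p : R) (k : nat) (F : {set {set T}}).
Hypotheses (p01 : 0 < p < 1) (k0 : (0 < k)%N) (Fk : forall S, S \in F -> #|S| = k).
Implicit Types (S L : {set T}) (f g : {ffun T -> T}).

Definition tree_on S (E : {set {set T}}) := [exists f, rtree S f && (E :&: pairs S == edges S f)].

Let r := p / (1 - p).

Lemma weight_edges S f : rtree S f -> S \in F ->
  weight p (pairs S) (edges S f) = p ^+ k.-1 * (1 - p) ^+ ('C(k, 2) - k.-1).
Proof.
move=> tf SF; rewrite weightE ?edges_sub_pairs // card_pairs card_edges; last by case/and3P: tf.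
by rewrite inner_rtree // Fk.
Qed.

Lemma inner_le_bin L f : acyclic f -> (#|inner L f| <= 'C(#|L|, 2))%N.
Proof. by move=> af; rewrite -card_edges // -card_pairs subset_leq_card // edges_sub_pairs. Qed.

Lemma inv_weight_edges L f : acyclic f ->
  (weight p (pairs L) (edges L f))^-1 = r^-1 ^+ #|inner L f| * (1 - p)^-1 ^+ 'C(#|L|, 2).
Proof.
case/andP: p01 => p0 p1 af; rewrite weightE ?edges_sub_pairs // card_pairs card_edges //.
rewrite -{2}(subnK (inner_le_bin L af)) exprD /r invf_div expr_div_n !exprVn.
have p0' : p ^+ #|inner L f| != 0 by rewrite expf_neq0 ?gt_eqF.
have q0 i : (1 - p) ^+ i != 0 by rewrite expf_neq0 // subr_eq0 eq_sym lt_eqF.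
by field; rewrite p0' !q0.
Qed.

(** Let X count the pairs of [S] in [F] and a rooted tree on [S]. The pairs (S, f), (S', g)
    contribute to E[X^2] only if both trees agree on [L = S :&: S']; [H] bounds the resulting
    correlation, averaged over the trees, and [c] bounds the number of [S'] above a given [L]. The
    double sum is then grouped by [L] and by its size. *)
Lemma second_moment (H : nat -> R) (c : nat -> nat) :
  (forall l, 0 <= H l) ->
  (forall L, (#|[set S in F | L \subset S]| <= c #|L|)%N) ->
  (forall S S' L, S \in F -> S' \in F -> L = S :&: S' ->
    \sum_(f | rtree S f) (#|agreeing S' L f|%:R * r^-1 ^+ #|inner L f| * (1 - p)^-1 ^+ 'C(#|L|, 2))
      <= (k ^ k.-1)%:R ^+ 2 * H #|L|) ->
  #|F|%:R <= expect p (pairs setT) (fun E => [exists S in F, tree_on S E]%:R) *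
    \sum_(l < k.+1) 'C(k, l)%:R * (c l)%:R * H l.
Proof.
move=> H0 cF HF; set P := expect _ _ _.
have p01' : 0 <= p <= 1 by case/andP: p01; lra.
pose w := p ^+ k.-1 * (1 - p) ^+ ('C(k, 2) - k.-1).
have w0 : 0 < w by apply: mulr_gt0; apply: exprn_gt0; case/andP: p01; lra.
pose K : R := (k ^ k.-1)%:R.
have K0 : 0 < K by rewrite ltr0n expn_gt0 k0.
pose X (E : {set {set T}}) : R := \sum_(S in F) \sum_(f | rtree S f) (E :&: pairs S == edges S f)%:R.
have sP S : pairs S \subset pairs setT by apply: pairsS; apply: subsetT.
have EX : expect p (pairs setT) X = #|F|%:R * K * w.
  rewrite /X expect_sum mulr_natl -mulr_natl -mulrA mulr_natl -sumr_const; apply: eq_bigr => S SF.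
  rewrite expect_sum (eq_bigr (fun=> w)) => [|f tf].
    by rewrite sumr_const /K -(Fk SF) -card_rtree ?Fk // mulr_natl; congr (_ *+ _); apply: eq_card => f; rewrite inE.
  by rewrite expect_trace ?edges_sub_pairs // (weight_edges tf SF).
have XP : expect p (pairs setT) (fun E => (X E != 0)%:R) <= P.
  apply: ler_expect => // E _; rewrite ler_nat.
  have [//|nE] := boolP [exists S in F, tree_on S E]; first by rewrite leq_b1.
  rewrite /X big1 ?eqxx // => S SF; rewrite big1 // => f tf; case: eqP => // Ef.
  case/negP: nE; apply/exists_inP; exists S => //.
  by apply/existsP; exists f; rewrite tf Ef eqxx.
have EX2 : expect p (pairs setT) (fun E => X E ^+ 2) <=
    w ^+ 2 * K ^+ 2 * \sum_(S in F) \sum_(S' in F) H #|S :&: S'|.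
  have -> : expect p (pairs setT) (fun E => X E ^+ 2) = \sum_(S in F) \sum_(S' in F)
      \sum_(f | rtree S f) \sum_(g | rtree S' g)
        expect p (pairs setT) (fun E => (E :&: pairs S == edges S f)%:R * (E :&: pairs S' == edges S' g)%:R).
    transitivity (expect p (pairs setT) (fun E => \sum_(S in F) \sum_(S' in F)
      \sum_(f | rtree S f) \sum_(g | rtree S' g)
        (E :&: pairs S == edges S f)%:R * (E :&: pairs S' == edges S' g)%:R)).
      apply: eq_expect => E _; rewrite expr2 {1}/X big_distrl /=; apply: eq_bigr => S _.
      rewrite /X big_distrr /=; apply: eq_bigr => S' _; rewrite big_distrl /=; apply: eq_bigr => f _.
      by rewrite big_distrr.
    rewrite expect_sum; apply: eq_bigr => S _; rewrite expect_sum; apply: eq_bigr => S' _.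
    by rewrite expect_sum; apply: eq_bigr => f _; rewrite expect_sum.
  rewrite mulr_sumr; apply: ler_sum => S SF; rewrite mulr_sumr; apply: ler_sum => S' S'F.
  rewrite -mulrA; apply: le_trans (ler_wpM2l (sqr_ge0 w) (HF S S' _ SF S'F erefl)).
  rewrite mulr_sumr; apply: ler_sum => f tf; set L := S :&: S'.
  have af : acyclic f by case/and3P: tf.
  have LS : L \subset S by apply: subsetIl.
  have LS' : L \subset S' by apply: subsetIr.
  rewrite -mulrA -(inv_weight_edges L af) mulrA mulrC -mulrA.
  have -> : (weight p (pairs L) (edges L f))^-1 * (w * (w * #|agreeing S' L f|%:R)) =
      \sum_(g in agreeing S' L f) w * w / weight p (pairs L) (edges L f).
    by rewrite sumr_const -[RHS]mulr_natr; ring.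
  rewrite big_mkcond [leRHS]big_mkcond.
  apply: ler_sum => g _; rewrite inE; case: ifP => //= tg.
  rewrite expect_two_traces ?edges_sub_pairs // pairsI.
  have tr : edges S f :&: pairs S' = edges L f.
    have := @edges_trace _ S L f; case/and3P: tf => ef _ _ /(_ ef LS) <-.
    by rewrite -pairsI setIA (setIidPl (edges_sub_pairs S f)).
  have tr' : edges S' g :&: pairs S = edges L g.
    have := @edges_trace _ S' L g; case/and3P: tg => eg _ _ /(_ eg LS') <-.
    by rewrite -pairsI setIC [pairs S :&: pairs S']setIC setIA [_ :&: edges _ _]setIC (setIidPl (edges_sub_pairs S' g)) setIC.
  rewrite tr tr' (weight_edges tf SF) (weight_edges tg S'F) eq_sym.
  by case: eqP => _ /=; rewrite ?mul0r // ?mul1r ?expr2 ?mulrA // mulrC mulrA.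
have SS : \sum_(S in F) \sum_(S' in F) H #|S :&: S'| <= #|F|%:R * \sum_(l < k.+1) 'C(k, l)%:R * (c l)%:R * H l.
  rewrite mulr_natl -sumr_const; apply: ler_sum => S SF.
  rewrite (partition_big (fun S' => S :&: S') (fun L => L \subset S)) /=; last by move=> S' _; apply: subsetIl.
  rewrite (partition_big (fun L : {set T} => inord #|L| : 'I_k.+1) xpredT) //=.
  apply: ler_sum => l _; rewrite -mulrA mulr_natl.
  have -> : 'C(k, l) = #|[set L : {set T} | L \subset S & #|L| == l]| by rewrite cards_draws (Fk SF).
  have lk (L : {set T}) : L \subset S -> (inord #|L| == l) = (#|L| == l).
    by move=> /subset_leq_card; rewrite (Fk SF) => LS; rewrite -val_eqE /= inordK.
  rewrite -sumr_const big_mkcond [leRHS]big_mkcond; apply: ler_sum => L _; rewrite inE.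
  have [LS|] := boolP (L \subset S); last by [].
  rewrite lk //=; have [<-|_ //] := eqVneq #|L| l.
  rewrite (eq_bigr (fun=> H #|L|)); last by move=> S' /andP[_ /eqP->].
  rewrite sumr_const mulr_natl; rewrite -![H _ *+ _]mulr_natr ler_wpM2l ?ler_nat //.
  apply: leq_trans (cF L); apply: subset_leq_card; apply/subsetP => S'; rewrite !inE unfold_in /=.
  by case/andP=> -> /eqP <-; rewrite subsetIr.
have Fpos : 0 <= #|F|%:R :> R by apply: ler0n.
set Z := \sum_(l < k.+1) _ in SS *.
have Z0 : 0 <= Z by apply: sumr_ge0 => l _; rewrite !mulr_ge0.
have [->|Fn0] := eqVneq (#|F|%:R : R) 0.
  by rewrite mulr_ge0 // expect_ge0 // => E _; apply: ler0n.
have Fgt0 : 0 < #|F|%:R :> R by rewrite lt_def Fn0.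
have := expect_CS p01' (pairs setT) X; rewrite EX => CS.
have X20 : 0 <= expect p (pairs setT) (fun E => X E ^+ 2) by apply: expect_ge0 => // E _; apply: sqr_ge0.
have := le_trans CS (le_trans (ler_wpM2r X20 XP) (ler_wpM2l _ EX2)).
have P0 : 0 <= P by apply: expect_ge0 => // E _; apply: ler0n.
move=> /(_ P0) H1.
have H2 := le_trans H1 (ler_wpM2l P0 (ler_wpM2l (mulr_ge0 (sqr_ge0 w) (sqr_ge0 K)) SS)).
rewrite -(ler_pM2l (x := w ^+ 2 * K ^+ 2 * #|F|%:R)); last exact: mulr_gt0 (mulr_gt0 (exprn_gt0 2 w0) (exprn_gt0 2 K0)) Fgt0.
have -> : w ^+ 2 * K ^+ 2 * #|F|%:R * #|F|%:R = (#|F|%:R * K * w) ^+ 2 by ring.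
by apply: le_trans H2 _; rewrite le_eqVlt; apply/orP; left; apply/eqP; ring.
Qed.

End SecondMoment.

(** * Two bounds on the correlation of trees that share l vertices *)

Section AgreementBounds.
Variables (R : realFieldType) (T : finType) (p : R) (k : nat).
Hypotheses (p01 : 0 < p < 1) (k0 : (0 < k)%N).
Implicit Types (S L : {set T}) (f g : {ffun T -> T}).

Let r := p / (1 - p).

Lemma bin_le_exp (theta : R) l i : 0 < theta ->
  'C(l, i)%:R <= theta ^+ (l - i) * (1 + theta^-1) ^+ l.
Proof.
move=> t0; have [li|il] := ltnP l i.
  rewrite bin_small // mulr_ge0 // exprn_ge0 //; first exact: ltW.
  by rewrite addr_ge0 // invr_ge0 ltW.
rewrite addrC exprDn -ler_pdivrMl ?exprn_gt0 //.
have li : (i < l.+1)%N by [].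
rewrite (bigD1 (Ordinal li)) //= expr1n mulr1 exprVn mulr_natr lerDl.
by apply: sumr_ge0 => j _; rewrite mulrn_wge0 // expr1n mulr1 exprn_ge0 // invr_ge0 ltW.
Qed.

Lemma odds_gt0 : 0 < r.
Proof. by case/andP: p01 => ? ?; rewrite divr_gt0 ?subr_gt0. Qed.

(** If i edges are shared, the prescribed parents save a factor k^i in the number of trees and the
    shared edges cost r^-i; the product (kr)^-i is at most 1 whatever i is. *)
Lemma agreement_bound_trees S S' L : #|S| = k -> #|S'| = k -> L \subset S -> L \subset S' -> 1 <= k%:R * r ->
  \sum_(f | rtree S f) (#|agreeing S' L f|%:R * r^-1 ^+ #|inner L f| * (1 - p)^-1 ^+ 'C(#|L|, 2))
    <= (k ^ k.-1)%:R ^+ 2 * (2 ^+ #|L| * (1 - p)^-1 ^+ 'C(#|L|, 2)).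
Proof.
move=> Sk S'k LS LS' kr; have r0 := odds_gt0.
have q0 : 0 <= (1 - p)^-1 by case/andP: p01 => _ p1; rewrite invr_ge0 subr_ge0 ltW.
rewrite -mulr_suml [leRHS]mulrA ler_wpM2r ?exprn_ge0 //.
have cT : (k ^ k.-1)%N = #|[pred f | rtree S f]|.
  by have := @card_rtree _ S; rewrite Sk => /(_ k0) <-; apply: eq_card => f; rewrite inE.
rewrite expr2 -mulrA {1}cT mulr_natl.
rewrite -sumr_const; apply: ler_sum => f tf; have af : acyclic f by case/and3P: tf.
apply: le_trans (_ : ('C(#|L|, #|inner L f|) * k ^ (k - #|inner L f|).-1)%:R * r^-1 ^+ #|inner L f| <= _).
  by rewrite ler_wpM2r ?exprn_ge0 ?invr_ge0 ?(ltW r0) // ler_nat -S'k card_agreeing_trees.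
have ik : (#|inner L f| <= k.-1)%N.
  rewrite -Sk -(inner_rtree tf); apply: subset_leq_card; apply/subsetP => v.
  by rewrite !inE => /and3P[/(subsetP LS)-> /(subsetP LS)-> ->].
rewrite natrM -mulrA [leRHS]mulrC; apply: ler_pM => //.
- by rewrite mulr_ge0 // exprn_ge0 // invr_ge0 ltW.
- have := @bin_le_exp 1 #|L| #|inner L f| ltr01.
  by rewrite expr1n mul1r invr1.
have -> : (k - #|inner L f|).-1 = (k.-1 - #|inner L f|)%N by lia.
have -> : (k ^ k.-1)%:R = (k ^ (k.-1 - #|inner L f|))%:R * k%:R ^+ #|inner L f| :> R.
  by rewrite -natrX -natrM -expnD subnK.
rewrite ler_wpM2l // exprVn -[leLHS]mul1r ler_pdivrMr ?exprn_gt0 //.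
by rewrite -exprMn exprn_ege1.
Qed.

(** The factor [k%:R ^+ 2] is the price of counting k^k functions in place of k^(k-1) trees on each
    of the two supports. Bounding the binomial by a power of [theta] keeps the summand a product
    over vertices, so that [sum_endo_inner] applies. *)
Lemma agreement_bound_functions (theta : R) S S' L : 0 < theta ->
  #|S| = k -> #|S'| = k -> L \subset S -> L \subset S' ->
  \sum_(f | rtree S f) (#|agreeing S' L f|%:R * r^-1 ^+ #|inner L f| * (1 - p)^-1 ^+ 'C(#|L|, 2))
    <= (k ^ k.-1)%:R ^+ 2 * (k%:R ^+ 2 * ((1 + theta^-1) *
          (#|L|.-1%:R / r + theta * (k - #|L|).+1%:R ^+ 2) / k%:R ^+ 2 ) ^+ #|L| * (1 - p)^-1 ^+ 'C(#|L|, 2)).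
Proof.
move=> t0 Sk S'k LS LS'; have r0 := odds_gt0.
have q0 : 0 <= (1 - p)^-1 by case/andP: p01 => _ p1; rewrite invr_ge0 subr_ge0 ltW.
rewrite -mulr_suml [leRHS]mulrA ler_wpM2r ?exprn_ge0 //.
set l := #|L|; pose a : R := theta * (k - l).+1%:R.
have lk : (l <= k)%N by rewrite -Sk subset_leq_card.
have a0 : 0 < a by rewrite mulr_gt0.
apply: le_trans (_ : \sum_(f | endo S f) (k ^ (k - l))%:R * (1 + theta^-1) ^+ l *
    (r^-1 ^+ #|inner L f| * a ^+ (l - #|inner L f|)) <= _).
  rewrite big_mkcond [leRHS]big_mkcond; apply: ler_sum => f _.
  have c0 : 0 <= (k ^ (k - l))%:R * (1 + theta^-1) ^+ l :> R.
    by rewrite mulr_ge0 // exprn_ge0 // addr_ge0 // invr_ge0 ltW.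
  have ra0 : 0 <= r^-1 ^+ #|inner L f| * a ^+ (l - #|inner L f|).
    by rewrite mulr_ge0 // exprn_ge0 // ?invr_ge0 ltW.
  case: ifP => [tf|_]; last by case: ifP => // _; rewrite mulr_ge0.
  have /and3P[ef af _] := tf; rewrite ef [r^-1 ^+ _ * _]mulrC mulrA.
  rewrite ler_wpM2r ?exprn_ge0 ?invr_ge0 ?(ltW r0) //.
  have := card_agreeing_functions af LS'; rewrite S'k -/l -(ler_nat R) => /le_trans; apply.
  rewrite natrM exprMn -natrX.
  rewrite (_ : _ * (_ * _) = theta ^+ (l - #|inner L f|) * (1 + theta^-1) ^+ l *
     (k ^ (k - l) * (k - l).+1 ^ (l - #|inner L f|))%:R); last by rewrite natrM; ring.
  by rewrite ler_wpM2r // bin_le_exp.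
rewrite -mulr_sumr sum_endo_inner // Sk -/l.
have kn : k%:R != 0 :> R by rewrite pnatr_eq0 -lt0n.
have kk : (k ^ k.-1)%:R * k%:R = (k ^ (k - l))%:R * k%:R ^+ l :> R.
  by rewrite -natrX -!natrM -expnSr prednK // -expnD subnK.
have -> : (k ^ k.-1)%:R ^+ 2 * (k%:R ^+ 2 * ((1 + theta^-1) *
          (l.-1%:R / r + theta * (k - l).+1%:R ^+ 2) / k%:R ^+ 2 ) ^+ l) =
   ((k ^ k.-1)%:R * k%:R) ^+ 2 / k%:R ^+ l ^+ 2 * ((1 + theta^-1) ^+ l *
    (l.-1%:R / r + theta * (k - l).+1%:R ^+ 2) ^+ l) :> R.
  by rewrite expr_div_n (exprAC _ 2 l) [((1 + _) * _) ^+ l]exprMn; ring.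
rewrite kk exprMn mulfK ?expf_neq0 // expr2 le_eqVlt; apply/orP; left; apply/eqP.
rewrite (_ : (k - l).+1%:R * a = theta * (k - l).+1%:R ^+ 2); last by rewrite /a; ring.
by ring.
Qed.

End AgreementBounds.

(** * Bounded differences *)

Section BoundedDifferences.
Variables (R : realFieldType) (T : finType) (p : R).
Hypothesis p01 : 0 <= p <= 1.
Implicit Types (C D E : {set T}) (u v : {set T} -> R).

Lemma expect_gt0 D v : (forall E, E \subset D -> 0 < v E) -> 0 < expect p D v.
Proof.
move=> v0; have D0 := @arg_minP _ _ _ D (fun E : {set T} => E \subset D) v (subxx D).
case: D0 => E0 sE0 min; apply: lt_le_trans (v0 E0 sE0) _.
by rewrite -[v E0](expectC p D); apply: ler_expect.
Qed.

(* Kantorovich's inequality: if a <= v <= K a then v + K a^2 / v <= (1 + K) a,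
   and AM-GM applies to the expectations of the two summands. *)
Lemma expect_inv_le D v K : 1 <= K -> (forall E, E \subset D -> 0 < v E) ->
  (forall E E', E \subset D -> E' \subset D -> v E <= K * v E') ->
  expect p D v * expect p D (fun E => (v E)^-1) <= (1 + K) ^+ 2 / (4 * K).
Proof.
move=> K1 v0 vK; have D0 := @arg_minP _ _ _ D (fun E : {set T} => E \subset D) v (subxx D).
case: D0 => E0 sE0 min; have a0 := v0 E0 sE0; set a := v E0 in min a0.
have K0 : 0 < K by lra.
set x := expect p D v; set y := expect p D _.
have H : x + K * a ^+ 2 * y <= (1 + K) * a.
  rewrite -expectZ -expectD -[leRHS](expectC p D); apply: ler_expect => // E sE.
  have vE := v0 E sE; rewrite -subr_ge0.
  rewrite (_ : _ - _ = (v E - a) * (K * a - v E) / v E); last by field; rewrite gt_eqF.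
  by rewrite divr_ge0 ?mulr_ge0 ?subr_ge0 ?min ?vK // ltW.
have x0 : 0 < x by apply: expect_gt0.
have y0 : 0 < y by apply: expect_gt0 => E sE; rewrite invr_gt0 v0.
rewrite ler_pdivlMr ?mulr_gt0 // -(ler_pM2r (exprn_gt0 2 a0)).
apply: le_trans (_ : (x + K * a ^+ 2 * y) ^+ 2 <= _).
  have := sqr_ge0 (x - K * a ^+ 2 * y); rewrite -subr_ge0 => h.
  by rewrite -subr_ge0 (_ : _ - _ = (x - K * a ^+ 2 * y) ^+ 2) ?sqr_ge0 //; ring.
rewrite -exprMn ler_sqr ?nnegrE ?mulr_ge0 ?addr_ge0 ?mulr_ge0 ?sqr_ge0 //; try exact: ltW.

Qed.

(** The last colour is averaged out: by [expect_inv_le] the conditional expectation of 1/u is at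
    most the constant times 1/v, where v is that of u, and v inherits the ratio hypothesis for the
    remaining colours. So each colour costs one factor. *)
Lemma expect_mul_inv_le D (c : T -> nat) u K N : 1 <= K ->
  (forall E, E \subset D -> 0 < u E) -> (forall e, e \in D -> (c e < N)%N) ->
  (forall (i : nat) E E', E \subset D -> E' \subset D ->
     (forall e, e \in D -> c e != i -> (e \in E) = (e \in E')) -> u E <= K * u E') ->
  expect p D u * expect p D (fun E => (u E)^-1) <= ((1 + K) ^+ 2 / (4 * K)) ^+ N.
Proof.
move=> K1; elim: N D u => [|N IH] D u u0 cN uK.
  have -> : D = set0 by apply/setP => e; rewrite inE; apply/negP => /cN.
  rewrite !expect_set0 mulfV ?expr0 // gt_eqF // u0 //.
  by apply/subsetP => e; rewrite inE.
pose A := [set e in D | (c e < N)%N]; pose C := D :\: A.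
have sAD : A \subset D by apply/subsetP => e; rewrite inE => /andP[].
have CN e : e \in C -> c e = N.
  by rewrite !inE => /andP[+ eD]; rewrite eD /= -leqNgt => cN'; apply/eqP; rewrite eqn_leq cN' -ltnS cN.
have sU (B B' : {set T}) : B \subset A -> B' \subset C -> B :|: B' \subset D.
  by move=> sB sB'; rewrite subUset (subset_trans sB) // (subset_trans sB') // subsetDl.
pose v (B : {set T}) := expect p C (fun B' => u (B :|: B')).
have v0 (B : {set T}) : B \subset A -> 0 < v B by move=> sB; apply: expect_gt0 => B' sB'; apply/u0/sU.
have M0 : 0 <= (1 + K) ^+ 2 / (4 * K) by rewrite divr_ge0 ?sqr_ge0 // mulr_ge0 //; lra.
rewrite !(expect_split _ _ sAD) -/C.
have H : expect p A (fun B => expect p C (fun B' => (u (B :|: B'))^-1)) <=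
    expect p A (fun B => (1 + K) ^+ 2 / (4 * K) * (v B)^-1).
  apply: ler_expect => // B sB; rewrite ler_pdivlMr ?v0 // mulrC; apply: expect_inv_le => // [E sE|E E' sE sE'].
    exact/u0/sU.
  apply: (uK N); rewrite ?sU // => e eD ceN; rewrite !inE.
  have nC : e \notin C by apply: contra ceN => /CN->.
  by rewrite (contraNF (subsetP sE e) nC) (contraNF (subsetP sE' e) nC).
apply: le_trans (ler_wpM2l _ H) _; first by apply: expect_ge0 => // B /v0/ltW.
rewrite expectZ mulrCA [_ ^+ N.+1]exprS ler_wpM2l //; apply: IH => // [e|i E E' sE sE' EE'].
  by rewrite inE => /andP[].
rewrite -expectZ; apply: ler_expect => // B' sB'; apply: (uK i); rewrite ?sU // => e eD cei.
rewrite !inE; have [eA|eA] := boolP (e \in A); first by rewrite EE'.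
by rewrite (contraNF (subsetP sE e) eA) (contraNF (subsetP sE' e) eA).
Qed.

(** Markov's inequality for [K ^+ f] and for its inverse; [expect_mul_inv_le] bounds the product of
    their expectations. *)
Lemma bounded_differences D (c : T -> nat) (f : {set T} -> nat) (K : R) N s s' : 1 <= K ->
  (forall e, e \in D -> (c e < N)%N) ->
  (forall (i : nat) E E', E \subset D -> E' \subset D ->
     (forall e, e \in D -> c e != i -> (e \in E) = (e \in E')) -> (f E <= (f E').+1)%N) ->
  expect p D (fun E => (s <= f E)%N%:R) * expect p D (fun E => (f E <= s')%N%:R) * K ^+ s <=
    K ^+ s' * ((1 + K) ^+ 2 / (4 * K)) ^+ N.
Proof.
move=> K1 cN fN; have K0 : 0 < K by lra.
have := @expect_mul_inv_le D c (fun E => K ^+ f E) K N K1.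
move=> /(_ (fun E _ => exprn_gt0 (f E) K0) cN) => /(_ _)/wrap[i E E' sE sE' EE'|H].
  by rewrite -exprS ler_weXn2l // (fN i).
apply: le_trans (ler_wpM2l (exprn_ge0 s' (ltW K0)) H).
rewrite [leRHS]mulrCA mulrAC [X in X * _]mulrC.
apply: ler_pM; rewrite ?mulr_ge0 ?expect_ge0 ?exprn_ge0 ?(ltW K0) // -expectZ; last first.
  apply: ler_expect => // E _; case: leqP => sf /=.
    by rewrite ler_pdivlMr ?exprn_gt0 // mul1r ler_weXn2l.
  by rewrite mulr_ge0 ?invr_ge0 ?exprn_ge0 // ltW.
apply: ler_expect => // E _; case: leqP => sf; rewrite ?mulr0 ?mulr1 ?exprn_ge0 ?(ltW K0) //.
by rewrite ler_weXn2l.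
Qed.

End BoundedDifferences.

(** * Transversals of a block partition *)

Section Transversals.
Variables (T : finType) (b : T -> nat).
Implicit Types (S L : {set T}).

Definition transversal S := [forall v in S, forall w in S, (b v == b w) ==> (v == w)].

Lemma transversalP S : reflect {in S &, injective b} (transversal S).
Proof.
apply: (iffP forall_inP) => [H v w vS wS bvw|H v vS].
  by apply/eqP; have /forall_inP/(_ w wS) := H v vS; rewrite bvw eqxx.
by apply/forall_inP => w wS; apply/implyP => /eqP/(H _ _ vS wS)->.
Qed.

Variables (N m k : nat).
Hypothesis fiber : forall i, (i < N)%N -> #|[set v | b v == i]| = m.

Definition block_transversal S := transversal S && [forall v in S, (b v < N)%N].

Definition transversals : {set {set T}} := [set S | block_transversal S && (#|S| == k)].

(** The new vertex may be any of the [m] vertices of any of the [N - #|L|] blocks that [L]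
    misses. *)
Lemma card_block_extensions L : block_transversal L ->
  #|[set v | (v \notin L) && block_transversal (v |: L)]| = ((N - #|L|) * m)%N.
Proof.
case/andP=> tL /forall_inP NL.
have -> : [set v | (v \notin L) && block_transversal (v |: L)] =
    [set v | (b v < N)%N && (b v \notin [seq b w | w in L])].
  apply/setP => v; rewrite !inE; apply/andP/andP => [[vL /andP[/transversalP tvL /forall_inP NvL]]|[bv nv]].
    split; first by apply: NvL; apply: setU11.
    apply/mapP => -[w]; rewrite mem_enum => wL /tvL E; move: vL.
    by rewrite E ?setU11 // ?wL // setU1r.
  have vL : v \notin L by apply: contra nv => vL; apply: map_f; rewrite mem_enum.
  split=> //; apply/andP; split; last first.
    by apply/forall_inP => w; rewrite !inE => /orP[/eqP->//|/NL].
  apply/transversalP => x y; rewrite !inE => /orP[/eqP->|xL] /orP[/eqP->|yL] // E.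
  - by case/negP: nv; rewrite E map_f // mem_enum.
  - by case/negP: nv; rewrite -E map_f // mem_enum.
  - by move/transversalP: tL; apply.
(* One index beyond the [N] blocks makes [inord] available even for [N = 0]; [ord_max] is never a
   block met by [L]. *)
pose f v : 'I_N.+1 := inord (b v).
pose A : {set 'I_N.+1} := [set i : 'I_N.+1 | (i < N)%N && (i \notin [seq f w | w in L])].
have fE v : (b v < N)%N -> f v = b v :> nat by move=> bv; rewrite /f inordK // ltnS ltnW.
have cA : #|A| = (N - #|L|)%N.
  have := cardsC [set f w | w in L]; rewrite card_in_imset; last first.
    move=> v w vL wL /(congr1 (@nat_of_ord _)); rewrite !fE ?NL //.
    by move/transversalP: tL; apply.
  rewrite card_ord => E; have := cardsD1 ord_max (~: [set f w | w in L]).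
  have -> /= : ord_max \in ~: [set f w | w in L].
    rewrite inE; apply/imsetP => -[w wL /(congr1 (@nat_of_ord _))]; rewrite fE ?NL //=.
    by move=> E'; have := NL w wL; rewrite -E' ltnn.
  rewrite (_ : _ :\ _ = A); first by move=> E2; move: E; rewrite E2; move: #|A| #|L| => x y; lia.
  apply/setP => i; rewrite !inE ltn_neqAle -ltnS ltn_ord andbT; congr (_ && ~~ _).
  apply/imsetP/mapP => -[w wL ->]; exists w => //; by rewrite ?mem_enum // -mem_enum.
rewrite -cA -sum_nat_const -sum1_card.
rewrite (partition_big f (fun i => i \in A)) => [|v]; last first.
  rewrite !inE => /andP[bv nv]; rewrite fE // bv /=; apply: contra nv => /mapP[w].
  rewrite mem_enum => wL /(congr1 (@nat_of_ord _)); rewrite fE // fE ?NL // => ->.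
  by apply: map_f; rewrite mem_enum.
apply: eq_bigr => i; rewrite inE => /andP[iN ni]; rewrite -(fiber iN) sum1dep_card.
apply: eq_card => v; rewrite !inE; apply/andP/eqP => [[/andP[bv nv] /eqP<-]|bv]; first by rewrite fE.
have fv : f v = i by apply: val_inj; rewrite /= fE bv.
rewrite fv eqxx bv iN; split=> //=; apply: contra ni => /mapP[w]; rewrite mem_enum => wL E.
by rewrite -fv /f bv E; apply: map_f; rewrite mem_enum.
Qed.

(** Double counting of pairs of a transversal [S] above [L] and a vertex [v] of [S :\: L], by
    induction on the number of vertices still to be added. *)
Lemma card_transversals_above L : block_transversal L -> (#|L| <= k)%N ->
  #|[set S in transversals | L \subset S]| = ('C(N - #|L|, k - #|L|) * m ^ (k - #|L|))%N.
Proof.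
move Ei: (k - #|L|)%N => i; elim: i L Ei => [|i IH] L Ei tL Lk.
  rewrite bin0 mul1n expn0; apply/eqP/cards1P; exists L; apply/setP => S; rewrite !inE.
  have Lk' : #|L| = k by lia.
  apply/andP/eqP => [[/andP[_ /eqP Sk] LS]|->]; last by rewrite tL Lk' eqxx.
  by apply/esym/eqP; rewrite eqEcard LS Sk Lk' leqnn.
pose V := [set v | (v \notin L) && block_transversal (v |: L)].
have cV : #|V| = ((N - #|L|) * m)%N by apply: card_block_extensions.
have trans_sub S S' : S' \subset S -> block_transversal S -> block_transversal S'.
  move=> /subsetP S'S /andP[/transversalP tS /forall_inP NS]; apply/andP; split.
    by apply/transversalP => v w /S'S vS /S'S wS; apply: tS.
  by apply/forall_inP => v /S'S /NS.
have : (\sum_(v in V) #|[set S in transversals | (v |: L) \subset S]| =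
        \sum_(S in [set S in transversals | L \subset S]) i.+1)%N.
  transitivity (\sum_(v in V) \sum_(S in [set S in transversals | L \subset S]) (v \in S))%N.
    apply: eq_bigr => v _; rewrite -sum1_card big_mkcond [RHS]big_mkcond; apply: eq_bigr => S _.
    by rewrite !inE subUset sub1set; case: (_ && (_ == k)); case: (v \in S); case: (L \subset S).
  rewrite exchange_big; apply: eq_bigr => S; rewrite !inE => /andP[/andP[tS /eqP Sk] LS].
  have <- : #|S :\: L| = i.+1 by rewrite cardsD (setIidPr LS) Sk.
  rewrite -sum1_card big_mkcond [RHS]big_mkcond; apply: eq_bigr => v _; rewrite !inE.
  have [vS|vS] := boolP (v \in S); last by rewrite andbF; case: ifP.
  rewrite andbT (_ : block_transversal _); first by rewrite andbT; case: ifP.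
  by apply: trans_sub tS; rewrite subUset sub1set vS.
rewrite sum_nat_const (eq_bigr (fun=> 'C((N - #|L|).-1, i) * m ^ i)%N) => [|v]; last first.
  rewrite inE => /andP[vL tvL]; rewrite IH // cardsU1 vL /= ?add1n; try lia.
  by rewrite subnS.
rewrite sum_nat_const cV => E; apply/eqP; rewrite -(eqn_pmul2r (ltn0Sn i)) -E expnS.
apply/eqP; have E2 := mul_bin_diag (N - #|L|) i.
transitivity ((N - #|L|) * 'C((N - #|L|).-1, i) * (m * m ^ i))%N; first by ring.
by rewrite E2; ring.
Qed.

Lemma card_transversals : #|transversals| = ('C(N, k) * m ^ k)%N.
Proof.
have := @card_transversals_above set0; rewrite cards0 !subn0 => <- //.
  by apply: eq_card => S; rewrite !inE sub0set andbT.
by apply/andP; split; apply/forall_inP => v; rewrite inE.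
Qed.

Lemma card_transversals_above_le L :
  (#|[set S in transversals | L \subset S]| <= 'C(N - #|L|, k - #|L|) * m ^ (k - #|L|))%N.
Proof.
have [->|/set0Pn[S]] := eqVneq [set S in transversals | L \subset S] set0; first by rewrite cards0.
rewrite !inE => /andP[/andP[/andP[/transversalP tS /forall_inP NS] /eqP Sk] LS].
rewrite card_transversals_above // -?Sk ?subset_leq_card //; apply/andP; split.
  by apply/transversalP => v w /(subsetP LS) vS /(subsetP LS) wS; apply: tS.
by apply/forall_inP => v /(subsetP LS) /NS.
Qed.

End Transversals.

(** The ratio C(N - l, k - l) / C(N, k) is the quotient of the falling factorials of k and N, and
    each of the l factors of the latter is at least N - k. *)
Lemma bin_ratio_le N k l : (l <= k)%N -> (k <= N)%N ->
  ('C(N - l, k - l) * (N - k) ^ l <= 'C(N, k) * k ^_ l)%N.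
Proof.
move=> + kN; elim: l => [|l IH] lk; first by rewrite !subn0 expn0 ffactn0.
rewrite ffactnSr mulnA; apply: leq_trans (leq_mul (IH (ltnW lk)) (leqnn _)).
have := mul_bin_diag (N - l) (k - l.+1); rewrite -subnS subnSK // => E.
rewrite [leqRHS]mulnAC [('C(N - l, _) * _)%N]mulnC -E expnS.
rewrite [leqLHS]mulnA leq_mul2r; apply/orP; right.
by rewrite [leqRHS]mulnC leq_mul2l; apply/orP; right; lia.
Qed.

(** * Probabilities in G(n,p) *)

Section Gnp.
Variables (R : realType) (n : nat) (p : R).
Hypothesis p01 : 0 < p < 1.
Implicit Types (S : {set 'I_n}) (E : {set {set 'I_n}}).

Let p01' : 0 <= p <= 1. Proof. by case/andP: p01; lra. Qed.

Lemma vpairsE : vpairs n = pairs setT.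
Proof. by apply/setP => e; rewrite !inE subsetT andbT. Qed.

Lemma gnp_probE (A : pred {set {set 'I_n}}) :
  gnp_prob p A = expect p (pairs setT) (fun E => (A E)%:R).
Proof.
rewrite /gnp_prob /expect big_mkcondr vpairsE; apply: eq_bigr => E _; rewrite /weight.
by case: (A E); rewrite ?mulr1 ?mulr0.
Qed.

Lemma le_gnp_prob (A B : pred {set {set 'I_n}}) :
  (forall E, E \subset vpairs n -> A E -> B E) -> gnp_prob p A <= gnp_prob p B.
Proof.
move=> AB; rewrite !gnp_probE; apply: ler_expect => // E sE.
rewrite ler_nat; have := AB E; rewrite vpairsE => /(_ sE).
by case: (A E) => // /(_ isT) ->.
Qed.

Lemma gnp_prob_ge0 (A : pred {set {set 'I_n}}) : 0 <= gnp_prob p A.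
Proof. by rewrite gnp_probE expect_ge0. Qed.

Lemma gnp_prob_le1 (A : pred {set {set 'I_n}}) : gnp_prob p A <= 1.
Proof.
rewrite -[leRHS](expectC p (pairs [set: 'I_n])) gnp_probE.
by apply: ler_expect => // E _; case: (A E).
Qed.

Lemma gnp_probC (A : pred {set {set 'I_n}}) : gnp_prob p A = 1 - gnp_prob p (fun E => ~~ A E).
Proof.
apply/eqP; rewrite eq_sym subr_eq -[X in X == _](expectC p (pairs [set: 'I_n])) !gnp_probE -expectD.
by apply/eqP; apply: eq_expect => E _; case: (A E); rewrite ?addr0 ?add0r.
Qed.

Lemma gnp_probU (A B C : pred {set {set 'I_n}}) : (forall E, A E -> B E || C E) ->
  gnp_prob p A <= gnp_prob p B + gnp_prob p C.
Proof.
move=> ABC; rewrite !gnp_probE -expectD; apply: ler_expect => // E _.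
by rewrite -natrD ler_nat; have := ABC E; case: (A E) => // /(_ isT); case: (B E); case: (C E).
Qed.

Lemma inducedE E S : E \subset pairs setT -> Defs.induced E S = E :&: pairs S.
Proof.
move=> sE; apply/setP => e; rewrite !inE; apply: andb_id2l => /(subsetP sE).
by rewrite inE => /andP[-> _].
Qed.

Lemma max_induced_forestP E k : (0 < k <= max_induced_forest E)%N ->
  exists2 S : {set 'I_n}, #|S| = k & is_forest (Defs.induced E S).
Proof.
case/andP=> k0 kmax; have [[S]|H] := pselect (exists2 S : {set 'I_n}, is_forest (Defs.induced E S) & (k <= #|S|)%N).
  move=> fS kS; have /card_gt0P[S'] : (0 < #|[set A : {set 'I_n} | A \subset S & #|A| == k]|)%N.
    by rewrite cards_draws bin_gt0.
  rewrite inE => /andP[S'S /eqP S'k]; exists S' => //; apply: forest_sub fS.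
  by apply/subsetP => e; rewrite !inE => /andP[-> /subset_trans->].
suff : (max_induced_forest E <= k.-1)%N by case: k k0 kmax {H} => // k _ /leq_trans /[apply]; rewrite ltnn.
apply/bigmax_leqP => S /asboolP fS; rewrite -ltnS prednK // ltnNge; apply/negP => kS.
by apply: H; exists S.
Qed.

(** A union bound over the possible traces F, each of probability (1-p)^C r^|F| for C the number of
    pairs in S. Mapping F to a parent function is injective, and the sum over all functions on [S]
    factorises by [sum_endo_inner]. *)
Lemma prob_induced_forest S :
  expect p (pairs setT) (fun E => `[< is_forest (Defs.induced E S) >]%:R) <=
  (1 - p) ^+ 'C(#|S|, 2) * (1 + #|S|.-1%:R * (p / (1 - p))) ^+ #|S|.
Proof.
have r0 := odds_gt0 p01; set r := p / (1 - p) in r0 *.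
have sS : pairs S \subset pairs setT by apply: pairsS; apply: subsetT.
pose Fo := [set F : {set {set 'I_n}} | (F \subset pairs S) && `[< is_forest F >]].
apply: le_trans (_ : expect p (pairs setT) (fun E => \sum_(F in Fo) (E :&: pairs S == F)%:R) <= _).
  apply: ler_expect => // E sE; rewrite inducedE //; case: asboolP => fE; last by apply: sumr_ge0.
  rewrite (bigD1 (E :&: pairs S)) /=; last by rewrite inE subsetIr; apply/asboolP.
  by rewrite eqxx lerDl; apply: sumr_ge0.
rewrite expect_sum.
apply: le_trans (_ : \sum_(F in Fo) (1 - p) ^+ 'C(#|S|, 2) * r ^+ #|F| <= _).
  apply: ler_sum => F; rewrite inE => /andP[FS _]; rewrite expect_trace // weightE // card_pairs.
  have FC : (#|F| <= 'C(#|S|, 2))%N by rewrite -card_pairs subset_leq_card.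
  have q0 : (1 - p) ^+ #|F| != 0 by rewrite expf_neq0 //; case/andP: p01; lra.
  rewrite -{2}(subnK FC) exprD /r expr_div_n.
  by rewrite [_ ^+ #|F| / _]mulrC -mulrA mulVKf // mulrC.
rewrite -mulr_sumr ler_wpM2l ?exprn_ge0 //; first by case/andP: p01; lra.
have := @sum_endo_inner _ R S S 1 r (subxx S); rewrite subnn expn0 mul1r mulr1 addrC => <-.
under [leRHS]eq_bigr => f _ do rewrite expr1n mulr1.
pose par (F : {set {set 'I_n}}) : {ffun 'I_n -> 'I_n} :=
  odflt [ffun v => v] [pick f | [&& endo S f, edges S f == F & #|inner S f| == #|F| ]].
have parP F : F \in Fo -> [/\ endo S (par F), edges S (par F) = F & #|inner S (par F)| = #|F| ].
  rewrite inE => /andP[FS /asboolP fF]; rewrite /par; case: pickP => [f|H] /=.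
    by case/and3P=> ? /eqP ? /eqP.
  have [f [ef edf inf]] := forest_parent fF FS.
  by have := H f; rewrite ef edf inf !eqxx.
rewrite (eq_bigr (fun F => r ^+ #|inner S (par F)|)); last by move=> F /parP[_ _ ->].
rewrite -(big_imset (fun f => r ^+ #|inner S f|)) /=; last first.
  by move=> F F' /parP[_ eF _] /parP[_ eF' _] E; rewrite -eF -eF' E.
rewrite big_mkcond [leRHS]big_mkcond; apply: ler_sum => f _.
case: ifP => [/imsetP[F /parP[eF _ _] ->]|_]; first by rewrite eF.
by case: ifP => // _; rewrite exprn_ge0 // ltW.
Qed.

Lemma prob_large_forest k : (0 < k)%N ->
  gnp_prob p (fun E => k <= max_induced_forest E)%N <=
  'C(n, k)%:R * ((1 - p) ^+ 'C(k, 2) * (1 + k.-1%:R * (p / (1 - p))) ^+ k).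
Proof.
move=> k0; rewrite gnp_probE; pose Sk := [set S : {set 'I_n} | #|S| == k].
apply: le_trans (_ : expect p (pairs setT) (fun E => \sum_(S in Sk) `[< is_forest (Defs.induced E S) >]%:R) <= _).
  apply: ler_expect => // E sE; case: leqP => // kE; last by apply: sumr_ge0.
  have [|S Sk' fS] := @max_induced_forestP E k; first by rewrite k0.
  rewrite (bigD1 S) /=; last by rewrite inE Sk'.
  rewrite (_ : `[< _ >] = true); last by apply/asboolP.
  by rewrite lerDl; apply: sumr_ge0.
rewrite expect_sum; have <- : #|Sk| = 'C(n, k) by rewrite -[in RHS](card_ord n) -card_draws.
rewrite mulr_natl -sumr_const; apply: ler_sum => S; rewrite inE => /eqP <-; exact: prob_induced_forest.
Qed.

(** * Forests with at most one vertex in each block *)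

Section Blocks.
Variable m : nat.
Hypothesis m0 : (0 < m)%N.

Definition block (v : 'I_n) : nat := (v %/ m)%N.

Definition max_transversal_forest E : nat :=
  \max_(S | transversal block S && `[< is_forest (Defs.induced E S) >]) #|S|.

Lemma max_transversal_forest_le E : (max_transversal_forest E <= max_induced_forest E)%N.
Proof. by apply/bigmax_leqP => S /andP[_ fS]; apply: leq_bigmax_cond. Qed.

(** An edge is coloured by the larger block of its ends, so every edge of colour i touches block i.
    Deleting the at most one vertex of [S] in that block leaves a set on which [E] and [E'] induce
    the same graph. *)
Lemma max_transversal_forest_lipschitz i E E' : E \subset pairs setT -> E' \subset pairs setT ->
  (forall e, e \in pairs setT -> \max_(v in e) block v != i -> (e \in E) = (e \in E')) ->
  (max_transversal_forest E <= (max_transversal_forest E').+1)%N.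
Proof.
move=> sE sE' EE'; apply/bigmax_leqP => S /andP[/transversalP tS /asboolP fS].
pose S' := [set v in S | block v != i].
have S'S : S' \subset S by apply/subsetP => v; rewrite inE => /andP[].
apply: leq_trans (_ : #|S'|.+1 <= _)%N.
  rewrite -(cardsID S' S) (setIidPr S'S) addnC -addn1 addnC leq_add2l.
  apply/card_le1_eqP => v w; rewrite !inE => /andP[+ vS] /andP[+ wS].
  by rewrite vS wS /= !negbK => /eqP bv /eqP bw; apply: tS => //; rewrite bv bw.
rewrite ltnS; apply: (@leq_bigmax_cond _ _ (fun S : {set 'I_n} => #|S|)); apply/andP; split.
  by apply/transversalP => v w /(subsetP S'S) vS /(subsetP S'S); apply: tS.
apply/asboolP; rewrite (_ : Defs.induced E' S' = Defs.induced E S').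
  by apply: forest_sub fS; apply/subsetP => e; rewrite !inE => /andP[-> /subset_trans->].
rewrite !inducedE //; apply/setP => e; rewrite !in_setI [LHS]andbC [RHS]andbC.
apply: andb_id2l; rewrite inE => /andP[e2 eS']; rewrite EE' //; first by rewrite inE e2 subsetT.
have e0 : (0 < #|e|)%N by rewrite (eqP e2).
have [v ve ->] := @eq_bigmax_cond _ (mem e) block e0.
by have := subsetP eS' v ve; rewrite inE => /andP[].
Qed.

(** The extra colour in the exponent accounts for an incomplete last block. *)
Lemma max_transversal_forest_concentration (K : R) s s' : 1 <= K ->
  gnp_prob p (fun E => s <= max_transversal_forest E)%N *
  gnp_prob p (fun E => max_transversal_forest E <= s')%N * K ^+ s <=
    K ^+ s' * ((1 + K) ^+ 2 / (4 * K)) ^+ (n %/ m).+1.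
Proof.
move=> K1; rewrite !gnp_probE; apply: (@bounded_differences _ _ p p01' _ (fun e : {set 'I_n} => \max_(v in e) block v)%N
  max_transversal_forest) => // [e _|i E E'].
  by rewrite ltnS; apply/bigmax_leqP => v _; rewrite /block leq_div2r // ltnW.
exact: max_transversal_forest_lipschitz.
Qed.

Variables (N k : nat).
Hypotheses (Nm : (N * m <= n)%N) (k0 : (0 < k)%N) (kN : (k < N)%N).

Lemma card_block i : (i < N)%N -> #|[set v | block v == i]| = m.
Proof.
move=> iN; have im (j : 'I_m) : (i * m + j < n)%N.
  by apply: leq_trans Nm; apply: leq_trans (_ : i.+1 * m <= _)%N; rewrite ?leq_mul2r ?iN ?orbT // mulSn; have := ltn_ord j; lia.
rewrite -[RHS]card_ord -cardsT -(@card_in_imset _ _ (fun j : 'I_m => Ordinal (im j))); last first.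
  by move=> j j' _ _ [] /addnI jj'; apply: val_inj.
apply: eq_card => v; rewrite inE /block; apply/eqP/imsetP => [vi|[j _ ->]] /=.
  have vm : (v %% m < m)%N by rewrite ltn_mod.
  by exists (Ordinal vm) => //; apply: val_inj; rewrite /= -vi -divn_eq.
by rewrite divnMDl // divn_small ?addn0.
Qed.

(** The second moment is taken over transversals of the first [N] blocks, which have exactly [m]
    vertices each. By [bin_ratio_le] the fraction of them above a set of size l is at most k^_l /
    ((N-k)m)^l, so [(N - k) * m] takes the place of n. *)
Lemma prob_transversal_forest (H : nat -> R) (theta : R) : 0 < theta -> (forall l, 0 <= H l) ->
  (forall l, (l <= k)%N ->
     (1 <= k%:R * (p / (1 - p))) && (2 ^+ l * (1 - p)^-1 ^+ 'C(l, 2) <= H l) ||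
     (k%:R ^+ 2 * ((1 + theta^-1) * (l.-1%:R / (p / (1 - p)) + theta * (k - l).+1%:R ^+ 2)
        / k%:R ^+ 2) ^+ l * (1 - p)^-1 ^+ 'C(l, 2) <= H l)) ->
  1 <= gnp_prob p (fun E => k <= max_transversal_forest E)%N *
    \sum_(l < k.+1) 'C(k, l)%:R * (k ^_ l)%:R / ((N - k) * m)%:R ^+ l * H l.
Proof.
move=> t0 H0 Hb; pose F := transversals block N k.
have Fk S : S \in F -> #|S| = k by rewrite inE => /andP[_ /eqP].
have cF : #|F| = ('C(N, k) * m ^ k)%N by apply: card_transversals; apply: card_block.
have F0 : 0 < #|F|%:R :> R by rewrite cF ltr0n muln_gt0 bin_gt0 ltnW //= expn_gt0 m0.
have := @second_moment R _ p k F p01 k0 Fk H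
  (fun l => if (l <= k)%N then 'C(N - l, k - l) * m ^ (k - l) else 0)%N H0 _ _.
case/(_ _ _)/wrap => [L|S S' L SF S'F LE|SM].
- have [Lk|Lk] := leqP #|L| k; first exact: card_transversals_above_le card_block L.
  rewrite leqn0 cards_eq0; apply/eqP/setP => S; rewrite !inE; apply/negP => /andP[/andP[_ /eqP Sk]].
  by move/subset_leq_card; rewrite Sk leqNgt Lk.
- have LS : L \subset S by rewrite LE subsetIl.
  have LS' : L \subset S' by rewrite LE subsetIr.
  have Lk : (#|L| <= k)%N by rewrite -(Fk S SF) subset_leq_card.
  have K0 : 0 <= (k ^ k.-1)%:R ^+ 2 :> R by rewrite sqr_ge0.
  case/orP: (Hb _ Lk) => [/andP[kr HL]|HL].
    apply: le_trans (ler_wpM2l K0 HL).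
    by apply: agreement_bound_trees; rewrite ?Fk.
  apply: le_trans (ler_wpM2l K0 HL).
  by apply: agreement_bound_functions; rewrite ?Fk.
rewrite -(ler_pM2l F0) mulr1; apply: le_trans SM _.
rewrite [leRHS]mulrCA; apply: ler_pM.
- by apply: expect_ge0.
- by apply: sumr_ge0 => l _; rewrite !mulr_ge0.
- rewrite gnp_probE; apply: ler_expect => // E sE; rewrite ler_nat.
  case: exists_inP => // -[S SF /existsP[f /andP[tf /eqP Ef]]].
  rewrite lt0b -(Fk S SF); apply: (@leq_bigmax_cond _ _ (fun S : {set 'I_n} => #|S|)).
  move: SF; rewrite inE => /andP[/andP[-> _] _] /=; apply/asboolP.
  by rewrite inducedE // Ef; apply: forest_edges; case/and3P: tf.
rewrite mulr_sumr; apply: ler_sum => l _; rewrite !mulrA ler_wpM2r //.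
have lk : (l <= k)%N by rewrite -ltnS.
rewrite lk ler_pdivlMr ?exprn_gt0 ?ltr0n ?muln_gt0 ?subn_gt0 ?kN //.
rewrite [leRHS]mulrAC [leRHS]mulrC -!mulrA ler_wpM2l // cF -natrX -!natrM ler_nat.
have := leq_mul (bin_ratio_le lk (ltnW kN)) (leqnn (m ^ k)).
have Em : (m ^ k = m ^ (k - l) * m ^ l)%N by rewrite -expnD subnK.
by rewrite expnMn => H'; apply: leq_trans (leq_trans _ H') _; rewrite leq_eqVlt; apply/orP; left;
  apply/eqP; rewrite ?Em; ring.
Qed.

End Blocks.
End Gnp.

(** * Asymptotics of the second moment *)

Section ElementaryBounds.
Variable R : realType.
Implicit Types x y c K : R.

(** The cube of the tangent bound for exp(cx/3) is a cubic, which beats the square; the minimum with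
    1 in [c'] gives c'(1 + x) <= 1 + cx/3. *)
Lemma exp_dominates c K : 0 < c -> exists2 x0 : R, 0 <= x0 &
  forall x, x0 <= x -> K * (1 + x) ^+ 2 <= expR (c * x).
Proof.
move=> c0; pose c' := Num.min (c / 3) 1.
have c'0 : 0 < c' by rewrite lt_min ltr01 andbT divr_gt0.
exists (`|K| / c' ^+ 3) => [|x xK]; first by rewrite divr_ge0 // exprn_ge0 // ltW.
have x0 : 0 <= x by apply: le_trans xK; rewrite divr_ge0 // exprn_ge0 // ltW.
have c'3 : c' <= c / 3 by rewrite ge_min lexx.
have c'1 : c' <= 1 by rewrite ge_min lexx orbT.
have H : c' * (1 + x) <= expR (c / 3 * x).
  by apply: le_trans (expR_ge1Dx _); have := ler_wpM2r x0 c'3; lra.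
apply: le_trans (_ : (c' * (1 + x)) ^+ 3 <= _).
  have -> : (c' * (1 + x)) ^+ 3 = (c' ^+ 3 * (1 + x)) * (1 + x) ^+ 2 by ring.
  rewrite ler_wpM2r ?sqr_ge0 //.
  apply: le_trans (ler_norm K) _; move: xK; rewrite ler_pdivrMr ?exprn_gt0 //; have := exprn_ge0 3 (ltW c'0); lra.
have -> : c * x = 3%:R * (c / 3 * x) by field.
by rewrite expRM_natl lerXn2r ?nnegrE ?expR_ge0 ?mulr_ge0 ?addr_ge0 // ltW.
Qed.

Lemma natr_bin2 l : 'C(l, 2)%:R = l%:R * (l%:R - 1) / 2 :> R.
Proof.
elim: l => [|l IH]; first by rewrite bin0n /= !mul0r.
by rewrite binS bin1 natrD IH -[l.+1%:R]natr1; field.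
Qed.

Lemma fact_lower l : l%:R ^+ l <= l`!%:R * expR l%:R :> R.
Proof.
elim: l => [|l IH]; first by rewrite expr0 fact0 expR0 mulr1.
have [->|l0] := posnP l; first by rewrite expr1 factS fact0 mul1r; apply: le_trans (expR_ge1Dx _); lra.
have l0' : 0 < l%:R :> R by rewrite ltr0n.
rewrite factS natrM -[X in expR X]natr1 expRD exprS -mulrA ler_wpM2l //.
rewrite mulrA; apply: le_trans (ler_wpM2r (expR_ge0 _) IH).
have -> : l.+1%:R = l%:R * (1 + l%:R^-1) :> R by rewrite mulrDr mulfV ?gt_eqF // mulr1 natr1.
rewrite exprMn ler_wpM2l ?exprn_ge0 //.
have -> : expR 1 = expR (l%:R^-1) ^+ l :> R by rewrite -expRM_natl mulfV ?gt_eqF.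
by rewrite lerXn2r ?nnegrE ?expR_ge0 ?addr_ge0 ?invr_ge0 // expR_ge1Dx.
Qed.

Lemma fact_upper l : (0 < l)%N -> l`!%:R * expR l%:R <= expR 1 * l%:R * l%:R ^+ l :> R.
Proof.
elim: l => // l IH _; have [->|l0] := posnP l; first by rewrite factS fact0 expr1 !mulr1 mul1r.
have l0' : 0 < l%:R :> R by rewrite ltr0n.
have S0 : 0 < l.+1%:R :> R by rewrite ltr0n.
have Sn : l.+1%:R != 0 :> R by rewrite gt_eqF.
rewrite factS natrM -[X in expR X]natr1 expRD.
have -> : l.+1%:R * l`!%:R * (expR l%:R * expR 1) = l.+1%:R * expR 1 * (l`!%:R * expR l%:R) :> R by ring.
have -> : expR 1 * l.+1%:R * l.+1%:R ^+ l.+1 = l.+1%:R * expR 1 * l.+1%:R ^+ l.+1 :> R by ring.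
rewrite ler_wpM2l ?mulr_ge0 ?expR_ge0 //; apply: le_trans (IH l0) _.
have -> : expR 1 * l%:R * l%:R ^+ l = (expR (l.+1%:R^-1) * l%:R) ^+ l.+1 :> R.
  by rewrite exprMn -expRM_natl mulfV // -mulrA exprS.
rewrite lerXn2r ?nnegrE ?mulr_ge0 ?expR_ge0 //.
rewrite -ler_pdivlMl ?expR_gt0 // -expRN mulrC -ler_pdivrMl //.
apply: le_trans (expR_ge1Dx _); rewrite -natr1 -[X in X - _](mulVf Sn) -natr1 mulrDr mulr1 addrK //.
Qed.

Lemma bin_upper (k l : nat) : (0 < l)%N -> 'C(k, l)%:R <= (expR 1 * k%:R / l%:R) ^+ l :> R.
Proof.
move=> l0; have l0' : 0 < l%:R :> R by rewrite ltr0n.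
rewrite expr_div_n ler_pdivlMr ?exprn_gt0 // exprMn.
apply: le_trans (ler_wpM2l (ler0n _ _) (fact_lower l)) _.
rewrite mulrA -natrM bin_ffact mulrC -[expR l%:R](congr1 expR (mulr1 _)) expRM_natl ler_wpM2l ?exprn_ge0 ?expR_ge0 //.
by rewrite -natrX ler_nat; elim: l {l0 l0'} => // l IH; rewrite ffactnSr expnSr leq_mul // leq_subr.
Qed.

End ElementaryBounds.

(** * Bounds on one term of the second moment, by overlap size *)

Section Terms.
Variables (R : realType) (n k : nat) (p eps delta h M : R).
Hypotheses (p0 : 0 < p) (peps : p < 1 - eps) (eps01 : 0 < eps < 1) (delta01 : 0 < delta < 1).
Hypotheses (h01 : 0 < h <= 1) (M0 : 0 < M) (n0 : (0 < n)%N) (k0 : (0 < k)%N).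

Let Q := - ln (1 - p).
Let r := p / (1 - p).
Let a := Q * k%:R / 2.
Let theta := h^-1.

(* By hk, a is at most ln (n p) + O(1): k stays below the threshold
   2 log_q (e n p (1 - delta)) + 3. *)
Hypothesis hk : Q * (k%:R - 3) / 2 <= 1 + ln (n%:R * p) + ln (1 - delta).
Hypothesis hM : n%:R / M <= expR h.

Lemma oneBp_gt0 : 0 < 1 - p. Proof. by have := peps; case/andP: eps01 => ? ? ?; lra. Qed.

Lemma expRQ : expR Q = (1 - p)^-1.
Proof. by rewrite expRN lnK // posrE oneBp_gt0. Qed.

Lemma p_le_Q : p <= Q.
Proof.
have H : ln (1 - p) <= - p by apply: le_ln1Dx; have := oneBp_gt0; lra.
by rewrite /Q; lra.
Qed.

Lemma Q_le_r : Q <= r.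
Proof.
have q0 := oneBp_gt0.
have -> : Q = ln (1 - p)^-1 by rewrite lnV // posrE.
have -> : (1 - p)^-1 = 1 + r by rewrite /r; field; rewrite gt_eqF.
by apply: le_ln1Dx; apply: lt_trans (_ : 0 < _); [lra | rewrite divr_gt0].
Qed.

Lemma r_le_Q : r <= Q / eps.
Proof.
have q0 := oneBp_gt0; case/andP: eps01 => e0 _.
rewrite /r ler_pdivlMr // mulrAC ler_pdivrMr //.
apply: ler_pM; [exact: ltW | case/andP: eps01; lra | exact: p_le_Q | move: peps; lra].
Qed.

Lemma a_gt0 : 0 < a.
Proof. by rewrite divr_gt0 // mulr_gt0 ?ltr0n //; apply: lt_le_trans p0 p_le_Q. Qed.

Lemma rk_le : r * k%:R <= 2 * a / eps.
Proof.
have -> : 2 * a / eps = (Q / eps) * k%:R by case/andP: eps01 => e0 _; rewrite /a; field; rewrite gt_eqF.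
by rewrite ler_wpM2r // r_le_Q.
Qed.

(* The contribution to E[X^2] / E[X]^2 of the pairs whose supports share l
   vertices, for X the number of pairs (S, f) with S a k-set. *)
Definition term (l : nat) : R :=
  'C(k, l)%:R * (k ^_ l)%:R / M ^+ l *
  (k%:R ^+ 2 * ((1 + theta^-1) * (l.-1%:R / r + theta * (k - l).+1%:R ^+ 2) / k%:R ^+ 2) ^+ l
     * (1 - p)^-1 ^+ 'C(l, 2)).

(** What remains of the l-th root of [term l] besides binomials and polynomial factors. The factors
    [expR h] come from [n / M] and from [1 + theta^-1 = 1 + h]; [1 - delta] is the slack below the
    threshold. *)
Let X (l : nat) : R := expR h * expR h * (1 - delta) *
  (l%:R * l.-1%:R + theta * r * l%:R * (k - l).+1%:R ^+ 2) / k%:R ^+ 2 * expR (- (Q * (k%:R - l%:R) / 2)).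

Lemma term_le l : (0 < l <= k)%N -> term l <= expR 1 * k%:R ^+ 3 * ('C(k, l)%:R ^+ 2 * X l ^+ l).
Proof.
case/andP=> l0 lk; have q0 := oneBp_gt0; have h0 : 0 < h by case/andP: h01.
have k0' : 0 < k%:R :> R by rewrite ltr0n.
have l0' : 0 < l%:R :> R by rewrite ltr0n.
have r0 : 0 < r by rewrite divr_gt0.
have th0 : 0 < theta by rewrite invr_gt0.
set B := (1 + theta^-1) * (l.-1%:R / r + theta * (k - l).+1%:R ^+ 2) / k%:R ^+ 2.
have B0 : 0 <= B.
  by rewrite divr_ge0 ?sqr_ge0 // mulr_ge0 ?addr_ge0 ?invr_ge0 ?divr_ge0 ?mulr_ge0 ?sqr_ge0 // ltW.
have qC : (1 - p)^-1 ^+ 'C(l, 2) = expR (Q * (l%:R - 1) / 2) ^+ l.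
  by rewrite -expRQ -!expRM_natl natr_bin2; congr expR; field.
have -> : term l = k%:R ^+ 2 * 'C(k, l)%:R * (k ^_ l)%:R * (B / M * expR (Q * (l%:R - 1) / 2)) ^+ l.
  by rewrite /term -/B qC [(B / M * _) ^+ l]exprMn [(B / M) ^+ l]exprMn exprVn; ring.
have -> : (k ^_ l)%:R = 'C(k, l)%:R * l`!%:R :> R by rewrite -natrM bin_ffact.
have fl : l`!%:R <= expR 1 * k%:R * (l%:R / expR 1) ^+ l :> R.
  rewrite expr_div_n -expRM_natl mulr1 mulrA ler_pdivlMr ?expR_gt0 //.
  apply: le_trans (fact_upper R l0) _; rewrite ler_wpM2r ?exprn_ge0 //.
  by rewrite ler_wpM2l ?expR_ge0 // ler_nat.
have Y0 : 0 <= B / M * expR (Q * (l%:R - 1) / 2) by rewrite mulr_ge0 ?expR_ge0 // divr_ge0 // ltW.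
have YX : l%:R / expR 1 * (B / M * expR (Q * (l%:R - 1) / 2)) <= X l.
  (* As (l-1)/2 = (k-3)/2 + 1 - (k-l)/2, the 3 in [hk] leaves exactly one factor 1/(1-p), which
     turns the p of np into r and cancels the 1/r in [B]. *)
  have E : expR (Q * (l%:R - 1) / 2) <=
      (1 - p)^-1 * (expR 1 * (n%:R * p) * (1 - delta)) * expR (- (Q * (k%:R - l%:R) / 2)).
    have D0 : n%:R * p \is Num.pos by rewrite posrE mulr_gt0 // ltr0n.
    have d1 : 1 - delta \is Num.pos by rewrite posrE; case/andP: delta01; lra.
    rewrite -(lnK D0) -(lnK d1) -expRQ -!expRD ler_expR.
    by move: hk; lra.
  apply: le_trans (ler_wpM2l _ (ler_wpM2l _ E)) _.
  - by rewrite divr_ge0 ?expR_ge0 // ltW.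
  - by rewrite divr_ge0 // ltW.
  have -> : l%:R / expR 1 * (B / M * ((1 - p)^-1 * (expR 1 * (n%:R * p) * (1 - delta)) *
      expR (- (Q * (k%:R - l%:R) / 2)))) =
    (n%:R / M) * (1 + theta^-1) * (1 - delta) *
      (l%:R * l.-1%:R + theta * r * l%:R * (k - l).+1%:R ^+ 2) / k%:R ^+ 2 * expR (- (Q * (k%:R - l%:R) / 2)).
    have e1 : expR 1 != 0 :> R by rewrite gt_eqF ?expR_gt0.
    have q1 : 1 - p != 0 by rewrite gt_eqF.
    have p1 : p != 0 by rewrite gt_eqF.
    have M1 : M != 0 by rewrite gt_eqF.
    have k1 : k%:R != 0 :> R by rewrite gt_eqF.
    have t1 : theta != 0 by rewrite gt_eqF.
    rewrite /B /r; move: (expR _) (expR 1) e1 theta t1 => x y e1 t t1.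
    by field; rewrite e1 q1 p1 M1 k1 t1.
  rewrite /X ler_wpM2r ?expR_ge0 // ler_wpM2r ?invr_ge0 ?sqr_ge0 // ler_wpM2r //.
    by rewrite addr_ge0 ?mulr_ge0 ?invr_ge0 ?(ltW th0) ?(ltW p0) ?(ltW q0) ?(ltW h0) //.
  rewrite ler_wpM2r //; first by case/andP: delta01; lra.
  apply: ler_pM; rewrite ?divr_ge0 ?addr_ge0 ?invr_ge0 ?(ltW th0) ?(ltW M0) ?(ltW h0) //.
  by rewrite /theta invrK expR_ge1Dx.
apply: le_trans (_ : k%:R ^+ 2 * 'C(k, l)%:R * ('C(k, l)%:R * (expR 1 * k%:R * (l%:R / expR 1) ^+ l)) *
  (B / M * expR (Q * (l%:R - 1) / 2)) ^+ l <= _).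
  by rewrite ler_wpM2r ?exprn_ge0 // ler_wpM2l ?mulr_ge0 ?sqr_ge0 // ler_wpM2l.
have -> : k%:R ^+ 2 * 'C(k, l)%:R * ('C(k, l)%:R * (expR 1 * k%:R * (l%:R / expR 1) ^+ l)) *
  (B / M * expR (Q * (l%:R - 1) / 2)) ^+ l = expR 1 * k%:R ^+ 3 * ('C(k, l)%:R ^+ 2 *
   (l%:R / expR 1 * (B / M * expR (Q * (l%:R - 1) / 2))) ^+ l).
  by rewrite [X in _ = _ * (_ * X)]exprMn; ring.
rewrite ler_wpM2l ?mulr_ge0 ?expR_ge0 ?exprn_ge0 // ler_wpM2l ?sqr_ge0 //.
by apply: lerXn2r => //; rewrite nnegrE ?(le_trans _ YX) // mulr_ge0 // divr_ge0 ?expR_ge0 // ltW.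
Qed.


Let u (l : nat) : R := (k%:R - l%:R) / k%:R.

Lemma X_ge0 l : 0 <= X l.
Proof.
have q0 := oneBp_gt0; have h0 : 0 <= h by case/andP: h01 => /ltW.
have d0 : 0 <= 1 - delta by case/andP: delta01; lra.
rewrite /X mulr_ge0 ?expR_ge0 // divr_ge0 ?sqr_ge0 // mulr_ge0 //; first by rewrite !mulr_ge0 ?expR_ge0.
by rewrite addr_ge0 ?mulr_ge0 ?invr_ge0 ?(ltW p0) ?(ltW q0).
Qed.

Lemma XE l : X l = expR (2 * h) * (1 - delta) *
  ((l%:R * l.-1%:R + theta * r * l%:R * (k - l).+1%:R ^+ 2) / k%:R ^+ 2) * expR (- (a * u l)).
Proof.
have k1 : k%:R != 0 :> R by rewrite pnatr_eq0 -lt0n.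
have E2 : expR h * expR h = expR (2 * h) by rewrite -expRD; congr expR; ring.
rewrite /X E2; congr (_ * expR _); first by rewrite -!mulrA.
by rewrite /a /u; field.
Qed.

Lemma theta_rk : theta * r * k%:R <= 2 * a / (h * eps).
Proof.
have h0 : 0 < h by case/andP: h01.
have e0 : 0 < eps by case/andP: eps01.
have -> : 2 * a / (h * eps) = theta * (2 * a / eps).
  by rewrite /theta; field; rewrite !gt_eqF.
by rewrite -mulrA ler_wpM2l ?invr_ge0 ?rk_le // ltW.
Qed.

(* Here C(k, l) = C(k, k - l) is at most lam^(k-l) (1 + 1/lam)^k with lam = 4/h,
   and the factor q^(-(k-l)/2) inside X absorbs the power of lam. *)
Lemma upper_range l : (0 < l <= k)%N -> (k <= 2 * l)%N ->
  64 / (eps * h ^+ 2) <= a -> 8 * ln (4 / h) <= a -> Q <= k%:R * (eps * h ^+ 2 / 4) ->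
  'C(k, l)%:R ^+ 2 * X l ^+ l <= (expR (4 * h) * (1 - delta)) ^+ l.
Proof.
case/andP=> l0 lk k2l ha ha2 hQ; have a0 := a_gt0; have [/andP[h0 h1] /andP[e0 e1]] := (h01, eps01).
have k0' : 0 < k%:R :> R by rewrite ltr0n.
have kn : k%:R != 0 :> R by rewrite gt_eqF.
have l0' : 0 < l%:R :> R by rewrite ltr0n.
have lk' : l%:R <= k%:R :> R by rewrite ler_nat.
have u0 : 0 <= u l by rewrite divr_ge0 // subr_ge0.
have lam0 : 0 < 4 / h by rewrite divr_gt0.
set g := ln (4 / h) in ha2.
have g0 : 0 <= g.
  by apply: ln_ge0; rewrite ler_pdivlMr // mul1r; apply: le_trans h1 _; lra.
have uk : k%:R - l%:R = u l * k%:R by rewrite /u divfK.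
have C1 : 'C(k, l)%:R <= expR (g * (k%:R - l%:R) + k%:R * (h / 4)).
  apply: le_trans (bin_le_exp k l lam0) _; rewrite expRD; apply: ler_pM.
  - by rewrite exprn_ge0 // ltW.
  - by rewrite exprn_ge0 // addr_ge0 // invr_ge0 ltW.
  - by rewrite -natrB // expRM_natr /g lnK // posrE.
  rewrite expRM_natl lerXn2r ?nnegrE ?expR_ge0 ?addr_ge0 ?invr_ge0 ?(ltW lam0) //.
  by rewrite invf_div expR_ge1Dx.
have k2l' : k%:R <= 2 * l%:R :> R by rewrite -natrM ler_nat.
have C2 : 'C(k, l)%:R ^+ 2 <= expR (4 * u l * g + h) ^+ l.
  apply: le_trans (_ : expR (g * (k%:R - l%:R) + k%:R * (h / 4)) ^+ 2 <= _).
    by rewrite lerXn2r ?nnegrE ?expR_ge0.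
  rewrite -!expRM_natl ler_expR uk.
  have H1 : u l * g * k%:R <= u l * g * (2 * l%:R) by rewrite ler_wpM2l // mulr_ge0.
  have H2 : h * k%:R <= h * (2 * l%:R) by rewrite ler_wpM2l // ltW.
  by lra.
apply: le_trans (ler_wpM2r (exprn_ge0 _ (X_ge0 l)) C2) _; rewrite -exprMn.
have d0 : 0 <= 1 - delta by case/andP: delta01; lra.
apply: lerXn2r; rewrite ?nnegrE;
  [exact: mulr_ge0 (expR_ge0 _) (X_ge0 l) | exact: mulr_ge0 (expR_ge0 _) d0 |].
set W := 2 * a / (h * eps).
have W0 : 0 <= W by apply: divr_ge0; apply: mulr_ge0 => //; apply: ltW.
have B1 : (l%:R * l.-1%:R + theta * r * l%:R * (k - l).+1%:R ^+ 2) / k%:R ^+ 2 <=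
    1 + W * (2 * u l ^+ 2 + 2 / k%:R ^+ 2).
  have E : (k - l).+1%:R = k%:R * (u l + k%:R^-1).
    by rewrite -natr1 natrB // mulrDr mulfV // mulrC -uk.
  have r0 : 0 < r by rewrite divr_gt0 // oneBp_gt0.
  rewrite E mulrDl; apply: lerD.
    by rewrite ler_pdivrMr ?exprn_gt0 // mul1r expr2 -!natrM ler_nat leq_mul // (leq_trans (leq_pred l)).
  rewrite exprMn mulrA mulrAC mulfK ?expf_neq0 //.
  apply: le_trans (_ : W * (u l + k%:R^-1) ^+ 2 <= _).
    rewrite ler_wpM2r ?sqr_ge0 //; apply: le_trans theta_rk.
    by rewrite ler_wpM2l // mulr_ge0 ?invr_ge0 // ltW.
  rewrite ler_wpM2l // -subr_ge0 (_ : _ - _ = (u l - k%:R^-1) ^+ 2) ?sqr_ge0 //.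
  by field.
(* Half of the decay exp(-au) pays for the binomials, by [ha2]; the other half, [E], pays for the
   term with [W]. *)
set E := expR (- (a * u l) / 2).
have E1 : E <= 1 by rewrite expR_le1; have := mulr_ge0 (ltW a0) u0; lra.
have E0 : 0 <= E := expR_ge0 _.
have E2 : a ^+ 2 * u l ^+ 2 * E <= 8.
  have z0 : 0 <= a * u l / 2 by rewrite divr_ge0 // mulr_ge0 // ltW.
  have := @expR_ge1Dxn R _ 1 z0; rewrite !factS fact0 !muln1 => H.
  have EE : E * expR (a * u l / 2) = 1 by rewrite -expRD -(expR0 R); congr expR; field.
  have := ler_wpM2l E0 H; rewrite EE; lra.
have E3 : expR (4 * u l * g) * expR (- (a * u l)) <= E.
  rewrite -expRD ler_expR; have := ler_wpM2l u0 ha2; lra.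
(* The two errors take h/2 each, which is the origin of 64 in [ha] and of 4 in [hQ]. Altogether
   exp(h) is spent here, exp(h) on the binomials and exp(2h) in [X], hence exp(4h). *)
have F1 : 2 * W * (u l ^+ 2 * E) <= h / 2.
  have -> : 2 * W * (u l ^+ 2 * E) = 4 / (h * eps * a) * (a ^+ 2 * u l ^+ 2 * E).
    by rewrite /W; field; rewrite !gt_eqF.
  apply: le_trans (ler_wpM2l _ E2) _; first by apply: divr_ge0 => //; apply: mulr_ge0 (ltW a0); apply: mulr_ge0; apply: ltW.
  move: ha; rewrite ler_pdivrMr ?mulr_gt0 ?exprn_gt0 // => ha.
  have hp : 0 < h * eps * a by apply: mulr_gt0 a0; apply: mulr_gt0.
  by rewrite mulrAC ler_pdivrMr //; lra.
have F2 : 2 * W / k%:R ^+ 2 <= h / 2.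
  have -> : 2 * W / k%:R ^+ 2 = 2 * Q / (h * eps * k%:R).
    by rewrite /W /a; field; rewrite ?gt_eqF // kn.
  rewrite ler_pdivrMr ?mulr_gt0 //; lra.
have G : expR (4 * u l * g) * expR (- (a * u l)) *
   ((l%:R * l.-1%:R + theta * r * l%:R * (k - l).+1%:R ^+ 2) / k%:R ^+ 2) <= expR h.
  apply: le_trans (_ : E * (1 + W * (2 * u l ^+ 2 + 2 / k%:R ^+ 2)) <= _).
    apply: ler_pM E3 B1; first by apply: mulr_ge0; apply: expR_ge0.
    have r0 : 0 < r by rewrite divr_gt0 // oneBp_gt0.
    by rewrite divr_ge0 ?sqr_ge0 // addr_ge0 ?mulr_ge0 ?invr_ge0 ?sqr_ge0 ?(ltW h0) ?(ltW p0) ?(ltW oneBp_gt0).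
  apply: le_trans (expR_ge1Dx h).
  have T : 0 <= 2 * W / k%:R ^+ 2 by rewrite divr_ge0 ?sqr_ge0 // mulr_ge0.
  have := ler_wpM2r T E1; lra.
rewrite XE expRD.
have -> : expR (4 * h) = expR (2 * h) * expR h * expR h by rewrite -!expRD; congr expR; ring.
set B := (_ / k%:R ^+ 2) in G *.
have -> : expR (4 * u l * g) * expR h * (expR (2 * h) * (1 - delta) * B * expR (- (a * u l))) =
  expR (2 * h) * expR h * (1 - delta) * (expR (4 * u l * g) * expR (- (a * u l)) * B) by ring.
have -> : expR (2 * h) * expR h * expR h * (1 - delta) = expR (2 * h) * expR h * (1 - delta) * expR h by ring.
by rewrite ler_wpM2l // mulr_ge0 // mulr_ge0 ?expR_ge0.
Qed.

(** exp(2) comes from [bin_upper] squared, exp(2h) from [X], and the last factor from absorbing 1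
    into a multiple of a(k/l), both being at least 1. *)
Definition low_const : R := expR (2 + 2 * h) * (1 + 2 / (h * eps)).

Lemma low_range l : (0 < l <= k)%N -> 1 <= a ->
  'C(k, l)%:R ^+ 2 * X l ^+ l <= (low_const * a * (k%:R / l%:R) * expR (- a + a * l%:R / k%:R)) ^+ l.
Proof.
case/andP=> l0 lk a1; have [/andP[h0 h1] /andP[e0 e1]] := (h01, eps01).
have k0' : 0 < k%:R :> R by rewrite ltr0n.
have kn : k%:R != 0 :> R by rewrite gt_eqF.
have l0' : 0 < l%:R :> R by rewrite ltr0n.
have ln0 : l%:R != 0 :> R by rewrite gt_eqF.
have lk' : l%:R <= k%:R :> R by rewrite ler_nat.
have d0 : 0 <= 1 - delta by case/andP: delta01; lra.
apply: le_trans (_ : ((expR 1 * k%:R / l%:R) ^+ 2 * X l) ^+ l <= _).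
  rewrite [leRHS]exprMn ler_wpM2r ?exprn_ge0 ?X_ge0 // exprAC lerXn2r ?nnegrE ?exprn_ge0 ?bin_upper //.
have y0 : 0 <= expR (- a + a * l%:R / k%:R) := expR_ge0 _.
have a0 : 0 <= a := ltW a_gt0.
have W0 : 0 <= 2 * a / (h * eps) by apply: divr_ge0; apply: mulr_ge0 => //; apply: ltW.
have low0 : 0 <= low_const by rewrite mulr_ge0 ?expR_ge0 // addr_ge0 // divr_ge0 // mulr_ge0 // ltW.
apply: lerXn2r; rewrite ?nnegrE.
- by rewrite mulr_ge0 ?sqr_ge0 ?X_ge0.
- by rewrite mulr_ge0 // mulr_ge0 ?divr_ge0 // mulr_ge0.
rewrite XE (_ : - (a * u l) = - a + a * l%:R / k%:R); last by rewrite /u; field.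
rewrite mulrA ler_wpM2r //.
set B := l%:R * l.-1%:R + _.
have -> : (expR 1 * k%:R / l%:R) ^+ 2 * (expR (2 * h) * (1 - delta) * (B / k%:R ^+ 2)) =
    expR 1 ^+ 2 * expR (2 * h) * (1 - delta) * (B / l%:R ^+ 2).
  by move: (expR 1) => x; field; rewrite kn ln0.
have -> : low_const = expR 1 ^+ 2 * expR (2 * h) * (1 + 2 / (h * eps)).
  by rewrite /low_const -expRM_natl mulr1 -expRD.
set c := expR 1 ^+ 2 * expR (2 * h); have c0 : 0 <= c by rewrite mulr_ge0 ?expR_ge0 ?exprn_ge0 ?expR_ge0.
have -> : c * (1 - delta) * (B / l%:R ^+ 2) = c * ((1 - delta) * (B / l%:R ^+ 2)) by ring.
have -> : c * (1 + 2 / (h * eps)) * a * (k%:R / l%:R) = c * ((1 + 2 / (h * eps)) * a * (k%:R / l%:R)) by rewrite !mulrA.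
apply: ler_wpM2l => //.
have B0 : 0 <= B / l%:R ^+ 2.
  have r0 : 0 < r by rewrite divr_gt0 // oneBp_gt0.
  by rewrite divr_ge0 ?sqr_ge0 // addr_ge0 ?mulr_ge0 ?invr_ge0 ?sqr_ge0 ?(ltW h0) ?(ltW p0) ?(ltW oneBp_gt0).
apply: le_trans (_ : B / l%:R ^+ 2 <= _).
  by apply: ler_piMl => //; case/andP: delta01; lra.
apply: le_trans (_ : 1 + 2 * a / (h * eps) * (k%:R / l%:R) <= _).
  rewrite mulrDl; apply: lerD.
    by rewrite ler_pdivrMr ?exprn_gt0 // mul1r expr2 -!natrM ler_nat leq_mul // leq_pred.
  have -> : theta * r * l%:R * (k - l).+1%:R ^+ 2 / l%:R ^+ 2 = theta * r * ((k - l).+1%:R ^+ 2 / l%:R).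
    by field; rewrite ?ln0.
  apply: le_trans (_ : theta * r * (k%:R ^+ 2 / l%:R) <= _).
    have r0 : 0 < r by rewrite divr_gt0 // oneBp_gt0.
    rewrite ler_wpM2l ?mulr_ge0 ?invr_ge0 ?(ltW h0) ?(ltW p0) ?(ltW oneBp_gt0) //.
    by rewrite ler_wpM2r ?invr_ge0 // lerXn2r ?nnegrE // ler_nat -subSn // leq_subLR addnC -addn1 leq_add2l.
  have -> : theta * r * (k%:R ^+ 2 / l%:R) = theta * r * k%:R * (k%:R / l%:R) by rewrite expr2 !mulrA.
  by rewrite ler_wpM2r ?divr_ge0 // theta_rk.
have kl1 : 1 <= k%:R / l%:R :> R by rewrite ler_pdivlMr // mul1r.
have akl : 1 <= a * (k%:R / l%:R) by apply: le_trans a1 _; apply: ler_peMr.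
rewrite -subr_ge0 (_ : _ - _ = a * (k%:R / l%:R) - 1); first by rewrite subr_ge0.
by field; rewrite ln0 !gt_eqF.
Qed.

(** For overlaps up to k/a the exponent -a + al/k is within 1 of its value at l = 0, and the bound
    has the Poisson-like shape (mu/l)^l. *)
Lemma low_range_small l : (0 < l <= k)%N -> 1 <= a -> a * l%:R <= k%:R ->
  'C(k, l)%:R ^+ 2 * X l ^+ l <= (low_const * a * expR (1 - a) * k%:R / l%:R) ^+ l.
Proof.
move=> lk a1 al; apply: le_trans (low_range lk a1) _; have /andP[l0 _] := lk.
have k0' : 0 < k%:R :> R by rewrite ltr0n.
have l0' : 0 < l%:R :> R by rewrite ltr0n.
have [/andP[h0 h1] /andP[e0 e1]] := (h01, eps01).
have low0 : 0 <= low_const by rewrite mulr_ge0 ?expR_ge0 // addr_ge0 // divr_ge0 // mulr_ge0 // ltW.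
have a0 : 0 <= a := ltW a_gt0.
have la0 : 0 <= low_const * a by rewrite mulr_ge0.
have -> : low_const * a * expR (1 - a) * k%:R / l%:R = low_const * a * (k%:R / l%:R) * expR (1 - a).
  by rewrite [RHS]mulrAC !mulrA.
have kl0 : 0 <= k%:R / l%:R :> R by rewrite divr_ge0.
apply: lerXn2r; rewrite ?nnegrE; try exact: mulr_ge0 (mulr_ge0 la0 kl0) (expR_ge0 _).
apply: ler_wpM2l; first exact: mulr_ge0.
rewrite ler_expR.
have : a * l%:R / k%:R <= 1 by rewrite ler_pdivrMr // mul1r.
lra.
Qed.

(** Between k/a and k/2 one has k/l <= a, and half of the decay exp(-a) survives. *)
Lemma low_range_middle l : (0 < l <= k)%N -> 1 <= a -> k%:R <= a * l%:R -> (2 * l <= k)%N ->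
  'C(k, l)%:R ^+ 2 * X l ^+ l <= (low_const * a ^+ 2 * expR (- a / 2)) ^+ l.
Proof.
move=> lk a1 al l2; apply: le_trans (low_range lk a1) _; have /andP[l0 _] := lk.
have k0' : 0 < k%:R :> R by rewrite ltr0n.
have l0' : 0 < l%:R :> R by rewrite ltr0n.
have [/andP[h0 h1] /andP[e0 e1]] := (h01, eps01).
have low0 : 0 <= low_const by rewrite mulr_ge0 ?expR_ge0 // addr_ge0 // divr_ge0 // mulr_ge0 // ltW.
have a0 : 0 <= a := ltW a_gt0.
have la0 : 0 <= low_const * a by rewrite mulr_ge0.
have kl0 : 0 <= k%:R / l%:R :> R by rewrite divr_ge0.
have -> : low_const * a ^+ 2 = low_const * a * a by rewrite expr2 mulrA.
apply: lerXn2r; rewrite ?nnegrE.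
- exact: mulr_ge0 (mulr_ge0 la0 kl0) (expR_ge0 _).
- exact: mulr_ge0 (mulr_ge0 la0 a0) (expR_ge0 _).
apply: ler_pM (expR_ge0 _) _ _; first exact: mulr_ge0.
  by apply: ler_wpM2l => //; rewrite ler_pdivrMr.
rewrite ler_expR; have l2' : 2 * l%:R <= k%:R :> R by rewrite -natrM ler_nat.
have : a * l%:R / k%:R <= a / 2.
  rewrite ler_pdivrMr //; have := ler_wpM2l a0 l2'; lra.
lra.
Qed.

Lemma term_le_chain l y : (0 < l <= k)%N -> 'C(k, l)%:R ^+ 2 * X l ^+ l <= y ->
  term l <= expR 1 * k%:R ^+ 3 * y.
Proof.
move=> lk Hy; apply: le_trans (term_le lk) _.
by apply: ler_wpM2l => //; rewrite mulr_ge0 ?expR_ge0 // exprn_ge0.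
Qed.

Lemma term_upper_range l : (0 < l <= k)%N -> (k <= 2 * l)%N ->
  64 / (eps * h ^+ 2) <= a -> 8 * ln (4 / h) <= a -> Q <= k%:R * (eps * h ^+ 2 / 4) ->
  term l <= expR 1 * k%:R ^+ 3 * (expR (4 * h) * (1 - delta)) ^+ l.
Proof. by move=> lk ? ? ? ?; apply: term_le_chain (upper_range _ _ _ _ _). Qed.

Lemma term_small l : (0 < l <= k)%N -> 1 <= a -> a * l%:R <= k%:R ->
  term l <= expR 1 * k%:R ^+ 3 * (low_const * a * expR (1 - a) * k%:R / l%:R) ^+ l.
Proof. by move=> lk ? ?; apply: term_le_chain (low_range_small _ _ _). Qed.

Lemma term_middle l : (0 < l <= k)%N -> 1 <= a -> k%:R <= a * l%:R -> (2 * l <= k)%N ->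
  term l <= expR 1 * k%:R ^+ 3 * (low_const * a ^+ 2 * expR (- a / 2)) ^+ l.
Proof. by move=> lk ? ? ?; apply: term_le_chain (low_range_middle _ _ _ _). Qed.

End Terms.

(** * Summation over the overlap size *)

Section Sums.
Variables (R : realType) (n k : nat) (p eps delta h M Q a : R).
Hypotheses (QE : Q = - ln (1 - p)) (aE : a = Q * k%:R / 2).
Hypotheses (p0 : 0 < p) (peps : p < 1 - eps) (eps01 : 0 < eps < 1) (delta01 : 0 < delta < 1).
Hypotheses (h01 : 0 < h <= 1) (M0 : 0 < M) (n0 : (0 < n)%N) (k0 : (0 < k)%N).
Hypothesis hk : Q * (k%:R - 3) / 2 <= 1 + ln (n%:R * p) + ln (1 - delta).
Hypothesis hM : n%:R / M <= expR h.
Hypotheses (a1 : 1 <= a) (ha : 64 / (eps * h ^+ 2) <= a) (ha2 : 8 * ln (4 / h) <= a).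
Hypothesis hQ : Q <= k%:R * (eps * h ^+ 2 / 4).

(** By [mu_upper] this is at most a constant times a^2 n/(np)^2, the order of the mean overlap k^2/n
    of two random k-sets. *)
Let mu := low_const eps h * a * expR (1 - a) * k%:R.
Let nu := low_const eps h * a ^+ 2 * expR (- a / 2).
Let rho := expR (4 * h) * (1 - delta).

Lemma low_const_gt0 : 0 < low_const eps h.
Proof.
have [/andP[h0 _] /andP[e0 _]] := (h01, eps01).
by rewrite mulr_gt0 ?expR_gt0 // addr_gt0 // divr_gt0 // mulr_gt0.
Qed.

Lemma mu_ge0 : 0 <= mu.
Proof.
have a0 : 0 <= a := le_trans ler01 a1.
by apply: mulr_ge0 => //; apply: mulr_ge0 (expR_ge0 _); apply: mulr_ge0 => //; apply: ltW low_const_gt0.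
Qed.

Lemma nu_ge0 : 0 <= nu.
Proof. by apply: mulr_ge0 (expR_ge0 _); apply: mulr_ge0 (sqr_ge0 _); apply: ltW low_const_gt0. Qed.

Lemma rho_ge0 : 0 <= rho.
Proof. by apply: mulr_ge0 (expR_ge0 _) _; case/andP: delta01; lra. Qed.

Lemma term_trichotomy l : (0 < l <= k)%N ->
  [\/ term k p h M l <= expR 1 * k%:R ^+ 3 * (mu / l%:R) ^+ l,
      term k p h M l <= expR 1 * k%:R ^+ 3 * nu ^+ l |
      (k <= 2 * l)%N /\ term k p h M l <= expR 1 * k%:R ^+ 3 * rho ^+ l].
Proof.
move=> lk; have [k2l|l2k] := leqP k (2 * l).
  apply: Or33; split=> //.
  by apply: (term_upper_range (n := n) (eps := eps) (delta := delta)); rewrite -?QE -?aE.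
have [ak|ka] := leP (a * l%:R) k%:R.
  by apply: Or31; rewrite /mu aE QE; apply: (term_small (n := n) (delta := delta)); rewrite -?QE -?aE.
apply: Or32; rewrite /nu aE QE.
by apply: (term_middle (n := n) (delta := delta)); rewrite -?QE -?aE ?(ltW ka) // ltnW.
Qed.

Lemma term0 : term k p h M 0 = k%:R ^+ 2.
Proof. by rewrite /term bin0 ffactn0 !expr0 divr1 !mulr1 mul1r. Qed.

(** Since mu/l <= exp(mu/l), each (mu/l)^l is at most exp(mu), so every term obeys the same crude
    bound. *)
Lemma sparse_sum : nu <= 1 -> rho <= 1 ->
  \sum_(l < k.+1) term k p h M l <= k.+1%:R * (expR 1 * k%:R ^+ 3 * expR mu).
Proof.
move=> nu1 rho1; rewrite mulr_natl -[X in _ *+ X]card_ord -sumr_const; apply: ler_sum => l _.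
have k1 : 1 <= k%:R :> R by rewrite ler1n.
have emu : 1 <= expR mu by rewrite -[1](expR0 R) ler_expR mu_ge0.
have e1 : 1 <= expR 1 :> R by rewrite -[leLHS](expR0 R) ler_expR.
have c0 : 0 <= expR 1 * k%:R ^+ 3 :> R by rewrite mulr_ge0 ?expR_ge0 // exprn_ge0.
have c1 y : y <= expR mu -> expR 1 * k%:R ^+ 3 * y <= expR 1 * k%:R ^+ 3 * expR mu by move=> H; apply: ler_wpM2l.
have [l0|l0] := posnP l.
  rewrite l0 term0; apply: le_trans (c1 _ emu).
  by rewrite mulr1 exprS mulrA; apply: ler_peMl; [apply: sqr_ge0 | apply: mulr_ege1].
have lk : (0 < l <= k)%N by rewrite l0 -ltnS ltn_ord.
case: (term_trichotomy lk) => [|H|[_ H]].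
- move/le_trans; apply; apply: c1; have l0' : 0 < l%:R :> R by rewrite ltr0n.
  have -> : mu = l%:R * (mu / l%:R) by rewrite mulrC divfK // gt_eqF.
  rewrite expRM_natl [X in (X / _) ^+ _]mulrC [X in (X / _) ^+ _]divfK ?gt_eqF //.
  have m0 : 0 <= mu / l%:R by rewrite divr_ge0 ?mu_ge0.
  by apply: lerXn2r; rewrite ?nnegrE ?expR_ge0 //; apply: le_trans (expR_ge1Dx _); lra.
- apply: le_trans H (c1 _ _); apply: le_trans emu; apply: exprn_ile1 => //; exact: nu_ge0.
apply: le_trans H (c1 _ _); apply: le_trans emu; apply: exprn_ile1 => //; exact: rho_ge0.
Qed.

(* The first branch is the bound of [agreement_bound_trees], which unlike the
   general one has no polynomial factor and equals 1 at l = 0. *)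
Definition mixed_bound (l0 l : nat) : R :=
  if (l < l0)%N then 2 ^+ l * (1 - p)^-1 ^+ 'C(l, 2) else
  k%:R ^+ 2 * ((1 + h^-1^-1) * (l.-1%:R / (p / (1 - p)) + h^-1 * (k - l).+1%:R ^+ 2) / k%:R ^+ 2) ^+ l
     * (1 - p)^-1 ^+ 'C(l, 2).

Lemma few_small_indices (m l0 : nat) : \sum_(l < m) (l < l0)%N%:R <= l0%:R :> R.
Proof.
elim: m => [|m IH]; first by rewrite big_ord0.
rewrite big_ord_recr /=; have [ml|_] := ltnP m l0; last by rewrite addr0.
apply: le_trans (_ : m.+1%:R <= _); last by rewrite ler_nat.
rewrite -natr1 lerD2r; apply: le_trans (_ : \sum_(l < m) 1 <= _).
  by apply: ler_sum => l _; case: (_ < _)%N.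
by rewrite sumr_const card_ord.
Qed.

(** l = 0 contributes exactly 1. For 0 < l < l0 the l-th power of z = 2k^2/M is at most z, and the
    power of 1/(1-p) is bounded in terms of [eps] and [l0]. For larger l the power [nu' ^+ l0], or
    exp(-gl) with l >= k/2, has to beat the polynomial factors. *)
Lemma dense_sum (l0 : nat) (nu' g : R) : (0 < l0)%N -> mu <= nu' -> nu <= nu' -> nu' <= 1 ->
  0 <= g -> rho <= expR (- g) -> 2 * k%:R ^+ 2 / M <= 1 ->
  \sum_(l < k.+1) 'C(k, l)%:R * (k ^_ l)%:R / M ^+ l * mixed_bound l0 l <=
    1 + l0%:R * (2 * k%:R ^+ 2 / M * eps^-1 ^+ (l0 ^ 2)) +
    k.+1%:R * (expR 1 * k%:R ^+ 3 * (nu' ^+ l0 + expR (- g * k%:R / 2))).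
Proof.
move=> l00 mu' nnu nu1 g0 rhog k2M.
set z := 2 * k%:R ^+ 2 / M; set Z := expR 1 * _ * _.
have [/andP[h0 _] /andP[e0 e1]] := (h01, eps01).
have z0 : 0 <= z by rewrite divr_ge0 ?(ltW M0) // mulr_ge0 ?sqr_ge0.
have ze0 : 0 <= z * eps^-1 ^+ (l0 ^ 2) by rewrite mulr_ge0 // exprn_ge0 // invr_ge0 ltW.
have nu'0 : 0 <= nu' := le_trans nu_ge0 nnu.
have Z0 : 0 <= Z by rewrite mulr_ge0 ?addr_ge0 ?expR_ge0 ?exprn_ge0 // mulr_ge0 ?expR_ge0 ?exprn_ge0.
have q0 : 0 < 1 - p := oneBp_gt0 peps eps01.
have qe : (1 - p)^-1 <= eps^-1 by rewrite lef_pV2 ?posrE //; move: peps; lra.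
have e1' : 1 <= eps^-1 by rewrite invf_ge1 // ltW.
apply: le_trans (_ : \sum_(l < k.+1) ((l == 0 :> nat)%:R + (l < l0)%N%:R * (z * eps^-1 ^+ (l0 ^ 2)) + Z) <= _).
  apply: ler_sum => -[l /= lk] _; rewrite ltnS in lk.
  have [->|l1] := posnP l.
    rewrite bin0 ffactn0 expr0 divr1 mulr1 mul1r /mixed_bound l00 !expr0 mulr1 /=.
    by rewrite mul1r -addrA lerDl addr_ge0.
  rewrite add0r /mixed_bound; case: ltnP => ll0.
    rewrite mul1r; apply: le_trans (_ : z ^+ l * eps^-1 ^+ (l0 ^ 2) <= _); last first.
      rewrite -[leLHS]addr0; apply: lerD => //; apply: ler_wpM2r; first by rewrite exprn_ge0 // invr_ge0 ltW.
      by rewrite -{2}[z]expr1; apply: ler_wiXn2l.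
    rewrite mulrA; apply: ler_pM.
    - by rewrite !mulr_ge0 ?invr_ge0 ?exprn_ge0 ?(ltW M0).
    - by rewrite exprn_ge0 // invr_ge0 ltW.
    - have -> : z ^+ l = k%:R ^+ l * k%:R ^+ l / M ^+ l * 2 ^+ l.
        by rewrite /z expr_div_n exprMn exprAC expr2; ring.
      rewrite ler_wpM2r ?exprn_ge0 // ler_wpM2r ?invr_ge0 ?exprn_ge0 ?(ltW M0) //.
      have ff : (k ^_ l <= k ^ l)%N.
        by elim: (l) => // m IH; rewrite ffactnSr expnSr leq_mul // leq_subr.
      rewrite -!natrX; apply: ler_pM => //; rewrite ler_nat //.
      by apply: leq_trans ff; rewrite -bin_ffact leq_pmulr // fact_gt0.
    apply: le_trans (_ : eps^-1 ^+ 'C(l, 2) <= _).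
      by apply: lerXn2r; rewrite ?nnegrE ?invr_ge0 ?(ltW q0) ?(ltW e0).
    apply: ler_weXn2l => //; apply: leq_trans (_ : l ^ 2 <= _)%N; last by rewrite leq_exp2r // ltnW.
    by rewrite bin2 -divn2; apply: leq_trans (leq_div _ _) _; rewrite leq_mul // leq_pred.
  rewrite mul0r add0r -/(term k p h M l); have lk' : (0 < l <= k)%N by rewrite l1.
  have c0 : 0 <= expR 1 * k%:R ^+ 3 :> R by rewrite mulr_ge0 ?expR_ge0 // exprn_ge0.
  case: (term_trichotomy lk') => [|H|[k2l H]].
  - move/le_trans; apply; apply: ler_wpM2l => //.
    apply: le_trans (_ : nu' ^+ l0 <= _); last by rewrite lerDl expR_ge0.
    apply: le_trans (_ : nu' ^+ l <= _); last exact: ler_wiXn2l.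
    apply: lerXn2r; rewrite ?nnegrE // ?divr_ge0 ?mu_ge0 //; apply: le_trans mu'.
    rewrite ler_pdivrMr ?ltr0n //; apply: ler_peMr; [exact: mu_ge0 | by rewrite ler1n].
  - apply: le_trans H _; apply: ler_wpM2l => //.
    apply: le_trans (_ : nu' ^+ l0 <= _); last by rewrite lerDl expR_ge0.
    apply: le_trans (_ : nu' ^+ l <= _); last exact: ler_wiXn2l.
    by apply: lerXn2r; rewrite ?nnegrE // nu_ge0.
  apply: le_trans H _; apply: ler_wpM2l => //.
  apply: le_trans (_ : expR (- g * k%:R / 2) <= _); last by rewrite lerDr exprn_ge0.
  apply: le_trans (_ : expR (- g) ^+ l <= _).
    by apply: lerXn2r; rewrite ?nnegrE ?expR_ge0 ?rho_ge0.
  rewrite -expRM_natl ler_expR; have : k%:R <= 2 * l%:R :> R by rewrite -natrM ler_nat.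
  by move/(ler_wpM2l g0); lra.
rewrite !big_split /=; apply: lerD; last by rewrite sumr_const card_ord mulr_natl.
apply: lerD; first by rewrite big_ord_recl /= big1 ?addr0.
by rewrite -mulr_suml ler_wpM2r // few_small_indices.
Qed.

End Sums.

(** * The sizes of a, k and mu in terms of ln n and ln(np) *)

Section Scale.
Variables (R : realType) (n k : nat) (p eps delta Q a d L : R).
Hypotheses (QE : Q = - ln (1 - p)) (aE : a = Q * k%:R / 2) (dE : d = ln (n%:R * p)) (LE : L = ln n%:R).
Hypotheses (p0 : 0 < p) (peps : p < 1 - eps) (eps01 : 0 < eps < 1) (delta01 : 0 < delta < 1).
Hypotheses (n0 : (0 < n)%N) (d0 : 0 <= d).
Hypothesis hk : Q * (k%:R - 3) / 2 <= 1 + ln (n%:R * p) + ln (1 - delta).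
Hypothesis hk' : 1 + ln (n%:R * p) + ln (1 - delta) <= Q * (k%:R - 2) / 2.

Lemma n_gt0 : 0 < n%:R :> R. Proof. by rewrite ltr0n. Qed.

Lemma expR_L : expR L = n%:R.
Proof. by rewrite LE lnK // posrE n_gt0. Qed.

Lemma expR_d : expR d = n%:R * p.
Proof. by rewrite dE lnK // posrE mulr_gt0 // n_gt0. Qed.

Lemma p_scale : p = expR (d - L).
Proof. by rewrite expRB expR_d expR_L mulrAC mulfV ?mul1r // gt_eqF // n_gt0. Qed.

Lemma expR_Ld_p : expR (L - d) * p = 1.
Proof. by rewrite p_scale -expRD (_ : L - d + (d - L) = 0) ?expR0 //; ring. Qed.

Lemma Q_bounds : [/\ p <= Q, Q <= - ln eps & Q <= p / eps].
Proof.
have q0 := oneBp_gt0 peps eps01; have /andP[e0 e1] := eps01; split.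
- by rewrite QE (p_le_Q peps eps01).
- by rewrite QE lerN2 ler_ln ?posrE //; move: peps; lra.
rewrite QE; apply: le_trans (Q_le_r p0 peps eps01) _.
by rewrite ler_pM2l // lef_pV2 ?posrE //; move: peps; lra.
Qed.

Lemma d_le_L : d <= L.
Proof.
rewrite dE LE ler_ln ?posrE ?mulr_gt0 ?n_gt0 //; apply: ler_piMr; first exact: ltW n_gt0.
by have /andP[e0 _] := eps01; move: peps; lra.
Qed.

Lemma ln1delta : ln (1 - delta) < 0.
Proof. by apply: ln_lt0; have /andP[? ?] := delta01; apply/andP; split; lra. Qed.

Lemma a_upper : a <= (1 + 3 / 2 * - ln eps) * (1 + d).
Proof.
have [pQ Qm _] := Q_bounds; have H := ln1delta; move: hk; rewrite -dE aE => hk1.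
have Qm0 : 0 <= - ln eps by move: p0; lra.
have := mulr_ge0 Qm0 d0; lra.
Qed.

Lemma a_lower : 1 + d + ln (1 - delta) <= a.
Proof. by have [pQ _ _] := Q_bounds; move: hk' p0; rewrite -dE aE; lra. Qed.

(** exp(L - d) is 1/p, and p <= Q. *)
Lemma k_upper : k%:R <= 2 * a * expR (L - d).
Proof.
have [pQ _ _] := Q_bounds.
have H : p * k%:R <= Q * k%:R by apply: ler_wpM2r.
by rewrite -(ler_pM2r p0) -[leRHS]mulrA expR_Ld_p aE; lra.
Qed.

(** k is at least logarithmic in n even for constant p: from Q <= p/eps it is at least eps(1 + d)
    exp(L - d), and (1 + d)(1 + L - d) >= 1 + L because 0 <= d <= L. *)
Lemma k_lower : 1 + d <= 2 * a -> eps * (1 + L) <= k%:R.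
Proof.
move=> da; have [_ _ Qr] := Q_bounds; have /andP[e0 _] := eps01.
have H : 2 * a * eps <= p * k%:R.
  rewrite aE; have : Q * k%:R <= p / eps * k%:R by apply: ler_wpM2r.
  rewrite mulrAC ler_pdivlMr //; lra.
have H2 : (1 + d) * eps <= p * k%:R by apply: le_trans H; rewrite ler_pM2r.
have H3 : (1 + d) * eps * expR (L - d) <= k%:R.
  by rewrite -(ler_pM2r p0) -[leLHS]mulrA expR_Ld_p mulr1 [leRHS]mulrC.
apply: le_trans H3; rewrite [leRHS]mulrAC [leRHS]mulrC ler_pM2l //.
have x0 : 0 <= L - d by rewrite subr_ge0 d_le_L.
apply: le_trans (_ : (1 + d) * (1 + (L - d)) <= _); first by have := mulr_ge0 d0 x0; lra.
by rewrite ler_pM2l ?expR_ge1Dx //; move: d0; lra.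
Qed.

Lemma expRNa : expR (- a) <= expR (- (1 + d + ln (1 - delta))).
Proof. by rewrite ler_expR lerN2 a_lower. Qed.

Lemma mu_upper (low : R) : 0 <= low -> 0 <= a ->
  low * a * expR (1 - a) * k%:R <= 2 * low / (1 - delta) * a ^+ 2 * expR (L - 2 * d).
Proof.
move=> low0 a0; have /andP[_ d1] := delta01; have dn : 1 - delta \is Num.pos by rewrite posrE; lra.
apply: le_trans (_ : low * a * (expR 1 * expR (- (1 + d + ln (1 - delta)))) * (2 * a * expR (L - d)) <= _).
  apply: ler_pM => //; first by rewrite mulr_ge0 ?expR_ge0 // mulr_ge0.
    apply: ler_wpM2l; first exact: mulr_ge0.
    by rewrite (expRD 1); apply: (ler_wpM2l (expR_ge0 _)); apply: expRNa.
  exact: k_upper.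
have -> : expR 1 * expR (- (1 + d + ln (1 - delta))) = expR (- d) / (1 - delta).
  by rewrite -expRD -[in RHS](lnK dn) -expRN -expRD; congr expR; ring.
have -> : expR (L - 2 * d) = expR (- d) * expR (L - d) by rewrite -expRD; congr expR; ring.
by rewrite le_eqVlt; apply/orP; left; apply/eqP; ring.
Qed.

End Scale.

(** * Choice of the constants *)

Section DenseCase.
Variables (R : realType) (eps delta : R).
Hypotheses (eps01 : 0 < eps < 1) (delta01 : 0 < delta < 1).

Let h := delta / 8.
Let c := 1 + 3 / 2 * - ln eps.

(* To be applied with d = ln (n p) and a = k ln(q) / 2. *)
Lemma large_degree : exists2 d0 : R, 0 <= d0 & forall d a, d0 <= d ->
  1 + d + ln (1 - delta) <= a -> a <= c * (1 + d) ->
  [/\ 1 <= a, 64 / (eps * h ^+ 2) <= a, 8 * ln (4 / h) <= a, 1 + d <= 2 * a &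
     6 * a * expR (- d / 2) <= 1 - expR (- h) /\
     low_const eps h * a ^+ 2 * expR (- a / 2) <= 1].
Proof.
have [/andP[e0 e1] /andP[del0 del1]] := (eps01, delta01).
have h0 : 0 < h by rewrite divr_gt0.
have h01 : 0 < h <= 1 by rewrite h0 /h; lra.
have eh : expR (- h) < 1 by rewrite expR_lt1; lra.
have low0 := low_const_gt0 eps01 h01.
have c1 : 1 <= c by rewrite /c; have := ln_le0 (ltW e1); lra.
set lam := ln (1 - delta).
have half0 : 0 < 1 / 2 :> R by lra.
have [x1 x10 H1] := exp_dominates (6 * c / (1 - expR (- h))) half0.
have [x2 x20 H2] := exp_dominates (low_const eps h * c ^+ 2 * expR (- (1 + lam) / 2)) half0.
set B := 64 / (eps * h ^+ 2); set B' := 8 * ln (4 / h).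
exists (x1 + x2 + `|B| + `|B'| + 1 + 2 * `|lam|) => [|d a dge al au].
  by rewrite !addr_ge0 ?normr_ge0 // mulr_ge0.
have nB := ler_norm B; have nB' := ler_norm B'; have := ler_norm (- lam); rewrite normrN => nl.
have B0 := normr_ge0 B; have B'0 := normr_ge0 B'; have l0 := normr_ge0 lam.
have d0 : 0 <= d by lra.
have a0 : 0 <= a by lra.
split; [lra | lra | lra | lra | split].
  have /H1 : x1 <= d by lra.
  rewrite mulrAC ler_pdivrMr ?subr_gt0 // => H.
  have H' : 6 * a <= expR (1 / 2 * d) * (1 - expR (- h)).
    apply: le_trans H; rewrite expr2 -!mulrA ler_pM2l // mulrA.
    by apply: le_trans au _; apply: ler_peMr; [apply: mulr_ge0; lra | lra].
  have E : expR (1 / 2 * d) * expR (- d / 2) = 1 by rewrite -expRD -[RHS](expR0 R); congr expR; ring.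
  have := ler_wpM2r (expR_ge0 (- d / 2)) H'; rewrite [leRHS]mulrAC E; lra.
have /H2 H : x2 <= d by lra.
apply: le_trans (_ : low_const eps h * (c * (1 + d)) ^+ 2 * expR (- (1 + d + lam) / 2) <= _).
  apply: ler_pM (expR_ge0 _) _ _; first by rewrite mulr_ge0 ?sqr_ge0 // ltW.
    by rewrite ler_wpM2l ?(ltW low0) // lerXn2r ?nnegrE // mulr_ge0; lra.
  by rewrite ler_expR; lra.
have -> : expR (- (1 + d + lam) / 2) = expR (- (1 + lam) / 2) * expR (- (1 / 2 * d)).
  by rewrite -expRD; congr expR; ring.
have E : expR (1 / 2 * d) * expR (- (1 / 2 * d)) = 1 by rewrite -expRD -[RHS](expR0 R); congr expR; ring.
have := ler_wpM2r (expR_ge0 (- (1 / 2 * d))) H; rewrite E; apply: le_trans.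
by rewrite le_eqVlt; apply/orP; left; apply/eqP; ring.
Qed.

Lemma exp_decay (b y : R) : 0 < b -> exists2 x0 : R, 0 <= x0 & forall x, x0 <= x -> y <= expR (b * x).
Proof.
move=> b0; have [x0 x00 H] := exp_dominates `|y| b0; exists x0 => // x xx0.
apply: le_trans (H x xx0); apply: le_trans (ler_norm _) _; apply: ler_peMr => //.
by apply: exprn_ege1; lra.
Qed.

(** With h = delta/8 the losses exp(4h) consume only half of the slack, since 1 - delta <=
    exp(-delta). *)
Lemma h_props : [/\ 0 < h <= 1 & expR (4 * h) * (1 - delta) <= expR (- (delta / 2))].
Proof.
have /andP[del0 del1] := delta01; split; first by rewrite /h; lra.
apply: le_trans (_ : expR (4 * h) * expR (- delta) <= _).
  by apply: ler_wpM2l (expR_ge0 _) _ _ _; have := expR_ge1Dx (- delta); lra.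
by rewrite -expRD ler_expR /h; lra.
Qed.

End DenseCase.

(** * The dense and the sparse range *)

(** Blocks of a single vertex are taken, so that all sets are transversals. The second moment sum is
    then 1 plus a negative power of n, and so the probability itself is close to 1. *)
Lemma dense_case (R : realType) (eps delta : R) : 0 < eps < 1 -> 0 < delta < 1 ->
  exists c' d0 L0 : R, 0 < c' /\ forall (n k : nat) (p : R),
  (0 < n)%N -> 0 < p -> p < 1 - eps -> d0 <= ln (n%:R * p) -> L0 <= ln n%:R ->
  3 / 5 * ln n%:R <= ln (n%:R * p) ->
  - ln (1 - p) * (k%:R - 3) / 2 <= 1 + ln (n%:R * p) + ln (1 - delta) ->
  1 + ln (n%:R * p) + ln (1 - delta) <= - ln (1 - p) * (k%:R - 2) / 2 ->
  1 - 3 * expR (- (c' * ln n%:R)) <= gnp_prob p (fun E : {set {set 'I_n}} => k <= max_induced_forest E)%N.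
Proof.
move=> eps01 delta01; have [/andP[e0 e1] /andP[del0 del1]] := (eps01, delta01).
pose h := delta / 8; pose c := 1 + 3 / 2 * - ln eps; pose low := low_const eps h.
have [h01 hrho] := h_props delta01; have /andP[h0 h1] := h01; rewrite -/h in h0 h1 h01 hrho.
have low0 : 0 < low := low_const_gt0 eps01 h01.
have c1 : 1 <= c by rewrite /c; have := ln_le0 (ltW e1); lra.
have [d0 d00 Hd] := large_degree eps01 delta01; rewrite -/h -/c in Hd.
(* With this l0, nu' ^ l0 = n^-5 beats the factor (k + 1) e k^3. *)
pose l0 := 50%N.
have [w wE] : exists w : R, w = l0%:R * eps^-1 ^+ (l0 ^ 2) by eexists.
pose K1 := 8 * expR h * c ^+ 2 * w.
pose K2 := 2 * low / (1 - delta) * c ^+ 2.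
pose K3 := low * c ^+ 2 * expR (- (1 + ln (1 - delta)) / 2).
have tenth : 0 < 1 / 10 :> R by lra.
have g8 : 0 < delta / 2 / 8 by lra.
have [x1 x10 H1] := exp_dominates K1 tenth.
have [x2 x20 H2] := exp_dominates K2 tenth.
have [x3 x30 H3] := exp_dominates K3 tenth.
have [x4 x40 H4] := exp_dominates (expR 1) g8.
pose c' := Num.min (1 / 10) (delta / 2 / 4 * eps).
have c'1 : c' <= 1 / 10 by rewrite ge_min lexx.
have c'2 : c' <= delta / 2 / 4 * eps by rewrite ge_min lexx orbT.
have c'0 : 0 < c' by rewrite lt_min tenth /= !mulr_gt0 //; lra.
have e0' : 0 < eps^-1 by rewrite invr_gt0.
exists c', d0, (4 + x1 + x2 + x3 + (x4 + 4 * (- ln eps) / h ^+ 2) / eps ^+ 2); split=> // n k p n0 p0 peps.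
set d := ln (n%:R * p); set L := ln n%:R; set Q := - ln (1 - p) => d0d L0L Ld hk hk'.
pose a := Q * k%:R / 2.
have Qm0 : 0 <= - ln eps by rewrite oppr_ge0 ln_le0 // ltW.
have s0 : 0 <= (x4 + 4 * (- ln eps) / h ^+ 2) / eps ^+ 2.
  by rewrite divr_ge0 ?sqr_ge0 // addr_ge0 // divr_ge0 ?sqr_ge0 // mulr_ge0.
have QE : Q = - ln (1 - p) by [].
have aE : a = Q * k%:R / 2 by [].
have dd0 : 0 <= d by apply: le_trans d0d.
have p01 : 0 < p < 1 by rewrite p0 /=; clear - e0 peps; lra.
have al : 1 + d + ln (1 - delta) <= a by apply: (a_lower (n := n) (k := k) QE aE _ p0 peps eps01).
have au : a <= c * (1 + d) by apply: (a_upper (n := n) (k := k) (delta := delta) QE aE _ p0 peps eps01).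
have [a1 a2 a3 a4 [a5 a6]] := Hd d a d0d al au.
have a0 : 0 <= a by apply: le_trans a1.
have k0 : (0 < k)%N.
  by rewrite lt0n; apply/eqP => k0; move: a1; rewrite aE k0 mulr0 mul0r ler10.
have k0' : 0 < k%:R :> R by rewrite ltr0n.
have n0' : 0 < n%:R :> R by rewrite ltr0n.
have eL : expR L = n%:R by apply: expR_L.
have dL : d <= L by apply: (d_le_L (n := n) (p := p) (eps := eps)).
have ku : k%:R <= 2 * a * expR (L - d) by apply: (k_upper (n := n) (p := p) QE aE _ _ p0 peps eps01).
have kl : eps * (1 + L) <= k%:R by apply: (k_lower (n := n) (p := p) (d := d) QE aE _ _ p0 peps eps01).
have kn : k%:R <= n%:R * (1 - expR (- h)).
  apply: le_trans ku _; rewrite -eL; apply: le_trans (_ : expR L * (6 * a * expR (- d / 2)) <= _); last first.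
    by apply: (ler_wpM2l _ a5); apply: expR_ge0.
  have -> : 2 * a * expR (L - d) = expR L * (2 * a * expR (- d)) by rewrite expRD; ring.
  apply: ler_wpM2l; first exact: expR_ge0.
  apply: ler_pM; rewrite ?expR_ge0 ?ler_expR //; first by rewrite mulr_ge0.
    by rewrite ler_wpM2r // ler_nat.
  by clear - dd0; lra.
have eh0 := expR_gt0 (- h).
have kn' : (k < n)%N by rewrite -(ltr_nat R); apply: le_lt_trans kn _; rewrite gtr_pMr //; clear - eh0; lra.
have ME : ((n - k) * 1)%:R = n%:R - k%:R :> R by rewrite muln1 natrB // ltnW.
set M : R := ((n - k) * 1)%:R in ME.
have Ml : n%:R * expR (- h) <= M by rewrite ME; clear - kn; lra.
have M0 : 0 < M by apply: lt_le_trans Ml; rewrite mulr_gt0.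
have hM : n%:R / M <= expR h.
  rewrite ler_pdivrMr // -ler_pdivrMl ?expR_gt0 // -expRN mulrC //.
have kLn : k%:R <= expR L by rewrite eL ler_nat ltnW.
have hQ : Q <= k%:R * (eps * h ^+ 2 / 4).
  have [_ Qm _] := Q_bounds QE p0 peps eps01; apply: le_trans Qm _.
  have : (x4 + 4 * (- ln eps) / h ^+ 2) / eps ^+ 2 <= L by clear - L0L x10 x20 x30; lra.
  rewrite ler_pdivrMr ?exprn_gt0 // => H.
  have H' : 4 * (- ln eps) / h ^+ 2 <= eps * (eps * L) by move: H; rewrite expr2; clear - x40; lra.
  have : 4 * (- ln eps) / h ^+ 2 <= eps * k%:R.
    by apply: le_trans H' _; rewrite ler_pM2l //; apply: le_trans kl; rewrite ler_pM2l // lerDr.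
  by rewrite ler_pdivrMr ?exprn_gt0 //; clear; lra.
have L0 : 0 <= L by apply: le_trans dL.
(* n/(np)^2 is at most n^(-1/5) here; half of this saving is given up for the factors log^2 n. *)
pose nu' := expR (- (1 / 10 * L)).
have E10 y : y <= expR (1 / 10 * L) -> y * expR (L - 2 * d) <= nu'.
  move=> H; apply: le_trans (_ : expR (1 / 10 * L) * expR (L - 2 * d) <= _).
    by apply: (ler_wpM2r _ H); apply: expR_ge0.
  by rewrite -expRD ler_expR; clear - Ld; lra.
have a2L : a ^+ 2 <= c ^+ 2 * (1 + L) ^+ 2.
  have c0 : 0 <= c by apply: le_trans c1.
  rewrite -exprMn lerXn2r ?nnegrE //; first by rewrite mulr_ge0 // addr_ge0.
  by apply: le_trans au _; apply: ler_wpM2l => //; rewrite lerD2l.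
have mu' : low_const eps h * a * expR (1 - a) * k%:R <= nu'.
  apply: le_trans (mu_upper (n := n) (k := k) (p := p) QE aE erefl erefl p0 peps eps01 delta01 n0 hk' (ltW low0) a0) _.
  apply: E10; apply: le_trans (H2 L _); last by clear - L0L x10 x20 x30 s0; lra.
  rewrite /K2 -[leRHS]mulrA; apply: (ler_wpM2l _ a2L).
  by apply: divr_ge0; [apply: mulr_ge0 => //; apply: ltW | rewrite subr_ge0 ltW].
have nnu : low_const eps h * a ^+ 2 * expR (- a / 2) <= nu'.
  apply: le_trans (_ : K3 * (1 + L) ^+ 2 * expR (- d / 2) <= _).
    have -> : K3 * (1 + L) ^+ 2 * expR (- d / 2) = low * (c ^+ 2 * (1 + L) ^+ 2) * expR (- (1 + d + ln (1 - delta)) / 2).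
      rewrite (_ : - (1 + d + ln (1 - delta)) / 2 = - (1 + ln (1 - delta)) / 2 + - d / 2); last by ring.
      by rewrite expRD /K3; ring.
    apply: ler_pM (expR_ge0 _) _ _; first by rewrite mulr_ge0 ?sqr_ge0 // ltW.
      by apply: (ler_wpM2l _ a2L); apply: ltW.
    by rewrite ler_expR; clear - al; lra.
  apply: le_trans (_ : expR (1 / 10 * L) * expR (- d / 2) <= _).
    by apply: ler_wpM2r; [apply: expR_ge0 | apply: H3; clear - L0L x10 x20 x30 s0; lra].
  by rewrite -expRD ler_expR; clear - Ld L0; lra.
have nu1 : nu' <= 1 by rewrite expR_le1; clear - L0; lra.
have k2M : 2 * k%:R ^+ 2 / M * (l0%:R * eps^-1 ^+ (l0 ^ 2)) <= nu'.
  have z1 : 2 * k%:R ^+ 2 / M <= 8 * expR h * a ^+ 2 * expR (L - 2 * d).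
    have ae0 : 0 <= 2 * a * expR (L - d) := le_trans (ltW k0') ku.
    have k2 : k%:R ^+ 2 <= (2 * a * expR (L - d)) ^+ 2 by rewrite lerXn2r ?nnegrE ?ler0n.
    have Mi : M^-1 <= expR h / n%:R by rewrite ler_pdivlMr // mulrC.
    apply: le_trans (_ : 2 * (2 * a * expR (L - d)) ^+ 2 * (expR h / n%:R) <= _).
      apply: ler_pM => //; rewrite ?invr_ge0 ?(ltW M0) ?mulr_ge0 ?sqr_ge0 //.
      by rewrite ler_pM2l.
    have -> : expR (L - 2 * d) = expR (L - d) ^+ 2 / n%:R.
      by rewrite -eL -expRN expr2 -!expRD; congr expR; ring.
    by rewrite le_eqVlt; apply/orP; left; apply/eqP; ring.
  have w0 : 0 <= w by rewrite wE mulr_ge0 // exprn_ge0 // ltW.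
  rewrite -wE; apply: le_trans (ler_wpM2r w0 z1) _.
  rewrite mulrAC; apply: E10; apply: le_trans (H1 L _); last by clear - L0L x10 x20 x30 s0; lra.
  rewrite /K1 (_ : 8 * expR h * a ^+ 2 * w = 8 * expR h * w * a ^+ 2); last by rewrite mulrAC.
  rewrite (_ : 8 * expR h * c ^+ 2 * w * (1 + L) ^+ 2 = 8 * expR h * w * (c ^+ 2 * (1 + L) ^+ 2)); last first.
    by rewrite [RHS]mulrA [8 * expR h * w * _]mulrAC.
  apply: (ler_wpM2l _ a2L); apply: mulr_ge0 => //; apply: mulr_ge0 => //; exact: expR_ge0.
have k2M1 : 2 * k%:R ^+ 2 / M <= 1.
  apply: le_trans nu1; apply: le_trans k2M; apply: ler_peMr.
    by rewrite divr_ge0 ?(ltW M0) // mulr_ge0 ?sqr_ge0.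
  by apply: mulr_ege1; rewrite ?ler1n // exprn_ege1 // invf_ge1 // ltW.
have g0 : 0 <= delta / 2 by rewrite divr_ge0 // ltW.
have l00 : (0 < l0)%N by [].
have S := dense_sum QE aE p0 peps eps01 delta01 h01 M0 n0 k0 hk hM a1 a2 a3 hQ l00 mu' nnu nu1 g0 hrho k2M1.
set Sm := \sum_(l < k.+1) _ in S.
have PS : 1 <= gnp_prob p (fun E : {set {set 'I_n}} => k <= max_transversal_forest 1 E)%N * Sm.
  have hi0 : 0 < h^-1 by rewrite invr_gt0.
  have nn : (n * 1 <= n)%N by rewrite muln1.
  apply: (prob_transversal_forest (N := n) (m := 1) p01 _ _ k0 kn' hi0) => // [l|l lk].
    have q0 := oneBp_gt0 peps eps01; have q0' : 0 <= (1 - p)^-1 by rewrite invr_ge0 ltW.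
    rewrite /mixed_bound; case: ifP => _; first by rewrite mulr_ge0 ?exprn_ge0.
    rewrite !mulr_ge0 ?exprn_ge0 // divr_ge0 ?sqr_ge0 // mulr_ge0 //.
      by rewrite addr_ge0 // invr_ge0 ltW.
    by rewrite addr_ge0 ?mulr_ge0 ?sqr_ge0 ?invr_ge0 // ?(ltW h0) ?mulr_ge0 ?(ltW p0).
  rewrite /mixed_bound; case: ifP => _; rewrite lexx ?orbT // andbT; apply/orP; left.
  have Qr := Q_le_r p0 peps eps01.
  apply: le_trans (_ : k%:R * Q <= _); first by move: a1; rewrite aE; clear; lra.
  by rewrite ler_pM2l.
have S1 : Sm <= 1 + 3 * expR (- (c' * L)).
  apply: le_trans S _; rewrite -addrA lerD2l.
  have cL : nu' <= expR (- (c' * L)).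
    by rewrite ler_expR lerN2; apply: (ler_wpM2r _ c'1).
  have kk : k.+1%:R * (expR 1 * k%:R ^+ 3) <= expR 2 * k%:R ^+ 4 :> R.
    have e2 : 2 <= expR 1 :> R by apply: le_trans (expR_ge1Dx 1).
    have -> : expR 2 = expR 1 * expR 1 :> R by rewrite -expRD; congr expR; ring.
    have -> : k.+1%:R * (expR 1 * k%:R ^+ 3) = expR 1 * k%:R ^+ 3 * k.+1%:R :> R by ring.
    have -> : expR 1 * expR 1 * k%:R ^+ 4 = expR 1 * k%:R ^+ 3 * (expR 1 * k%:R) :> R by ring.
    apply: ler_wpM2l; first by rewrite mulr_ge0 ?expR_ge0 // exprn_ge0.
    apply: le_trans (_ : 2 * k%:R <= _); last by rewrite ler_pM2r.
    by rewrite mulr_natl mulr2n -natr1 lerD2l ler1n.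
  have T1 : l0%:R * (2 * k%:R ^+ 2 / M * eps^-1 ^+ (l0 ^ 2)) <= expR (- (c' * L)).
    by apply: le_trans cL; apply: le_trans k2M; rewrite mulrCA.
  have T2 : k.+1%:R * (expR 1 * k%:R ^+ 3) * nu' ^+ l0 <= expR (- (c' * L)).
    apply: le_trans (ler_wpM2r _ kk) _; first by rewrite exprn_ge0 ?expR_ge0.
    apply: le_trans (_ : expR 2 * expR L ^+ 4 * nu' ^+ l0 <= _).
      apply: ler_wpM2r; first by rewrite exprn_ge0 ?expR_ge0.
      by apply: (ler_wpM2l (expR_ge0 _)); rewrite lerXn2r ?nnegrE ?expR_ge0.
    rewrite /nu' -!expRM_natl -!expRD ler_expR.
    have : c' * L <= 1 / 10 * L by apply: (ler_wpM2r _ c'1).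
    have L4 : 4 <= L by clear - L0L x10 x20 x30 s0; lra.
    by rewrite /l0; clear - L4; lra.
  have T3 : k.+1%:R * (expR 1 * k%:R ^+ 3) * expR (- (delta / 2) * k%:R / 2) <= expR (- (c' * L)).
    apply: le_trans (ler_wpM2r (expR_ge0 _) kk) _.
    have xk : x4 <= k%:R.
      apply: le_trans kl; have : (x4 + 4 * (- ln eps) / h ^+ 2) / eps ^+ 2 <= L by clear - L0L x10 x20 x30; lra.
      rewrite ler_pdivrMr ?exprn_gt0 // => H.
      have z0 : 0 <= 4 * (- ln eps) / h ^+ 2 by rewrite divr_ge0 ?sqr_ge0 // mulr_ge0.
      have H5 : L * eps ^+ 2 <= eps * L.
        by rewrite mulrC; apply: ler_wpM2r => //; rewrite expr2; apply: ler_piMl; apply: ltW.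
      by clear - H H5 z0 e0; lra.
    have H := H4 _ xk.
    have H' : expR 2 * k%:R ^+ 4 <= expR (delta / 2 / 4 * k%:R).
      apply: le_trans (_ : (expR 1 * (1 + k%:R) ^+ 2) ^+ 2 <= _).
        rewrite exprMn -expRM_natl mulr1 -exprM; apply: (ler_wpM2l (expR_ge0 _)).
        by rewrite lerXn2r ?nnegrE // ?addr_ge0 // lerDr.
      have -> : expR (delta / 2 / 4 * k%:R) = expR (delta / 2 / 8 * k%:R) ^+ 2.
        by rewrite -expRM_natl; congr expR; field.
      by rewrite lerXn2r ?nnegrE ?expR_ge0 // mulr_ge0 ?expR_ge0 ?sqr_ge0.
    apply: le_trans (ler_wpM2r (expR_ge0 _) H') _; rewrite -expRD ler_expR.
    have d24 : 0 < delta / 2 / 4 by rewrite !divr_gt0.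
    have k3 : delta / 2 / 4 * (eps * (1 + L)) <= delta / 2 / 4 * k%:R by rewrite ler_pM2l.
    have k4 : c' * L <= delta / 2 / 4 * eps * L by apply: (ler_wpM2r _ c'2).
    have k5 : 0 <= delta / 2 / 4 * eps by rewrite mulr_ge0 // ltW.
    by clear - k3 k4 k5; lra.
  rewrite [k.+1%:R * _]mulrA [k.+1%:R * _ * _]mulrDr.
  apply: le_trans (lerD T1 (lerD T2 T3)) _.
  by move: (expR _) => y; clear; lra.
have Pmono : gnp_prob p (fun E : {set {set 'I_n}} => k <= max_transversal_forest 1 E)%N <=
    gnp_prob p (fun E : {set {set 'I_n}} => k <= max_induced_forest E)%N.
  by apply: le_gnp_prob => // E _ /leq_trans; apply; apply: max_transversal_forest_le.
apply: le_trans Pmono; set P := gnp_prob _ _ in PS *.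
have P0 : 0 <= P by apply: gnp_prob_ge0.
set y := expR _ in S1 *; have y0 : 0 <= y := expR_ge0 _.
have := ler_wpM2l P0 S1; have P1 : P <= 1 by apply: gnp_prob_le1.
have := ler_wpM2r y0 P1; move: PS; clear; lra.
Qed.

Lemma half_le_ln1Dx (R : realType) (y : R) : 0 <= y <= 1 -> y / 2 <= ln (1 + y).
Proof.
case/andP=> y0 y1; rewrite -[leLHS]expRK ler_ln ?posrE ?expR_gt0 //; last lra.
have H : 1 - y / 2 <= expR (- (y / 2)) by apply: le_trans (expR_ge1Dx _); lra.
have E : expR (y / 2) * expR (- (y / 2)) = 1 by apply: expRxMexpNx_1.
have e0 : 0 < 1 - y / 2 by lra.
have H1 : expR (y / 2) * (1 - y / 2) <= 1 by rewrite -[leRHS]E ler_wpM2l ?expR_ge0.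
have H2 : 1 <= (1 + y) * (1 - y / 2) by have := mulr_ge0 y0 (_ : 0 <= 1 - y); rewrite subr_ge0 => /(_ y1); lra.
by rewrite -(ler_pM2r e0); apply: le_trans H1 H2.
Qed.

(** With K = 1 + y, (2 + y)^2 = 4(1 + y) + y^2 shows that each colour costs at most exp(y^2/4),
    while each unit of s - s' gains at least exp(y/2). *)
Lemma concentration_exponent (R : realType) (y X : R) (s s' N : nat) : 0 <= y <= 1 ->
  X * (1 + y) ^+ s <= (1 + y) ^+ s' * ((1 + (1 + y)) ^+ 2 / (4 * (1 + y))) ^+ N -> (s' <= s)%N ->
  X <= expR (- ((s%:R - s'%:R) * y / 2) + N%:R * (y ^+ 2 / 4)).
Proof.
move=> y01 H ss; have [/andP[y0 y1]] := y01; have K0 : 0 < 1 + y by lra.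
have H1 : X * (1 + y) ^+ (s - s') <= ((1 + (1 + y)) ^+ 2 / (4 * (1 + y))) ^+ N.
  have Ks' : 0 < (1 + y) ^+ s' by rewrite exprn_gt0.
  rewrite -(ler_pM2l Ks'); apply: le_trans H.
  by rewrite mulrCA -exprD subnKC.
have H2 : ((1 + (1 + y)) ^+ 2 / (4 * (1 + y))) ^+ N <= expR (N%:R * (y ^+ 2 / 4)).
  rewrite expRM_natl; apply: lerXn2r; rewrite ?nnegrE ?expR_ge0 //.
    by rewrite divr_ge0 ?sqr_ge0 // mulr_ge0 // ltW.
  apply: le_trans (expR_ge1Dx _); rewrite ler_pdivrMr ?mulr_gt0 //.
  by have := mulr_ge0 y0 (sqr_ge0 y); lra.
have H3 : expR ((s%:R - s'%:R) * y / 2) <= (1 + y) ^+ (s - s').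
  rewrite -natrB // -[X in X ^+ _](lnK (x := 1 + y)) ?posrE // -expRM_natl -mulrA ler_expR.
  by rewrite ler_wpM2l // half_le_ln1Dx.
have e0 := expR_gt0 ((s%:R - s'%:R) * y / 2).
rewrite expRD expRN mulrC ler_pdivlMr //.
have [X0|X0] := leP 0 X; last first.
  by apply: le_trans (_ : 0 <= _); [rewrite nmulr_rle0 // ltW | exact: expR_ge0].
by apply: le_trans H2; apply: le_trans H1; apply: ler_wpM2l.
Qed.

Lemma sparse_case (R : realType) (eps : R) : 0 < eps < 1 ->
  exists d0 L0 : R, forall (n k k' : nat) (p : R),
  (0 < n)%N -> 0 < p -> p < 1 - eps -> d0 <= ln (n%:R * p) -> L0 <= ln n%:R ->
  ln (n%:R * p) <= 3 / 5 * ln n%:R ->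
  - ln (1 - p) * (k%:R - 3) / 2 <= 1 + ln (n%:R * p) + ln (1 - eps / 2) ->
  1 + ln (n%:R * p) + ln (1 - eps / 2) <= - ln (1 - p) * (k%:R - 2) / 2 ->
  (0 < k')%N -> - ln (1 - p) * (k'%:R - 3) / 2 <= 1 + ln (n%:R * p) + ln (1 - eps) ->
  1 - expR (- ln n%:R) <= gnp_prob p (fun E : {set {set 'I_n}} => k' <= max_induced_forest E)%N.
Proof.
move=> eps01; have /andP[e0 e1] := eps01; pose delta := eps / 2.
have delta01 : 0 < delta < 1 by apply/andP; split; rewrite /delta; lra.
have /andP[del0 del1] := delta01.
have [h01 hrho] := h_props delta01; set h := delta / 8 in h01 hrho; have /andP[h0 h1] := h01.
pose c := 1 + 3 / 2 * - ln eps; pose low := low_const eps h.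
have low0 : 0 < low := low_const_gt0 eps01 h01.
have c1 : 1 <= c by rewrite /c; have := ln_le0 (ltW e1); lra.
have [d0 d00 Hd] := large_degree eps01 delta01; rewrite -/h -/c in Hd.
(* [g] is the gap between the two thresholds; it gives k - (k' - 1) >= cc / p, where the factor
   [eps] in [cc] comes from Q <= p/eps. *)
pose g := ln (1 - delta) - ln (1 - eps).
have g0 : 0 < g by rewrite subr_gt0 ltr_ln ?posrE /delta; lra.
pose cc := 2 * g * eps.
have cc0 : 0 < cc by rewrite !mulr_gt0.
have tenth : 0 < 1 / 10 :> R by lra.
have half0 : 0 < 1 / 2 :> R by lra.
have [x1 x10 H1] := exp_dominates (2 * low / (1 - delta) * c ^+ 2 * (16 / cc ^+ 2)) half0.
(* 80 = 16 * 5, so that [cc ^+ 2 / 16] times the exponential exceeds 5(1 + L)^2, hence 2 + 5L. *)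
have [x2 x20 H2] := exp_dominates (80 / cc ^+ 2) tenth.
have [x3 x30 H3] := exp_decay cc half0.
exists (d0 + x1 + x3), (x2 + 4 * (- ln eps) / h ^+ 2 / eps ^+ 2) => n k k' p n0 p0 peps.
set d := ln (n%:R * p); set L := ln n%:R; set Q := - ln (1 - p) => d0d L0L Ld hk hk' k'0 hk2.
pose a := Q * k%:R / 2.
have Qm0 : 0 <= - ln eps by rewrite oppr_ge0 ln_le0 // ltW.
have s0 : 0 <= 4 * (- ln eps) / h ^+ 2 / eps ^+ 2.
  by rewrite divr_ge0 ?sqr_ge0 // divr_ge0 ?sqr_ge0 // mulr_ge0.
have QE : Q = - ln (1 - p) by [].
have aE : a = Q * k%:R / 2 by [].
have dd0 : d0 <= d by clear - d0d x10 x30; lra.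
have d0' : 0 <= d by apply: le_trans dd0.
have p01 : 0 < p < 1 by rewrite p0 /=; clear - e0 peps; lra.
have al : 1 + d + ln (1 - delta) <= a by apply: (a_lower (n := n) (k := k) QE aE _ p0 peps eps01).
have au : a <= c * (1 + d) by apply: (a_upper (n := n) (k := k) (delta := delta) QE aE _ p0 peps eps01).
have [a1 a2 a3 a4 [a5 a6]] := Hd d a dd0 al au.
have a0 : 0 <= a by apply: le_trans a1.
have k0 : (0 < k)%N.
  by rewrite lt0n; apply/eqP => k0; move: a1; rewrite aE k0 mulr0 mul0r ler10.
have k0' : 0 < k%:R :> R by rewrite ltr0n.
have n0' : 0 < n%:R :> R by rewrite ltr0n.
have eL : expR L = n%:R by apply: expR_L.
have dL : d <= L by apply: (d_le_L (n := n) (p := p) (eps := eps)).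
have L0 : 0 <= L by apply: le_trans dL.
have ku : k%:R <= 2 * a * expR (L - d) by apply: (k_upper (n := n) (p := p) QE aE _ _ p0 peps eps01).
have kl : eps * (1 + L) <= k%:R by apply: (k_lower (n := n) (p := p) (d := d) QE aE _ _ p0 peps eps01).
have ep : expR (L - d) * p = 1 by apply: (expR_Ld_p (n := n)).
have hQ : Q <= k%:R * (eps * h ^+ 2 / 4).
  have [_ Qm _] := Q_bounds QE p0 peps eps01; apply: le_trans Qm _.
  have : 4 * (- ln eps) / h ^+ 2 / eps ^+ 2 <= L by clear - L0L x20; lra.
  rewrite ler_pdivrMr ?exprn_gt0 // => H.
  have H' : 4 * (- ln eps) / h ^+ 2 <= eps * (eps * L) by move: H; rewrite expr2; clear; lra.
  have : 4 * (- ln eps) / h ^+ 2 <= eps * k%:R.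
    by apply: le_trans H' _; rewrite ler_pM2l //; apply: le_trans kl; rewrite ler_pM2l // lerDr.
  by rewrite ler_pdivrMr ?exprn_gt0 //; clear; lra.
have [m [m0 ml mu]] : exists m : nat, [/\ (0 < m)%N, expR (d / 2) <= m%:R & m%:R <= 2 * expR (d / 2)].
  exists (Num.truncn (expR (d / 2))).+1; split=> //; first by apply: ltW; rewrite truncnS_gt // expR_ge0.
  have t1 : (Num.truncn (expR (d / 2)))%:R <= expR (d / 2) by rewrite truncn_le // expR_ge0.
  have : 1 <= expR (d / 2) by rewrite -[leLHS](expR0 R) ler_expR divr_ge0.
  by rewrite -natr1; move: t1; clear; lra.
have m0' : 0 < m%:R :> R by rewrite ltr0n.
pose N := (n %/ m)%N.
(* The 6 of [large_degree] is 4 + 2: four for the k blocks met by a transversal, two for the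
   vertices of the incomplete last block. *)
have mk : m%:R + k%:R * m%:R <= n%:R * (1 - expR (- h)).
  apply: le_trans (_ : n%:R * (6 * a * expR (- d / 2)) <= _); last by rewrite ler_wpM2l.
  have E : expR (L - d) * expR (d / 2) = expR L * expR (- d / 2).
    by rewrite -!expRD; congr expR; field.
  have B1 : k%:R * m%:R <= 2 * a * expR (L - d) * (2 * expR (d / 2)) by apply: ler_pM.
  have B2 : m%:R <= 2 * (expR L * expR (- d / 2)).
    apply: le_trans mu _; rewrite ler_pM2l // -expRD ler_expR; clear - dL; lra.
  have B3 : 1 * (expR L * expR (- d / 2)) <= a * (expR L * expR (- d / 2)).
    by apply: (ler_wpM2r _ a1); rewrite mulr_ge0 ?expR_ge0.
  have B1' : k%:R * m%:R <= 4 * a * (expR L * expR (- d / 2)).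
    by rewrite -E; apply: le_trans B1 _; rewrite le_eqVlt; apply/orP; left; apply/eqP; clear; ring.
  have -> : n%:R * (6 * a * expR (- d / 2)) = 6 * (a * (expR L * expR (- d / 2))) by rewrite -eL; clear; ring.
  by move: (expR L * expR (- d / 2)) B1' B2 B3 => z B1' B2 B3; clear - B1' B2 B3; lra.
have eh0 := expR_gt0 (- h).
have mkn : m%:R + k%:R * m%:R < n%:R :> R.
  by apply: le_lt_trans mk _; rewrite gtr_pMr //; clear - eh0; lra.
have nN : (n < N.+1 * m)%N by rewrite ltn_ceil.
have kN : (k < N)%N.
  rewrite -ltnS -(ltn_pmul2r m0); apply: leq_trans nN.
  by rewrite ltnS; apply: ltnW; rewrite -(ltr_nat R) mulSn natrD natrM.
have Nm : (N * m <= n)%N by rewrite leq_divM.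
set M : R := ((N - k) * m)%:R.
have Ml : n%:R * expR (- h) <= M.
  have : n%:R <= (N.+1 * m)%:R :> R by rewrite ler_nat ltnW.
  rewrite /M mulnBl natrB ?leq_mul2r ?(ltnW kN) ?orbT // !natrM -natr1.
  by move: mk; clear; lra.
have M0 : 0 < M by apply: lt_le_trans Ml; rewrite mulr_gt0.
have hM : n%:R / M <= expR h by rewrite ler_pdivrMr // -ler_pdivrMl ?expR_gt0 // -expRN mulrC.
have rho1 : expR (4 * h) * (1 - delta) <= 1.
  by apply: le_trans hrho _; rewrite expR_le1 oppr_le0 divr_ge0 // ltW.
have S := sparse_sum QE aE p0 peps eps01 delta01 h01 M0 n0 k0 hk hM a1 a2 a3 hQ a6 rho1.
set Sm := \sum_(l < k.+1) _ in S; set mu1 := low_const eps h * a * _ * _ in S.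
set P := gnp_prob p (fun E : {set {set 'I_n}} => k <= max_transversal_forest m E)%N.
have PS : 1 <= P * Sm.
  have hi0 : 0 < h^-1 by rewrite invr_gt0.
  apply: (prob_transversal_forest (N := N) (m := m) p01 m0 Nm k0 kN hi0 (H := mixed_bound k p h 0)) => [l|l lk].
    have q0 := oneBp_gt0 peps eps01; have q0' : 0 <= (1 - p)^-1 by rewrite invr_ge0 ltW.
    rewrite /mixed_bound /= !mulr_ge0 ?exprn_ge0 // divr_ge0 ?sqr_ge0 // mulr_ge0 //.
      by rewrite addr_ge0 // invr_ge0 ltW.
    by rewrite addr_ge0 ?mulr_ge0 ?sqr_ge0 ?invr_ge0 // ?(ltW h0) ?mulr_ge0 ?(ltW p0).
  by rewrite /mixed_bound /= lexx orbT.
have kLn : k%:R <= expR L.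
  rewrite eL ler_nat; apply: leq_trans (ltnW kN) _; apply: leq_trans Nm; exact: leq_pmulr.
have S2 : Sm <= expR (2 + 4 * L + mu1).
  apply: le_trans S _; have e2 : 2 <= expR 1 :> R by apply: le_trans (expR_ge1Dx 1).
  rewrite mulrA [expR (_ + mu1)]expRD; apply: ler_wpM2r; first exact: expR_ge0.
  apply: le_trans (_ : expR 2 * k%:R ^+ 4 <= _).
    have -> : expR 2 = expR 1 * expR 1 :> R by rewrite -expRD; congr expR; clear; ring.
    have -> : k.+1%:R * (expR 1 * k%:R ^+ 3) = expR 1 * k%:R ^+ 3 * k.+1%:R :> R by clear; ring.
    have -> : expR 1 * expR 1 * k%:R ^+ 4 = expR 1 * k%:R ^+ 3 * (expR 1 * k%:R) :> R by clear; ring.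
    apply: ler_wpM2l; first by rewrite mulr_ge0 ?expR_ge0 // exprn_ge0.
    apply: le_trans (_ : 2 * k%:R <= _); last by rewrite ler_pM2r.
    by rewrite mulr_natl mulr2n -natr1 lerD2l ler1n.
  have -> : expR (2 + 4 * L) = expR 2 * expR L ^+ 4 by rewrite -expRM_natl -expRD.
  apply: (ler_wpM2l (expR_ge0 _)).
  by rewrite lerXn2r ?nnegrE ?expR_ge0.
pose P2 := gnp_prob p (fun E : {set {set 'I_n}} => max_transversal_forest m E <= k'.-1)%N.
have P20 : 0 <= P2 by apply: gnp_prob_ge0.
(* The minimiser of -ty/2 + (2n/m) y^2/4 for t = cc n/(np); the 2 in 2n/m covers the additional
   colour. *)
pose y := cc / 2 * m%:R * expR (- d).
have ccd : cc <= expR (d / 2) by rewrite (_ : d / 2 = 1 / 2 * d); [apply: H3; clear - d0d d00 x10; lra | clear; ring].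
have y01 : 0 <= y <= 1.
  apply/andP; split; first by rewrite !mulr_ge0 ?expR_ge0 ?invr_ge0 // ltW.
  have E : expR (d / 2) * expR (d / 2) * expR (- d) = 1.
    by rewrite -!expRD -[RHS](expR0 R); congr expR; field.
  rewrite -[leRHS]E /y; apply: (ler_wpM2r (expR_ge0 _)).
  apply: le_trans (_ : cc / 2 * (2 * expR (d / 2)) <= _).
    by apply: ler_wpM2l => //; rewrite divr_ge0 // ltW.
  rewrite (_ : cc / 2 * (2 * expR (d / 2)) = cc * expR (d / 2)); last by clear; field.
  by apply: (ler_wpM2r (expR_ge0 _)).
have t0 : cc * expR (L - d) <= k%:R - k'.-1%:R :> R.
  have [_ _ Qr] := Q_bounds QE p0 peps eps01.
  have : g <= Q * (k%:R - k'.-1%:R) / 2.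
    move: hk' hk2; rewrite -/delta -(prednK k'0) -natr1 /g; clear; lra.
  have Q0 : 0 < Q by have [pQ _ _] := Q_bounds QE p0 peps eps01; apply: lt_le_trans pQ.
  move=> H; have kk0 : 0 <= k%:R - k'.-1%:R :> R.
    by rewrite -(pmulr_rge0 _ Q0); move: H g0; clear; lra.
  have H' : g * eps <= p * (k%:R - k'.-1%:R) / 2.
    rewrite (_ : p * _ / 2 = p / eps * (k%:R - k'.-1%:R) / 2 * eps); last first.
      by rewrite -[in LHS](divfK (lt0r_neq0 e0) p); clear; ring.
    by rewrite ler_pM2r //; apply: le_trans H _; rewrite ler_pM2r // ler_wpM2r.
  rewrite -(ler_pM2r p0) -[leLHS]mulrA ep mulr1 /cc; move: H'; clear; lra.
have k'k : (k'.-1 <= k)%N.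
  by rewrite -(ler_nat R) -subr_ge0; apply: le_trans t0; rewrite mulr_ge0 ?expR_ge0 // ltW.
have conc := @max_transversal_forest_concentration R n p p01 m (1 + y) k k'.-1.
have y0 : 0 <= y by case/andP: y01.
have K1 : 1 <= 1 + y by rewrite lerDl.
have X := concentration_exponent y01 (conc K1) k'k.
rewrite -/P -/P2 -/N in X.
(* F = n (np)^(-3/2). The concentration gain [cc ^+ 2 / 8 * F] is split evenly: one half pays for
   [mu1] ([E2]), the other for the powers of n and the final exp(-L) ([E3]). *)
pose F := expR (L - 3 / 2 * d).
have fieldE (D lo C C' x : R) : D != 0 -> C != 0 ->
    C ^+ 2 / 16 * (2 * lo / D * C' ^+ 2 * (16 / C ^+ 2) * x) = 2 * lo / D * (C' ^+ 2 * x).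
  by clear => Dn Cn; field; rewrite Cn Dn.
have ELd : expR (L - d) = n%:R * expR (- d) by rewrite expRD eL.
have E1 : - ((k%:R - k'.-1%:R) * y / 2) + N.+1%:R * (y ^+ 2 / 4) <= - (cc ^+ 2 / 8 * F).
  have T1 : cc * (n%:R * expR (- d)) * y <= (k%:R - k'.-1%:R) * y.
    by rewrite -ELd; apply: ler_wpM2r.
  have T2 : N.+1%:R * m%:R * (cc / 2 * expR (- d) * y) <= 2 * n%:R * (cc / 2 * expR (- d) * y).
    apply: ler_wpM2r; first by rewrite !mulr_ge0 ?expR_ge0 ?invr_ge0 // ltW.
    rewrite -!natrM ler_nat mulSn mul2n -addnn leq_add //.
    by apply: leq_trans Nm; apply: leq_pmull; apply: leq_ltn_trans kN.
  have T3 : F <= n%:R * m%:R * expR (- d) ^+ 2.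
    have -> : F = n%:R * expR (d / 2) * expR (- d) ^+ 2.
      by rewrite -eL expr2 -!expRD; congr expR; clear; field.
    by rewrite ler_wpM2r ?sqr_ge0 // ler_pM2l.
  have T4 : cc ^+ 2 * F <= cc ^+ 2 * (n%:R * m%:R * expR (- d) ^+ 2) by rewrite ler_wpM2l ?sqr_ge0.
  move: T1 T2 T4; rewrite /y; clear; lra.
have E2 : mu1 <= cc ^+ 2 / 16 * F.
  apply: le_trans (mu_upper (n := n) (k := k) (p := p) QE aE erefl erefl p0 peps eps01 delta01 n0 hk' (ltW low0) a0) _.
  rewrite -/d -/L (_ : F = expR (d / 2) * expR (L - 2 * d)); last first.
    by rewrite -expRD /F; congr expR; clear; field.
  rewrite [leRHS]mulrA; apply: (ler_wpM2r (expR_ge0 _)).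
  have Hx := H1 d (_ : x1 <= d); have x1d : x1 <= d by clear - d0d d00 x30; lra.
  have {Hx} := Hx x1d; rewrite (_ : 1 / 2 * d = d / 2); last by clear; ring.
  have c20 : 0 <= cc ^+ 2 / 16 by rewrite divr_ge0 ?sqr_ge0.
  move/(ler_wpM2l c20); apply: le_trans.
  rewrite (_ : cc ^+ 2 / 16 * _ = 2 * low / (1 - delta) * (c ^+ 2 * (1 + d) ^+ 2)); last first.
    have ccn : cc != 0 by rewrite gt_eqF.
    have dn : 1 - delta != 0 by rewrite subr_eq0 eq_sym lt_eqF.
    exact: fieldE.
  apply: ler_wpM2l.
    by apply: divr_ge0; [apply: mulr_ge0 => //; apply: ltW | rewrite subr_ge0 ltW].
  have c0 : 0 <= c by apply: le_trans c1.
  by rewrite -exprMn lerXn2r ?nnegrE // mulr_ge0 // addr_ge0.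
have E3 : 2 + 5 * L <= cc ^+ 2 / 16 * F.
  have x2L : x2 <= L by clear - L0L s0; lra.
  have H := H2 L x2L; have c20 : 0 < cc ^+ 2 / 16 by rewrite divr_gt0 ?exprn_gt0.
  have HF : expR (1 / 10 * L) <= F by rewrite ler_expR; clear - Ld; lra.
  apply: le_trans (ler_wpM2l (ltW c20) (le_trans H HF)).
  rewrite mulrA (_ : cc ^+ 2 / 16 * (80 / cc ^+ 2) = 5); last first.
    by rewrite mulf_div [_ * 80]mulrC -mulf_div divff ?mulr1 ?gt_eqF ?exprn_gt0 //; clear; field.
  have := mulr_ge0 L0 L0; move: L0; clear; lra.
have P2e : P2 <= expR (- L).
  have Sm0 : 0 <= P2 * P by rewrite mulr_ge0 // gnp_prob_ge0.
  apply: le_trans (_ : P2 * P * Sm <= _).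
    by rewrite -mulrA -[leLHS]mulr1; apply: ler_wpM2l.
  apply: le_trans (ler_wpM2l Sm0 S2) _; rewrite [P2 * P]mulrC.
  apply: le_trans (ler_wpM2r (expR_ge0 _) X) _; rewrite -expRD ler_expR.
  by move: E1 E2 E3; clear; lra.
rewrite gnp_probC lerD2l lerN2; apply: le_trans P2e; apply: le_gnp_prob => // E _.
rewrite -ltnNge => Ek; rewrite -ltnS prednK //; apply: leq_ltn_trans Ek.
exact: max_transversal_forest_le.
Qed.

(** * The upper bound and the theorem *)

(** The first moment is at most the k-th power of exp(1 + d - Q(k-3)/2 + lam/2): the C(n,k) bound
    cancels the k of kr, and r = p/(1-p) supplies the 3. Half of lam pays for replacing 1 + (k-1)r
    by kr, which is why d >= 1/lam is required; the other half remains, and [k_lower] turns it into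
    a negative power of n. *)
Lemma upper_case (R : realType) (eps : R) : 0 < eps < 1 ->
  exists c d0 : R, 0 < c /\ forall (n k : nat) (p : R),
  (0 < n)%N -> (0 < k)%N -> 0 < p -> p < 1 - eps -> d0 <= ln (n%:R * p) ->
  1 + ln (n%:R * p) + ln (1 + eps) <= - ln (1 - p) * (k%:R - 3) / 2 ->
  gnp_prob p (fun E : {set {set 'I_n}} => k <= max_induced_forest E)%N <= expR (- (c * ln n%:R)).
Proof.
move=> eps01; have /andP[e0 e1] := eps01; pose lam := ln (1 + eps).
have l0 : 0 < lam by apply: ln_gt0; lra.
exists (eps * (lam / 2)), lam^-1; split; first by rewrite !mulr_gt0.
move=> n k p n0 k0 p0 peps; set d := ln (n%:R * p); set L := ln n%:R; set Q := - ln (1 - p) => dl hk.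
have QE : Q = - ln (1 - p) by [].
pose a := Q * k%:R / 2; have aE : a = Q * k%:R / 2 by [].
have p01 : 0 < p < 1 by rewrite p0 /=; clear - e0 peps; lra.
have q0 : 0 < 1 - p by rewrite subr_gt0; case/andP: p01.
have d0 : 0 <= d by apply: le_trans dl; rewrite invr_ge0 ltW.
have k0' : 0 < k%:R :> R by rewrite ltr0n.
have [pQ _ Qr] := Q_bounds QE p0 peps eps01.
have Q0 : 0 < Q by apply: lt_le_trans pQ.
have Qr' := Q_le_r p0 peps eps01; rewrite -/Q in Qr'.
have eQ := expRQ peps eps01; rewrite -/Q in eQ.
have eL : expR L = n%:R by apply: expR_L.
have dL : d <= L by apply: (d_le_L (n := n) (p := p) (eps := eps)).
have ed : expR d = n%:R * p by apply: expR_d.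
have a2 : 1 + d <= a by move: hk Q0 l0; rewrite /lam aE; clear; lra.
have kl : eps * (1 + L) <= k%:R.
  apply: (k_lower (n := n) (p := p) (d := d) QE aE _ _ p0 peps eps01) => //.
  by move: a2 d0; clear; lra.
have UB := prob_large_forest n p01 k0; apply: le_trans UB _; set r := p / (1 - p) in Qr' *.
have r0 : 0 < r by rewrite divr_gt0.
have kr0 : 0 < k%:R * r by rewrite mulr_gt0.
have kr : 2 / lam <= k%:R * r.
  apply: le_trans (_ : k%:R * Q <= _); last by rewrite ler_pM2l.
  apply: le_trans (_ : 2 * d <= _); first by rewrite ler_pM2l.
  by move: a2; rewrite aE; clear; lra.
have E3 : (1 + k.-1%:R * r) <= k%:R * r * expR (lam / 2).
  apply: le_trans (_ : k%:R * r * (1 + lam / 2) <= _); last by rewrite ler_pM2l // expR_ge1Dx.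
  have : 1 <= k%:R * r * (lam / 2).
    have {1}-> : 1 = 2 / lam * (lam / 2) by have ln0 := lt0r_neq0 l0; clear - ln0; field.
    by rewrite ler_pM2r // divr_gt0.
  have : k.-1%:R * r <= k%:R * r by rewrite ler_pM2r // ler_nat leq_pred.
  by clear; lra.
have E2 : (1 - p) ^+ 'C(k, 2) = expR (- (Q * (k%:R - 1) / 2)) ^+ k.
  have -> : 1 - p = expR (- Q) by rewrite expRN eQ invrK.
  by rewrite -!expRM_natl natr_bin2; congr expR; clear; field.
apply: le_trans (_ : (expR 1 * n%:R / k%:R) ^+ k * (expR (- (Q * (k%:R - 1) / 2)) ^+ k * (k%:R * r * expR (lam / 2)) ^+ k) <= _).
  have x0 : 0 <= 1 + k.-1%:R * r by rewrite addr_ge0 // mulr_ge0 // ltW.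
  apply: ler_pM => //; first by rewrite mulr_ge0 ?exprn_ge0 // ltW.
    exact: bin_upper.
  rewrite E2 ler_wpM2l ?exprn_ge0 ?expR_ge0 // lerXn2r ?nnegrE //.
  exact: le_trans E3.
rewrite -!exprMn.
have -> : expR 1 * n%:R / k%:R * (expR (- (Q * (k%:R - 1) / 2)) * (k%:R * r * expR (lam / 2))) =
    expR (1 + d + Q - Q * (k%:R - 1) / 2 + lam / 2).
  have -> : expR (1 + d + Q - Q * (k%:R - 1) / 2 + lam / 2) =
      expR 1 * expR d * expR Q * expR (- (Q * (k%:R - 1) / 2)) * expR (lam / 2) by rewrite -!expRD.
  rewrite ed eQ /r; move: (expR (lam / 2)) (expR (- _)) (expR 1) => x y z.
  have qn : 1 - p != 0 by rewrite gt_eqF.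
  have kn : k%:R != 0 :> R by rewrite gt_eqF.
  by clear - qn kn; field; rewrite qn kn.
rewrite -expRM_natl ler_expR.
apply: le_trans (_ : k%:R * (- (lam / 2)) <= _).
  by rewrite ler_pM2l //; move: hk; rewrite /lam; clear; lra.
have : lam / 2 * (eps * (1 + L)) <= lam / 2 * k%:R by rewrite ler_pM2l // divr_gt0.
have : 0 <= lam / 2 * eps by rewrite !mulr_ge0 // ?invr_ge0 // ltW.
by clear; lra.
Qed.

Lemma floor_natE (R : realType) (x : R) : 0 <= x -> Num.floor x = (Num.truncn x)%:Z.
Proof. by move=> x0; rewrite truncn_floor x0 gez0_abs // floor_ge0. Qed.

Lemma forest_size_concentration (R : realType) (eps : R) : 0 < eps < 1 ->
  exists c C L0 : R, [/\ 0 < c, 0 < C & forall (n : nat) (p : R),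
  (0 < n)%N -> L0 <= ln n%:R -> C / n%:R < p < 1 - eps ->
  1 - 4 * expR (- (c * ln n%:R)) <= gnp_prob p (fun G : {set {set 'I_n}} =>
     Num.floor (2 * logb (1 - p)^-1 (expR 1 * n%:R * p * (1 - eps)) + 3)
       <= (max_induced_forest G)%:Z <=
     Num.ceil (2 * logb (1 - p)^-1 (expR 1 * n%:R * p * (1 + eps)) + 3))].
Proof.
move=> eps01; have /andP[e0 e1] := eps01.
have [c1 [d1 [L1 [c10 dense]]]] := dense_case eps01 eps01.
have [d2 [L2 sparse]] := sparse_case eps01.
have [c3 [d3 [c30 upper]]] := upper_case eps01.
pose c := Num.min (Num.min c1 1) c3.
have cc1 : c <= c1 by rewrite !ge_min lexx.
have cc2 : c <= 1 by rewrite !ge_min lexx orbT.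
have cc3 : c <= c3 by rewrite !ge_min lexx !orbT.
(* np > C puts ln(np) above every threshold; the last summand keeps 1 + d + ln(1 - eps) nonnegative,
   so that the floor is a natural number. *)
exists c, (expR (`|d1| + `|d2| + `|d3| + `|ln (1 - eps)|)), (`|L1| + `|L2|).
split; [by rewrite !lt_min c10 ltr01 c30 | exact: expR_gt0 |].
move=> n p n0 LL /andP[Cp peps].
have n0' : 0 < n%:R :> R by rewrite ltr0n.
have p0 : 0 < p by apply: lt_trans Cp; rewrite divr_gt0 ?expR_gt0.
have p01 : 0 < p < 1 by rewrite p0 /=; clear - e0 peps; lra.
have q0 : 0 < 1 - p by rewrite subr_gt0; case/andP: p01.
set d := ln (n%:R * p); set L := ln n%:R in LL *; set Q := - ln (1 - p).
have np0 : 0 < n%:R * p by rewrite mulr_gt0.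
have [L1L L2L L0] : [/\ L1 <= L, L2 <= L & 0 <= L].
  have := ler_norm L1; have := ler_norm L2; have := normr_ge0 L1; have := normr_ge0 L2.
  by move: LL; clear; split; lra.
have dl : `|d1| + `|d2| + `|d3| + `|ln (1 - eps)| <= d.
  rewrite -ler_expR lnK ?posrE // mulrC -ler_pdivrMr //; exact: ltW.
have [d1d d2d d3d dled] : [/\ d1 <= d, d2 <= d, d3 <= d & `|ln (1 - eps)| <= d].
  have := ler_norm d1; have := ler_norm d2; have := ler_norm d3.
  have := normr_ge0 d1; have := normr_ge0 d2; have := normr_ge0 d3; have := normr_ge0 (ln (1 - eps)).
  by move: dl; clear; split; lra.
have [pQ _ _] := Q_bounds (erefl Q) p0 peps eps01; have Q0 : 0 < Q by apply: lt_le_trans pQ.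
have logE x : 0 < x -> logb (1 - p)^-1 (expR 1 * n%:R * p * x) = (1 + d + ln x) / Q.
  move=> x0; rewrite /logb lnV ?posrE // -/Q; congr (_ / _).
  by rewrite lnM ?posrE ?mulr_gt0 ?expR_gt0 // -mulrA lnM ?posrE ?expR_gt0 // expRK.
have e1' : 0 < 1 - eps by rewrite subr_gt0.
have e2' : 0 < 1 + eps by rewrite addr_gt0.
rewrite !logE //.
have lne : - d <= ln (1 - eps) by have := ler_norm (- ln (1 - eps)); rewrite normrN; move: dled; clear; lra.
have floor_spec x (k := Num.truncn (2 * (x / Q) + 3)) : 0 <= x ->
    Q * (k%:R - 3) / 2 <= x /\ x <= Q * (k%:R - 2) / 2.
  move=> x0; have y0 : 0 <= 2 * (x / Q) + 3 by rewrite addr_ge0 // mulr_ge0 // divr_ge0 // ltW.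
  have k1 : k%:R <= 2 * (x / Q) + 3 by rewrite truncn_le.
  have k2 : 2 * (x / Q) + 3 < k%:R + 1 by rewrite natr1 truncnS_gt.
  have xE : x = Q * (x / Q) by rewrite mulrCA mulfV ?mulr1 // gt_eqF.
  have := ler_wpM2l (ltW Q0) k1; have := ler_wpM2l (ltW Q0) (ltW k2).
  by move: xE; clear; split; lra.
set xl := 1 + d + ln (1 - eps); set xu := 1 + d + ln (1 + eps).
have xl0 : 0 <= xl by rewrite /xl; move: lne; clear; lra.
have [kl1 kl2] := floor_spec xl xl0.
set k := Num.truncn (2 * (xl / Q) + 3) in kl1 kl2.
have k0 : (0 < k)%N.
  rewrite lt0n; apply/eqP => k0; move: kl2; rewrite k0; move: Q0 xl0; clear; lra.
have lower : 1 - 3 * expR (- (c * L)) <= gnp_prob p (fun E : {set {set 'I_n}} => k <= max_induced_forest E)%N.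
  (* The dense range works directly at eps; the sparse range starts from the larger size belonging
     to eps/2. *)
  have [Ld|dLs] := leP (3 / 5 * L) d.
    apply: le_trans (dense n k p n0 p0 peps d1d L1L Ld kl1 kl2).
    rewrite lerD2l lerN2 ler_pM2l // ler_expR lerN2; exact: ler_wpM2r.
  have xs0 : 0 <= 1 + d + ln (1 - eps / 2).
    apply: le_trans xl0 _; rewrite lerD2l ler_ln ?posrE //; clear - e0 e1; lra.
  have [ks1 ks2] := floor_spec _ xs0.
  apply: le_trans (sparse n _ k p n0 p0 peps d2d L2L (ltW dLs) ks1 ks2 k0 kl1).
  rewrite lerD2l lerN2; apply: le_trans (_ : expR (- (c * L)) <= _).
    by rewrite ler_expR lerN2 -[leRHS]mul1r; apply: ler_wpM2r.
  by have := expR_ge0 (- (c * L)); clear; lra.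
have xu0 : 0 <= xu by rewrite /xu addr_ge0 ?ln_ge0 ?lerDl ?(ltW e0) // addr_ge0 // (le_trans _ dled).
have y0 : 0 <= 2 * (xu / Q) + 3 by rewrite addr_ge0 // mulr_ge0 // divr_ge0 // ltW.
have [k2 k2E] : exists k2 : nat, Num.ceil (2 * (xu / Q) + 3) = k2%:Z.
  by exists `|Num.ceil (2 * (xu / Q) + 3)|%N; rewrite gez0_abs // ceil_ge0; move: y0; clear; lra.
have k2u : 2 * (xu / Q) + 3 <= k2%:R by have := ceil_ge (2 * (xu / Q) + 3); rewrite k2E.
have hu : xu <= Q * (k2.+1%:R - 3) / 2.
  have xE : xu = Q * (xu / Q) by rewrite mulrCA mulfV ?mulr1 // gt_eqF.
  have := ler_wpM2l (ltW Q0) k2u; rewrite -[k2.+1%:R]natr1; move: xE Q0; clear; lra.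
(* Exceeding the ceiling [k2] means having an induced forest on [k2.+1] vertices. *)
have up := upper n k2.+1 p n0 isT p0 peps d3d hu.
have up' : gnp_prob p (fun E : {set {set 'I_n}} => k2.+1 <= max_induced_forest E)%N <= expR (- (c * L)).
  by apply: le_trans up _; rewrite ler_expR lerN2; apply: ler_wpM2r.
have xlq : 0 <= 2 * (xl / Q) + 3 by rewrite addr_ge0 // mulr_ge0 // divr_ge0 // ltW.
rewrite floor_natE // -/k k2E gnp_probC.
pose A (E : {set {set 'I_n}}) := ~~ (k%:Z <= (max_induced_forest E)%:Z <= k2%:Z).
pose B (E : {set {set 'I_n}}) := ~~ (k <= max_induced_forest E)%N.
pose C (E : {set {set 'I_n}}) := (k2 < max_induced_forest E)%N.
have ABC E : A E -> B E || C E by rewrite /A /B /C !lez_nat negb_and [(k2 < _)%N]ltnNge.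
have := gnp_probU p01 ABC; rewrite -/(A _) -/(B _).
move: lower up'; rewrite gnp_probC -/C -/B -/A; clear; lra.
Qed.

Local Open Scope classical_set_scope.

Theorem theorem1 (R : realType) (eps : R) (heps : 0 < eps) :
  exists C : R, 0 < C /\
    forall p : nat -> R,
      (forall n : nat, 0 < p n < 1) ->
      (\forall n \near \oo, C / n%:R < p n < 1 - eps) ->
      (fun n : nat =>
         let q := (1 - p n)^-1 in
         gnp_prob (p n) (fun G : {set {set 'I_n}} =>
           Num.floor (2 * logb q (expR 1 * n%:R * p n * (1 - eps)) + 3)
             <= (max_induced_forest G)%:Z <=
           Num.ceil (2 * logb q (expR 1 * n%:R * p n * (1 + eps)) + 3)))
        @ \oo --> (1 : R).
Proof.
have [eps1|eps1] := ltP eps 1; last first.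
  (* For eps >= 1 the bound p < 1 - eps contradicts p > 0. *)
  exists 1; split=> // p p01 [N _ H]; have := H N (leqnn N); have := p01 N.
  by case/andP=> p0 _ /andP[_ p1]; exfalso; lra.
have eps01 : 0 < eps < 1 by rewrite heps.
have [c [C [L0 [c0 C0 main]]]] := forest_size_concentration eps01.
exists C; split=> // p p01 hp; apply/cvgrPdist_le => e e0.
have [x0 x00 Hx] := exp_decay (4 / e) c0.
near=> n.
have n0 : (0 < n)%N by near: n; apply: nbhs_infty_ge.
have n0' : 0 < n%:R :> R by rewrite ltr0n.
have lnn (x : R) : expR x <= n%:R -> x <= ln n%:R.
  by move=> xn; rewrite -[x]expRK ler_ln ?posrE ?expR_gt0.
have L0n : L0 <= ln n%:R by apply: lnn; near: n; apply: nbhs_infty_ger.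
have x0n : x0 <= ln n%:R by apply: lnn; near: n; apply: nbhs_infty_ger.
have pn : C / n%:R < p n < 1 - eps by near: n.
have := main n (p n) n0 L0n pn; set P := gnp_prob _ _ => HP.
have P1 : P <= 1 by apply: gnp_prob_le1; apply: p01.
have He : 4 * expR (- (c * ln n%:R)) <= e.
  rewrite expRN ler_pdivrMr ?expR_gt0 // mulrC -ler_pdivrMr //; exact: Hx.
by change (`|1 - P| <= e); rewrite ger0_norm ?subr_ge0 //; clear -HP He; lra.
Unshelve. all: by end_near.
Qed.
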